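(* Let $f:\mathbb{R}^l\times\mathbb{R}^n\to\mathbb{R}^n$ be continuously differentiable, $g:\mathbb{R}^l\times\mathbb{R}^n\times\mathbb{R}^n\to\mathbb{R}^s$ twice continuously differentiable, $D\subset\mathbb{R}^s$ convex polyhedral, $\Gamma(p,x):=\{z\in\mathbb{R}^n\mid g(p,x,z)\in D\}$, $G(p,x):=\widehat N_{\Gamma(p,x)}(x)$, $M:=f+G$ and $S(p):=\{x\in\mathbb{R}^n\mid0\in M(p,x)\}$. Let $\bar x\in S(\bar p)$ and assume that there is $\kappa>0$ such that $\mathrm{dist}(z,\Gamma(p,x))\le\kappa\,\mathrm{dist}(g(p,x,z),D)$ for all $(p,x,z)$ in a neighborhood of $(\bar p,\bar x,\bar x)$. If the second-order condition for isolated calmness (SOCIC) holds at $(\bar p,\bar x)$, then $S$ has the isolated calmness property at $(\bar p,\bar x)$. Conversely, if for every $u\neq0$ in $\mathbb{R}^n$ there holds $$DG\big((\bar p,\bar x),-f(\bar p,\bar x)\big)(0,u)=D\Psi\big((\bar p,\bar x,\bar x),-f(\bar p,\bar x)\big)(0,u,u)$$ and the mapping $M=f+G$ is metrically subregular in direction $(0,u)$ at $((\bar p,\bar x),0)$, then SOCIC is also necessary for the isolated calmness property of $S$ at $(\bar p,\bar x)$.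
   Context: Cones. For a closed set $\Omega\subset\mathbb{R}^d$ and $\bar z\in\Omega$: $T_\Omega(\bar z):=\{u\mid\exists u_k\to u,\ t_k\downarrow0:\ \bar z+t_ku_k\in\Omega\ \forall k\}$ (also used for graphs). $A^\circ$ is the (negative) polar; $\widehat N_\Omega(\bar z):=T_\Omega(\bar z)^\circ$ is the regular normal cone, written $N_\Omega(\bar z)$ for convex $\Omega$. All these cones are $\emptyset$ if $\bar z\notin\Omega$. $[a]^\perp$ is the orthogonal complement of the span $[a]$ of $a$. Critical cone: $\mathcal{K}_D(z,z^* ):=T_D(z)\cap[z^*]^\perp$ for $z^*\in N_D(z)$. $\mathrm{dist}(x,\emptyset)=\infty$. Graphical derivative: $DF(\bar x,\bar y)(u):=\{v\mid(u,v)\in T_{\mathrm{gph}\,F}(\bar x,\bar y)\}$. Directional metric subregularity. For a direction $u$ and $\rho,\delta>0$ let $\mathcal{V}_{\rho,\delta}(u):=\{d\mid\|d\|\le\rho,\ \big\|\|u\|d-\|d\|u\big\|\le\delta\|u\|\|d\|\}$; a directional neighborhood of $u$ is a set containing some $\mathcal{V}_{\rho,\delta}(u)$. $F$ is metrically subregular in direction $u$ at $(\bar x,\bar y)\in\mathrm{gph}\,F$ if there are a directional neighborhood $\mathcal{U}$ of $u$ and $\kappa\ge0$ with $\mathrm{dist}(x,F^{-1}(\bar y))\le\kappa\,\mathrm{dist}(\bar y,F(x))$ for all $x\in\bar x+\mathcal{U}$. Isolated calmness of $S$ at $(\bar p,\bar x)\in\mathrm{gph}\,S$: there are a neighborhood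 $U$ of $\bar x$, a neighborhood $V$ of $\bar p$ and $L\ge0$ such that $S(p)\cap U\subset\{\bar x\}+L\|p-\bar p\|\mathcal{B}$ for all $p\in V$, $\mathcal{B}$ being the closed unit ball. Notation. $\nabla$ is the Jacobian, $\nabla_i$ the partial Jacobian in the $i$-th argument. $\tilde g(p,x):=g(p,x,x)$, $b(p,x):=\nabla_3g(p,x,x)$, $\Psi(p,x,z):=\widehat N_{\Gamma(p,x)}(z)$, $\mathcal{L}_\lambda(p,x):=f(p,x)+b(p,x)^T\lambda$. For $y=(p,x,z)$ and $v=(q,u,w)$: $\Lambda(y,y^* ):=\{\lambda\in N_D(g(y))\mid\nabla g(y)^T\lambda=y^*\}$ and $\Lambda(y,y^*;v):=\arg\max\{v^T\nabla^2(\lambda^Tg)(y)v\mid\lambda\in\Lambda(y,y^* )\}$. $\Xi((p,x),x^*;(q,u)):=\{\mu\in N_D(\tilde g(p,x))\mid b(p,x)^T\mu=x^*,\ \nabla\tilde g(p,x)(q,u)\in\mathcal{K}_D(\tilde g(p,x),\mu)\}$. $\tilde\Lambda((p,x),x^*;(q,u))$ is the union of the sets $\Lambda((p,x,x),\nabla g(p,x,x)^T\mu;(q,u,u))$ over all $\mu\in\Xi((p,x),x^*;(q,u))$. SOCIC holds at $(\bar p,\bar x)$ if for every $u\neq0$ and every $\lambda\in\tilde\Lambda((\bar p,\bar x),-f(\bar p,\bar x);(0,u))$ with $\nabla_2\tilde g(\bar p,\bar x)u\in\mathcal{K}_D(\tilde g(\bar p,\bar x),\lambda)$ there exists $v\in\mathbb{R}^n$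 such that $b(\bar p,\bar x)v\in T_{\mathcal{K}_D(\tilde g(\bar p,\bar x),\lambda)}(\nabla_2\tilde g(\bar p,\bar x)u)$ and $v^T\nabla_2\mathcal{L}_\lambda(\bar p,\bar x)u<0$. *)

(* Defs.v *)
From HB Require Import structures.
From mathcomp Require Import all_boot all_order all_algebra.
From mathcomp Require Import all_classical all_reals all_analysis.
Set Implicit Arguments.
Unset Strict Implicit.
Unset Printing Implicit Defensive.
Import Order.TTheory GRing.Theory Num.Theory.
Import numFieldNormedType.Exports.
Local Open Scope classical_set_scope.
Local Open Scope ring_scope.

(* R^m is 'rV[R]_m, and a product of such spaces is their concatenation, with
   pairs given by row_mx.  The library norm `|x| on 'rV[R]_m is the sup norm,
   hence the separate Euclidean norm below; topologies coincide.

   The library Jacobian 'J h x acts on row vectors from the right, so it is the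
   transpose of the usual Jacobian matrix: v *m 'J h x is (nabla h(x)) v, and
   lam *m ('J h x)^T is (nabla h(x))^T lam. *)

Definition dot (R : realType) (m : nat) (u v : 'rV[R]_m) : R :=
  \sum_(i < m) u 0 i * v 0 i.

Definition enorm (R : realType) (m : nat) (u : 'rV[R]_m) : R :=
  Num.sqrt (dot u u).

(* Extended-valued: the distance to the empty set is +oo. *)
Definition dist (R : realType) (m : nat) (x : 'rV[R]_m) (A : set 'rV[R]_m) :
    \bar R :=
  ereal_inf [set (enorm (x - y))%:E | y in A].

Definition C1 (R : realType) (m k : nat) (h : 'rV[R]_m -> 'rV[R]_k) : Prop :=
  (forall x, differentiable h x) /\ continuous (fun x => 'J h x).

(* mxvec turns the matrix-valued map 'J h into a map between row vectors. *)
Definition C2 (R : realType) (m k : nat) (h : 'rV[R]_m -> 'rV[R]_k) : Prop :=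
  (forall x, differentiable h x) /\ C1 (fun x => mxvec ('J h x)).

Definition hessian (R : realType) (m : nat) (h : 'rV[R]_m -> R) (y : 'rV[R]_m) :
    'M[R]_m :=
  \matrix_(i, j)
    ('D_('e_i) (fun y' : 'rV[R]_m => 'D_('e_j) (h : 'rV[R]_m -> R^o) y' : R^o) y
      : R).

Definition convex_polyhedral (R : realType) (m : nat) (D : set 'rV[R]_m) : Prop :=
  exists (k : nat) (a : 'I_k -> 'rV[R]_m) (c : 'I_k -> R),
    D = [set z | forall i, dot (a i) z <= c i].

(* Empty when z is not in Om, also if Om is not closed. *)
Definition tangent_cone (R : realType) (m : nat) (Om : set 'rV[R]_m)
    (z : 'rV[R]_m) : set 'rV[R]_m :=
  [set u | Om z /\
    exists (u_ : nat -> 'rV[R]_m) (t_ : nat -> R),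
      [/\ u_ @ \oo --> u, (forall k, 0 < t_ k), t_ @ \oo --> (0 : R)
        & forall k, Om (z + t_ k *: u_ k)]].

Definition polar (R : realType) (m : nat) (A : set 'rV[R]_m) : set 'rV[R]_m :=
  [set w | forall v, A v -> dot w v <= 0].

(* The membership test is needed: the polar of the empty set is everything. *)
Definition normal_cone (R : realType) (m : nat) (Om : set 'rV[R]_m)
    (z : 'rV[R]_m) : set 'rV[R]_m :=
  [set w | Om z /\ polar (tangent_cone Om z) w].

Definition perp (R : realType) (m : nat) (a : 'rV[R]_m) : set 'rV[R]_m :=
  [set w | dot a w = 0].

Definition critical_cone (R : realType) (m : nat) (D : set 'rV[R]_m)
    (z zs : 'rV[R]_m) : set 'rV[R]_m :=
  tangent_cone D z `&` perp zs.

Definition gph (R : realType) (m k : nat) (F : 'rV[R]_m -> set 'rV[R]_k) :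
    set 'rV[R]_(m + k) :=
  [set xy | F (lsubmx xy) (rsubmx xy)].

Definition graphical_derivative (R : realType) (m k : nat)
    (F : 'rV[R]_m -> set 'rV[R]_k) (x : 'rV[R]_m) (y : 'rV[R]_k)
    (u : 'rV[R]_m) : set 'rV[R]_k :=
  [set v | tangent_cone (gph F) (row_mx x y) (row_mx u v)].

Definition dir_cone (R : realType) (m : nat) (u : 'rV[R]_m) (rho delta : R) :
    set 'rV[R]_m :=
  [set d | enorm d <= rho /\
    enorm (enorm u *: d - enorm d *: u) <= delta * enorm u * enorm d].

Definition dir_nbhs (R : realType) (m : nat) (u : 'rV[R]_m)
    (U : set 'rV[R]_m) : Prop :=
  exists rho delta : R, [/\ 0 < rho, 0 < delta & dir_cone u rho delta `<=` U].

Definition metric_subregular_dir (R : realType) (m k : nat)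
    (F : 'rV[R]_m -> set 'rV[R]_k) (u x : 'rV[R]_m) (y : 'rV[R]_k) : Prop :=
  F x y /\
  exists (U : set 'rV[R]_m) (kappa : R), [/\ dir_nbhs u U, 0 <= kappa &
    forall d, U d ->
      (dist (x + d) [set x' | F x' y] <= kappa%:E * dist y (F (x + d)%R))%E].

Definition isolated_calm (R : realType) (m k : nat)
    (S : 'rV[R]_m -> set 'rV[R]_k) (p : 'rV[R]_m) (x : 'rV[R]_k) : Prop :=
  S p x /\
  exists (U : set 'rV[R]_k) (V : set 'rV[R]_m) (L : R),
    [/\ nbhs x U, nbhs p V, 0 <= L &
      forall p', V p' ->
        S p' `&` U `<=`
          [set x + (L * enorm (p' - p)) *: e | e in [set e | enorm e <= 1]]].

(* Triples (p, x, z) in R^l x R^n x R^n and their components. *)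
Definition trip (R : realType) (l n : nat) (p : 'rV[R]_l) (x z : 'rV[R]_n) :
    'rV[R]_(l + (n + n)) :=
  row_mx p (row_mx x z).

Definition pr1 (R : realType) (l n : nat) (y : 'rV[R]_(l + (n + n))) :
  'rV[R]_l := lsubmx y.
Definition pr2 (R : realType) (l n : nat) (y : 'rV[R]_(l + (n + n))) :
  'rV[R]_n := lsubmx (rsubmx y).
Definition pr3 (R : realType) (l n : nat) (y : 'rV[R]_(l + (n + n))) :
  'rV[R]_n := rsubmx (rsubmx y).

Definition Gamma (R : realType) (l n s : nat)
    (g : 'rV[R]_(l + (n + n)) -> 'rV[R]_s) (D : set 'rV[R]_s)
    (p : 'rV[R]_l) (x : 'rV[R]_n) : set 'rV[R]_n :=
  [set z | D (g (trip p x z))].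

Definition Psi (R : realType) (l n s : nat)
    (g : 'rV[R]_(l + (n + n)) -> 'rV[R]_s) (D : set 'rV[R]_s)
    (y : 'rV[R]_(l + (n + n))) : set 'rV[R]_n :=
  normal_cone (Gamma g D (pr1 y) (pr2 y)) (pr3 y).

Definition Gmap (R : realType) (l n s : nat)
    (g : 'rV[R]_(l + (n + n)) -> 'rV[R]_s) (D : set 'rV[R]_s)
    (y : 'rV[R]_(l + n)) : set 'rV[R]_n :=
  normal_cone (Gamma g D (lsubmx y) (rsubmx y)) (rsubmx y).

Definition Mmap (R : realType) (l n s : nat) (f : 'rV[R]_(l + n) -> 'rV[R]_n)
    (g : 'rV[R]_(l + (n + n)) -> 'rV[R]_s) (D : set 'rV[R]_s)
    (y : 'rV[R]_(l + n)) : set 'rV[R]_n :=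
  [set f y + w | w in Gmap g D y].

Definition Smap (R : realType) (l n s : nat) (f : 'rV[R]_(l + n) -> 'rV[R]_n)
    (g : 'rV[R]_(l + (n + n)) -> 'rV[R]_s) (D : set 'rV[R]_s)
    (p : 'rV[R]_l) : set 'rV[R]_n :=
  [set x | Mmap f g D (row_mx p x) 0].

Definition gtilde (R : realType) (l n s : nat)
    (g : 'rV[R]_(l + (n + n)) -> 'rV[R]_s) (y : 'rV[R]_(l + n)) : 'rV[R]_s :=
  g (trip (lsubmx y) (rsubmx y) (rsubmx y)).

(* The transpose of b(p,x) = nabla_3 g(p,x,x), as for 'J. *)
Definition bT (R : realType) (l n s : nat)
    (g : 'rV[R]_(l + (n + n)) -> 'rV[R]_s) (p : 'rV[R]_l) (x : 'rV[R]_n) :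
    'M[R]_(n, s) :=
  'J (fun z : 'rV[R]_n => g (trip p x z)) x.

Definition Lagr (R : realType) (l n s : nat) (f : 'rV[R]_(l + n) -> 'rV[R]_n)
    (g : 'rV[R]_(l + (n + n)) -> 'rV[R]_s) (lam : 'rV[R]_s)
    (p : 'rV[R]_l) (x : 'rV[R]_n) : 'rV[R]_n :=
  f (row_mx p x) + lam *m (bT g p x)^T.

Definition Lambda (R : realType) (l n s : nat)
    (g : 'rV[R]_(l + (n + n)) -> 'rV[R]_s) (D : set 'rV[R]_s)
    (y ys : 'rV[R]_(l + (n + n))) : set 'rV[R]_s :=
  [set lam | normal_cone D (g y) lam /\ lam *m ('J g y)^T = ys].

Definition curvature (R : realType) (m s : nat) (g : 'rV[R]_m -> 'rV[R]_s)
    (y v : 'rV[R]_m) (lam : 'rV[R]_s) : R :=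
  dot (v *m hessian (fun y' => dot lam (g y')) y) v.

(* The set of maximizers; empty if the maximum is not attained. *)
Definition Lambda_dir (R : realType) (l n s : nat)
    (g : 'rV[R]_(l + (n + n)) -> 'rV[R]_s) (D : set 'rV[R]_s)
    (y ys v : 'rV[R]_(l + (n + n))) : set 'rV[R]_s :=
  [set lam | Lambda g D y ys lam /\
    forall lam', Lambda g D y ys lam' ->
      curvature g y v lam' <= curvature g y v lam].

Definition Xi (R : realType) (l n s : nat)
    (g : 'rV[R]_(l + (n + n)) -> 'rV[R]_s) (D : set 'rV[R]_s)
    (p : 'rV[R]_l) (x xs : 'rV[R]_n) (q : 'rV[R]_l) (u : 'rV[R]_n) :
    set 'rV[R]_s :=
  [set mu | [/\ normal_cone D (gtilde g (row_mx p x)) mu,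
    mu *m (bT g p x)^T = xs &
    critical_cone D (gtilde g (row_mx p x)) mu
      (row_mx q u *m 'J (gtilde g) (row_mx p x))]].

Definition Lambda_tilde (R : realType) (l n s : nat)
    (g : 'rV[R]_(l + (n + n)) -> 'rV[R]_s) (D : set 'rV[R]_s)
    (p : 'rV[R]_l) (x xs : 'rV[R]_n) (q : 'rV[R]_l) (u : 'rV[R]_n) :
    set 'rV[R]_s :=
  \bigcup_(mu in Xi g D p x xs q u)
    Lambda_dir g D (trip p x x) (mu *m ('J g (trip p x x))^T) (trip q u u).

Definition SOCIC (R : realType) (l n s : nat) (f : 'rV[R]_(l + n) -> 'rV[R]_n)
    (g : 'rV[R]_(l + (n + n)) -> 'rV[R]_s) (D : set 'rV[R]_s)
    (p : 'rV[R]_l) (x : 'rV[R]_n) : Prop :=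
  let gx := gtilde g (row_mx p x) in
  forall u : 'rV[R]_n, u != 0 ->
  let w := u *m 'J (fun x' : 'rV[R]_n => gtilde g (row_mx p x')) x in
  forall lam : 'rV[R]_s,
    Lambda_tilde g D p x (- f (row_mx p x)) 0 u lam ->
    critical_cone D gx lam w ->
    exists v : 'rV[R]_n,
      tangent_cone (critical_cone D gx lam) w (v *m bT g p x) /\
      dot v (u *m 'J (Lagr f g lam p) x) < 0.

(* Main.v *)
Require Import Defs.
From mathcomp Require Import all_boot all_order all_algebra.
From mathcomp Require Import all_classical all_reals all_analysis.
From mathcomp Require Import ring lra.
Set Implicit Arguments.
Unset Strict Implicit.
Unset Printing Implicit Defensive.
Import Order.TTheory GRing.Theory Num.Theory.
Import numFieldNormedType.Exports.
Local Open Scope classical_set_scope.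
Local Open Scope ring_scope.

(** Write y = (p, x, z), ybar = (pbar, xbar, xbar), J for the Jacobian of g at ybar,
    v = (0, u, u) and w = J v. The set D is polyhedral, so near g(ybar) it is a translate
    of its tangent cone, normal cones are generated by the active constraints, and all
    duality arguments reduce to Farkas' lemma ([weyl], [farkas]).

    Sufficiency. If isolated calmness fails, there are solutions x_k of the problems with
    parameters p_k such that |p_k - pbar| is negligible compared with t_k = |x_k - xbar|.
    Metric subregularity of the constraints gives multipliers lam_k that stay bounded
    ([multiplier_bound]), so in the limit there are a direction u of norm 1 and a
    multiplier mu. The active set at g(p_k, x_k, x_k) may be taken constant, so mu and
    lam_k are orthogonal to g(p_k, x_k, x_k) - g(ybar). To first order this says that w is
    in the critical cone of mu; to second order, comparison with any other multiplier of
    the same J^T mu says that mu maximizes the curvature. Hence mu is one of the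
    multipliers of the second-order condition. Since lam_k - mu is normal to the critical
    cone at w, subtracting the stationarity equations and dividing by t_k shows that no
    admissible vector has a negative product with the derivative of the Lagrangian.

    Necessity. If the second-order condition fails at u and lam, Farkas' lemma gives a
    normal eta to the critical cone at w with D_x L_lam u + b^T eta = 0. The multiplier
    lam maximizes the curvature, so linear programming duality provides a second-order
    correction zeta of the direction v, orthogonal to lam and, after a change of eta that
    preserves J^T eta, to eta as well ([second_order_corrector]). Along the curve
    y(t) = ybar + t v + (t^2 / 2) zeta, the vector g(y(t)) is within o(t^2) of a point of
    D at which lam + t eta is normal. Subregularity of the constraints only provides
    feasible points within o(t^2) of y(t), with no control of their normals. A normal
    close to b^T (lam + t eta) is found by minimizing a strongly convex quadratic function
    over the feasible set near y(t): comparison of values puts the minimizer within o(t)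
    of y(t), and its optimality condition is the required normal up to o(t)
    ([nearby_normal], [eventually_nearby_normal]). Thus - D_x f u belongs to the graphical
    derivative of Psi, by assumption to that of G, and directional subregularity of M
    turns the approximate solutions so obtained into solutions that violate isolated
    calmness ([calm_subregular_contradiction]). *)

(** * Euclidean structure of row vectors *)

Section Euclid.
Context {R : realType}.

Lemma dotE m (u v : 'rV[R]_m) : dot u v = (u *m v^T) 0 0.
Proof. by rewrite mxE; apply: eq_bigr => i _; rewrite mxE. Qed.

Lemma dotC m (u v : 'rV[R]_m) : dot u v = dot v u.
Proof. by apply: eq_bigr => i _; rewrite mulrC. Qed.

Lemma dotDl m (u v w : 'rV[R]_m) : dot (u + v) w = dot u w + dot v w.
Proof. by rewrite !dotE mulmxDl mxE. Qed.

Lemma dotDr m (u v w : 'rV[R]_m) : dot w (u + v) = dot w u + dot w v.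
Proof. by rewrite dotC dotDl !(dotC w). Qed.

Lemma dotZl m (a : R) (u v : 'rV[R]_m) : dot (a *: u) v = a * dot u v.
Proof. by rewrite !dotE -scalemxAl mxE. Qed.

Lemma dotZr m (a : R) (u v : 'rV[R]_m) : dot u (a *: v) = a * dot u v.
Proof. by rewrite dotC dotZl dotC. Qed.

Lemma dot0l m (u : 'rV[R]_m) : dot 0 u = 0.
Proof. by rewrite -(scale0r (0 : 'rV[R]_m)) dotZl mul0r. Qed.

Lemma dot0r m (u : 'rV[R]_m) : dot u 0 = 0.
Proof. by rewrite dotC dot0l. Qed.

Lemma dotNl m (u v : 'rV[R]_m) : dot (- u) v = - dot u v.
Proof. by rewrite -scaleN1r dotZl mulN1r. Qed.

Lemma dotNr m (u v : 'rV[R]_m) : dot u (- v) = - dot u v.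
Proof. by rewrite dotC dotNl dotC. Qed.

Lemma dotBl m (u v w : 'rV[R]_m) : dot (u - v) w = dot u w - dot v w.
Proof. by rewrite dotDl dotNl. Qed.

Lemma dotBr m (u v w : 'rV[R]_m) : dot w (u - v) = dot w u - dot w v.
Proof. by rewrite dotDr dotNr. Qed.

Definition dot_lin :=
  (dotDl, dotDr, dotBl, dotBr, dotNl, dotNr, dotZl, dotZr, dot0l, dot0r).

Lemma dot_mulmx m k (u : 'rV[R]_m) (M : 'M[R]_(m, k)) (v : 'rV[R]_k) :
  dot (u *m M) v = dot u (v *m M^T).
Proof. by rewrite !dotE trmx_mul trmxK mulmxA. Qed.

Lemma dot_row_mx m k (a c : 'rV[R]_m) (b d : 'rV[R]_k) :
  dot (row_mx a b) (row_mx c d) = dot a c + dot b d.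
Proof. by rewrite !dotE tr_row_mx mul_row_col mxE. Qed.

Lemma dot_scalar1 (b : 'rV[R]_1) (r : R) : dot b r%:M = b 0 0 * r.
Proof. by rewrite /dot big_ord1 mxE eqxx mulr1n. Qed.

Lemma dot_ge0 m (u : 'rV[R]_m) : 0 <= dot u u.
Proof. by apply: sumr_ge0 => i _; rewrite -expr2 sqr_ge0. Qed.

Lemma dot_eq0 m (u : 'rV[R]_m) : dot u u = 0 -> u = 0.
Proof.
move=> /eqP; rewrite psumr_eq0 => [/allP h|i _]; last by rewrite -expr2 sqr_ge0.
apply/rowP => i; rewrite mxE; have := h i (mem_index_enum _).
by rewrite mulf_eq0 orbb => /eqP.
Qed.

Lemma dot_deltar m (u : 'rV[R]_m) i : dot u 'e_i = u 0 i.
Proof.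
rewrite /dot (bigD1 i) //= mxE !eqxx mulr1 big1 ?addr0 // => j ji.
by rewrite mxE (negbTE ji) andbF mulr0.
Qed.

Lemma enorm_ge0 m (u : 'rV[R]_m) : 0 <= enorm u.
Proof. exact: sqrtr_ge0. Qed.

Lemma enorm_sqr m (u : 'rV[R]_m) : enorm u ^+ 2 = dot u u.
Proof. by rewrite sqr_sqrtr ?dot_ge0. Qed.

Lemma enorm_eq0 m (u : 'rV[R]_m) : enorm u = 0 -> u = 0.
Proof. by move=> h; apply: dot_eq0; rewrite -enorm_sqr h expr0n. Qed.

Lemma enorm0 m : enorm (0 : 'rV[R]_m) = 0.
Proof. by rewrite /enorm dot0l sqrtr0. Qed.

Lemma enorm_gt0 m (u : 'rV[R]_m) : u != 0 -> 0 < enorm u.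
Proof.
move=> u0; rewrite lt_def enorm_ge0 andbT; apply: contraNN u0 => /eqP.
by move/enorm_eq0/eqP.
Qed.

Lemma enormZ m (a : R) (u : 'rV[R]_m) : enorm (a *: u) = `|a| * enorm u.
Proof.
by rewrite /enorm dotZl dotZr mulrA -expr2 sqrtrM ?sqr_ge0 // sqrtr_sqr.
Qed.

Lemma enormN m (u : 'rV[R]_m) : enorm (- u) = enorm u.
Proof. by rewrite /enorm dotNl dotNr opprK. Qed.

Lemma enormB m (u v : 'rV[R]_m) : enorm (u - v) = enorm (v - u).
Proof. by rewrite -enormN opprB. Qed.

Lemma cauchy_schwarz m (u v : 'rV[R]_m) : dot u v <= enorm u * enorm v.
Proof.
have [->|u0] := eqVneq u 0; first by rewrite dot0l enorm0 mul0r.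
have [->|v0] := eqVneq v 0; first by rewrite dot0r enorm0 mulr0.
have pu := enorm_gt0 u0; have pv := enorm_gt0 v0.
have := dot_ge0 (enorm v *: u - enorm u *: v).
rewrite !dot_lin -!enorm_sqr (dotC v u) => h.
rewrite -(ler_pM2l (mulr_gt0 pu pv)).
by nra.
Qed.

Lemma cauchy_schwarz_norm m (u v : 'rV[R]_m) : `|dot u v| <= enorm u * enorm v.
Proof.
rewrite ler_norml cauchy_schwarz andbT lerNl -dotNl.
by rewrite -(enormN u) cauchy_schwarz.
Qed.

Lemma enormD m (u v : 'rV[R]_m) : enorm (u + v) <= enorm u + enorm v.
Proof.
rewrite -ler_sqr ?nnegrE ?addr_ge0 ?enorm_ge0 //.
rewrite enorm_sqr !dot_lin (dotC v u) sqrrD !enorm_sqr.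
have := cauchy_schwarz u v; lra.
Qed.

Lemma coord_le_enorm m (u : 'rV[R]_m) i : `|u 0 i| <= enorm u.
Proof.
have := cauchy_schwarz_norm u 'e_i; rewrite dot_deltar => /le_trans; apply.
suff -> : enorm ('e_i : 'rV[R]_m) = 1 by rewrite mulr1.
by rewrite /enorm dot_deltar mxE !eqxx sqrtr1.
Qed.

Lemma enorm_row_mxl m k (a : 'rV[R]_m) (b : 'rV[R]_k) :
  enorm a <= enorm (row_mx a b).
Proof. by rewrite ler_sqrt dot_row_mx ?lerDl ?dot_ge0 // addr_ge0 ?dot_ge0. Qed.

Lemma enorm_row_mxr m k (a : 'rV[R]_m) (b : 'rV[R]_k) :
  enorm b <= enorm (row_mx a b).
Proof. by rewrite ler_sqrt dot_row_mx ?lerDr ?dot_ge0 // addr_ge0 ?dot_ge0. Qed.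

Lemma enorm_row_mx_le m k (a : 'rV[R]_m) (b : 'rV[R]_k) :
  enorm (row_mx a b) <= enorm a + enorm b.
Proof.
rewrite -ler_sqr ?nnegrE ?addr_ge0 ?enorm_ge0 //.
rewrite enorm_sqr dot_row_mx sqrrD !enorm_sqr.
have := mulr_ge0 (enorm_ge0 a) (enorm_ge0 b); lra.
Qed.

(** * Finitely generated cones and linear programming duality *)

(** The cone generated by a list, by recursion so that Weyl's theorem can be proved
    one generator at a time. *)
Fixpoint fgcone m (A : seq 'rV[R]_m) : set 'rV[R]_m :=
  if A is a :: A' then [set y | exists2 c, 0 <= c & fgcone A' (y - c *: a)]
  else [set 0].

Definition halfspaces m (A : seq 'rV[R]_m) : set 'rV[R]_m :=
  [set y | forall a, a \in A -> dot a y <= 0].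

Lemma fgcone0 m (A : seq 'rV[R]_m) : fgcone A 0.
Proof. by elim: A => //= a A IH; exists 0; rewrite // scale0r subr0. Qed.

Lemma fgconeD m (A : seq 'rV[R]_m) x y :
  fgcone A x -> fgcone A y -> fgcone A (x + y).
Proof.
elim: A x y => [|a A IH] x y /=; first by move=> -> ->; rewrite addr0.
move=> [c c0 xc] [d d0 yd]; exists (c + d); first exact: addr_ge0.
by rewrite scalerDl opprD addrACA; exact: IH.
Qed.

Lemma fgconeZ m (A : seq 'rV[R]_m) (t : R) x :
  0 <= t -> fgcone A x -> fgcone A (t *: x).
Proof.
move=> t0; elim: A x => [|a A IH] x /=; first by move=> ->; rewrite scaler0.
move=> [c c0 xc]; exists (t * c); first exact: mulr_ge0.
by rewrite -scalerA -scalerBr; exact: IH.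
Qed.

Lemma fgcone_mem m (A : seq 'rV[R]_m) a : a \in A -> fgcone A a.
Proof.
elim: A => //= b A IH; rewrite inE => /orP[/eqP ->|/IH h].
  by exists 1; rewrite ?ler01 // scale1r subrr; exact: fgcone0.
by exists 0; rewrite // scale0r subr0.
Qed.

(** Induction principle for generated cones: all later inclusions of such a cone in
    a convex cone go through it. *)
Lemma fgcone_min m (A : seq 'rV[R]_m) (P : set 'rV[R]_m) :
  P 0 -> (forall x a c, P x -> a \in A -> 0 <= c -> P (x + c *: a)) ->
  fgcone A `<=` P.
Proof.
move=> P0; elim: A => [|a A IH] Padd x /=; first by move=> ->.
move=> [c c0 /IH h]; rewrite -(subrK (c *: a) x).
apply: (Padd) => //; last by rewrite mem_head.
by apply: h => y b d Py bA; apply: (Padd); rewrite // inE bA orbT.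
Qed.

Lemma fgcone_sub m (A B : seq 'rV[R]_m) :
  {subset A <= B} -> fgcone A `<=` fgcone B.
Proof.
move=> AB; apply: fgcone_min; first exact: fgcone0.
move=> x a c xB aA c0; apply: fgconeD => //; apply: fgconeZ => //.
by apply: fgcone_mem; exact: AB.
Qed.

Lemma fgcone_halfspaces m (A : seq 'rV[R]_m) x y :
  fgcone A x -> halfspaces A y -> dot x y <= 0.
Proof.
move=> xA yA; move: x xA; apply: fgcone_min; first by rewrite /= dot0l.
move=> x a c /= xy aA c0; rewrite dotDl dotZl.
by have := mulr_ge0_le0 c0 (yA _ aA); lra.
Qed.

Lemma fgcone_rcons m (A : seq 'rV[R]_m) b x :
  fgcone (rcons A b) x -> exists2 c, 0 <= c & fgcone A (x - c *: b).
Proof.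
move=> h; have : fgcone (b :: A) x.
  by apply: fgcone_sub h => y; rewrite mem_rcons.
by case=> c c0 h'; exists c.
Qed.

Lemma fgcone_map m k (A : seq 'rV[R]_m) (M : 'M[R]_(m, k)) y :
  fgcone [seq a *m M | a <- A] y -> exists2 x, fgcone A x & x *m M = y.
Proof.
move: y; apply: fgcone_min.
  by exists 0; [exact: fgcone0 | rewrite mul0mx].
move=> _ _ c [x xA <-] /mapP[a aA ->] c0; exists (x + c *: a).
  by apply: fgconeD => //; apply: fgconeZ => //; exact: fgcone_mem.
by rewrite mulmxDl -scalemxAl.
Qed.

Lemma fgcone_map_mem m k (A : seq 'rV[R]_m) (M : 'M[R]_(m, k)) x :
  fgcone A x -> fgcone [seq a *m M | a <- A] (x *m M).
Proof.
move: x; apply: fgcone_min; first by rewrite /= mul0mx; exact: fgcone0.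
move=> x a c /= h aA c0; rewrite mulmxDl -scalemxAl.
by apply: fgconeD => //; apply: fgconeZ => //; apply: fgcone_mem; exact: map_f.
Qed.

(** The existence part of one step of Fourier-Motzkin elimination: a number fits
    between finitely many lower and upper bounds as soon as each pair of bounds is
    compatible. *)
Lemma exists_between (T : eqType) (L U : seq T) (lo up : T -> R) :
  (forall x, x \in L -> 0 <= up x) ->
  (forall x y, x \in L -> y \in U -> lo y <= up x) ->
  exists c, [/\ 0 <= c, forall x, x \in L -> c <= up x
     & forall y, y \in U -> lo y <= c].
Proof.
move=> L0; elim: U => [|y U IH] LU; first by exists 0.
have [|c [c0 cL cU]] := IH; first by move=> x z xL zU; apply: LU; rewrite // inE zU orbT.
exists (Num.max c (lo y)); split.
- by rewrite le_max c0.
- by move=> x xL; rewrite ge_max cL //= LU // mem_head.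
- move=> z; rewrite inE => /orP[/eqP ->|zU]; first by rewrite le_max lexx orbT.
  by rewrite le_max cU.
Qed.

(** Fourier-Motzkin elimination. If the cone of the tail is [B y <= 0], then y is in
    the cone with the extra generator a when some c >= 0 satisfies B (y - c a) <= 0.
    Eliminating c keeps the rows that are nonpositive on a and combines each row p
    with [p . a > 0] with each row q with [q . a < 0]. *)
Lemma weyl m (A : seq 'rV[R]_m) : exists B, fgcone A = halfspaces B.
Proof.
elim: A => [|a A [B EB]].
  exists ([seq 'e_i | i <- enum 'I_m] ++ [seq - 'e_i | i <- enum 'I_m]).
  apply/seteqP; split => [_ -> b _|y /= h]; first by rewrite dot0r.
  apply/rowP => i; rewrite mxE; apply/eqP; rewrite eq_le.
  have h1 : 'e_i \in [seq ('e_i : 'rV[R]_m) | i <- enum 'I_m].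
    by apply: map_f; rewrite mem_enum.
  have h2 : - 'e_i \in [seq - ('e_i : 'rV[R]_m) | i <- enum 'I_m].
    by apply: map_f; rewrite mem_enum.
  have := h 'e_i; have := h (- 'e_i).
  rewrite !mem_cat h1 h2 orbT => /(_ isT) + /(_ isT).
  by rewrite dotNl dotC dot_deltar oppr_le0 => -> ->.
pose Z := [seq b <- B | dot b a <= 0].
pose P := [seq b <- B | dot b a > 0].
pose N := [seq b <- B | dot b a < 0].
exists (Z ++ [seq dot p a *: q - dot q a *: p | p <- P, q <- N]).
apply/seteqP; split => y /=.
  move=> [c c0]; rewrite EB => h b; rewrite mem_cat mem_filter.
  move=> /orP[/andP[ba bB]|/allpairsP[[p q] /= []]].
    have := h b bB; rewrite dotBr dotZr.
    by have := mulr_ge0_le0 c0 ba; lra.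
  rewrite !mem_filter => /andP[pa pB] /andP[qa qB] ->.
  have := h p pB; have := h q qB; rewrite !dot_lin => hq hp.
  have /(ler_wpM2l (ltW pa)) : dot q y <= c * dot q a by lra.
  have /(ler_wnM2l (ltW qa)) : dot p y <= c * dot p a by lra.
  lra.
move=> h.
have hZ b : b \in B -> dot b a <= 0 -> dot b y <= 0.
  by move=> bB ba; apply: h; rewrite mem_cat mem_filter ba bB.
have [||c [c0 cN cP]] := @exists_between _ N P (fun p => dot p y / dot p a)
  (fun q => dot q y / dot q a).
- move=> q; rewrite mem_filter => /andP[qa qB].
  by rewrite mulr_le0 ?invr_le0 ?(ltW qa) //; apply: hZ => //; exact: ltW.
- move=> q p qN pP.
  have := h (dot p a *: q - dot q a *: p).
  rewrite mem_cat (_ : (_ \in [seq _ | p <- P, q <- N])); last first.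
    by apply/allpairsP; exists (p, q).
  rewrite orbT => /(_ isT); rewrite !dot_lin.
  move: qN pP; rewrite !mem_filter => /andP[qa qB] /andP[pa pB] hh.
  rewrite ler_pdivrMr // mulrAC ler_ndivlMr //; lra.
exists c => //; rewrite EB => b bB; rewrite dotBr dotZr subr_le0.
have [ba|ba|ba] := ltgtP (dot b a) 0.
- by have := cN b; rewrite mem_filter ba bB => /(_ isT); rewrite ler_ndivlMr.
- by have := cP b; rewrite mem_filter ba bB => /(_ isT); rewrite ler_pdivrMr.
- by rewrite ba mulr0; apply: hZ => //; rewrite ba.
Qed.

(** By Weyl's theorem the cone is cut out by finitely many half-spaces; each of their
    normals b is nonpositive on the generators, so the hypothesis applies to b. *)
Lemma farkas m (A : seq 'rV[R]_m) x :
  (forall y, halfspaces A y -> dot x y <= 0) -> fgcone A x.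
Proof.
have [B EB] := weyl A => h; rewrite EB => b bB; rewrite dotC; apply: h => a aA.
by rewrite dotC; have := fgcone_mem aA; rewrite EB; exact.
Qed.

Lemma fgcone_separation m (A : seq 'rV[R]_m) x :
  ~ fgcone A x -> exists2 y, halfspaces A y & 0 < dot x y.
Proof.
move=> nx; apply: contrapT => h; apply: nx; apply: farkas => y yA.
by rewrite leNgt; apply/negP => xy; apply: h; exists y.
Qed.

Lemma mul_value_mx m s (M : 'M[R]_(s, m)) (q a : 'rV[R]_s) :
  a *m row_mx M q^T = row_mx (a *m M) (dot a q)%:M.
Proof. by rewrite mul_mx_row; congr row_mx; rewrite [LHS]mx11_scalar -dotE. Qed.

(** Linear programming duality at a maximizer lam of q. In the cone generated by the
    pairs (a M, a . q), for a in A and for a = - lam, the pair (0, 1) cannot occur,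
    since it would be a feasible direction of increase at lam. A vector separating it
    from the cone, scaled so that its last entry is 1, is the multiplier zeta. *)
Lemma dual_multiplier m s (A : seq 'rV[R]_s) (M : 'M[R]_(s, m))
    (lam q : 'rV[R]_s) :
  fgcone A lam ->
  (forall lam', fgcone A lam' -> lam' *m M = lam *m M -> dot lam' q <= dot lam q) ->
  exists zeta : 'rV[R]_m,
    halfspaces A (q + zeta *m M^T) /\ dot lam (q + zeta *m M^T) = 0.
Proof.
move=> lamA lammax.
pose W : 'M[R]_(s, m + 1) := row_mx M q^T.
have WE a : a *m W = row_mx (a *m M) (dot a q)%:M by exact: mul_value_mx.
have [] := @fgcone_separation _ [seq a *m W | a <- rcons A (- lam)] (row_mx 0 1%:M).
  move=> /fgcone_map[eta etaA]; rewrite WE => /eq_row_mx[etaM].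
  move=> /(congr1 (fun X : 'M[R]_1 => X 0 0)); rewrite !mxE !mulr1n => etaq.
  have [c c0 nu] := fgcone_rcons etaA.
  have c1 : 1 + c != 0 by rewrite lt0r_neq0 // ltr_pwDl.
  have t0 : 0 < (1 + c)^-1 by rewrite invr_gt0 ltr_pwDl.
  have := lammax (lam + (1 + c)^-1 *: eta); rewrite dotDl dotZl etaq mulr1.
  move=> hh; have : dot lam q + (1 + c)^-1 <= dot lam q.
    apply: hh; last by rewrite mulmxDl -scalemxAl etaM scaler0 addr0.
    have -> : lam + (1 + c)^-1 *: eta =
        (1 - (1 + c)^-1 * c) *: lam + (1 + c)^-1 *: (eta - c *: - lam).
      by apply/rowP => i; rewrite !mxE; field.
    apply: fgconeD; apply: fgconeZ => //; last exact: ltW.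
    have -> : 1 - (1 + c)^-1 * c = (1 + c)^-1 by field.
    exact: ltW.
  by rewrite gerDl leNgt t0.
move=> y; rewrite -(hsubmxK y) => hy; rewrite dot_row_mx dot0l add0r.
set z := lsubmx y in hy *; set b := rsubmx y in hy *.
rewrite dotC dot_scalar1 mulr1 => b0.
have hy' a : a \in rcons A (- lam) -> dot a (q + ((b 0 0)^-1 *: z) *m M^T) <= 0.
  move=> aA; have := hy _ (map_f (fun a : 'rV_s => a *m W) aA).
  rewrite WE dot_row_mx (dotC _ b) dot_scalar1.
  rewrite dot_mulmx -scalemxAl dotDr dotZr => h.
  rewrite -(ler_pM2l b0) mulr0 mulrDr mulrA divff ?lt0r_neq0 // mul1r.
  lra.
exists ((b 0 0)^-1 *: z); split => [a aA|].
  by apply: hy'; rewrite mem_rcons inE aA orbT.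
apply/eqP; rewrite eq_le; apply/andP; split.
  by apply: fgcone_halfspaces lamA _ => a aA; apply: hy'; rewrite mem_rcons inE aA orbT.
by have := hy' (- lam); rewrite mem_rcons mem_head dotNl oppr_le0; exact.
Qed.

(** A linear program that is feasible and whose dual is feasible has a maximizer: the
    pairs (a M, a . q) generate a cone that is an intersection of half-spaces, so the
    supremum over its slice through eta M is attained. *)
Lemma maximizer_attained m s (A : seq 'rV[R]_s) (M : 'M[R]_(s, m))
    (eta q : 'rV[R]_s) (zeta : 'rV[R]_m) :
  fgcone A eta -> halfspaces A (q + zeta *m M^T) ->
  exists2 eta', fgcone A eta' /\ eta' *m M = eta *m M &
    forall eta'', fgcone A eta'' -> eta'' *m M = eta *m M ->
      dot eta'' q <= dot eta' q.
Proof.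
move=> etaA dualf.
pose W : 'M[R]_(s, m + 1) := row_mx M q^T.
have WE a : a *m W = row_mx (a *m M) (dot a q)%:M by exact: mul_value_mx.
have [B EB] := weyl [seq a *m W | a <- A].
pose S := [set r : R | fgcone [seq a *m W | a <- A] (row_mx (eta *m M) r%:M)].
have S_of eta' : fgcone A eta' -> eta' *m M = eta *m M -> S (dot eta' q).
  by move=> h e; rewrite /S /= -e -WE; exact: fgcone_map_mem.
have of_S r : S r -> exists2 eta', fgcone A eta' /\ eta' *m M = eta *m M & dot eta' q = r.
  move=> /fgcone_map[eta' h]; rewrite WE => /eq_row_mx[e].
  move=> /(congr1 (fun X : 'M[R]_1 => X 0 0)); rewrite !mxE !mulr1n => etaq.
  by exists eta'.
have Sub : has_ubound S.
  exists (- dot (eta *m M) zeta) => r /of_S[eta' [h <-] <-].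
  have := fgcone_halfspaces h dualf.
  by rewrite dotDr dot_mulmx; lra.
have Ssup : has_sup S by split => //; exists (dot eta q); exact: S_of.
have SE r : S r = halfspaces B (row_mx (eta *m M) r%:M) by rewrite /S /= EB.
have : S (sup S).
  rewrite SE => b bB.
  have hb r : S r -> dot (lsubmx b) (eta *m M) + (rsubmx b) 0 0 * r <= 0.
    by rewrite SE => /(_ b bB); rewrite -{1}(hsubmxK b) dot_row_mx dot_scalar1.
  rewrite -(hsubmxK b) dot_row_mx dot_scalar1.
  have [b0|b0] := leP (rsubmx b 0 0) 0.
    have /hb := S_of _ etaA erefl; apply: le_trans; rewrite lerD2l.
    by apply: ler_wnM2l => //; apply: (ub_le_sup Sub); exact: S_of.
  suff : sup S <= - dot (lsubmx b) (eta *m M) / rsubmx b 0 0.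
    by rewrite ler_pdivlMr //; lra.
  apply: ge_sup; first by case: Ssup.
  by move=> r /hb; rewrite ler_pdivlMr //; lra.
move=> /of_S[eta' e1 e2]; exists eta' => // eta'' h e.
by rewrite e2; apply: (ub_le_sup Sub); exact: S_of.
Qed.

End Euclid.

(** * Topology in the Euclidean norm, tangent cones and polyhedra *)

Section Topology.
Context {R : realType}.

Lemma coord_le_norm m (u : 'rV[R]_m) i : `|u 0 i| <= `|u|.
Proof.
rewrite [leRHS]/Num.norm/= mx_normrE.
by rewrite (le_bigmax _ (fun ij => `|u ij.1 ij.2|) (0, i)).
Qed.

Lemma norm_le_enorm m (u : 'rV[R]_m) : `|u| <= enorm u.
Proof.
rewrite [leLHS]/Num.norm/= mx_normrE; apply: bigmax_le; first exact: enorm_ge0.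
by case=> i j _ /=; rewrite ord1 coord_le_enorm.
Qed.

Lemma enorm_le_norm m (u : 'rV[R]_m) : enorm u <= m.+1%:R * `|u|.
Proof.
rewrite -ler_sqr ?nnegrE ?mulr_ge0 ?enorm_ge0 //.
rewrite enorm_sqr exprMn; apply: (@le_trans _ _ (m%:R * `|u| ^+ 2)).
  rewrite -{2}(card_ord m) -sum1_card natr_sum mulr_suml.
  apply: ler_sum => i _; rewrite mul1r -expr2.
  rewrite -[_ ^+ 2 in leLHS]real_normK ?num_real // ler_sqr ?nnegrE //.
  exact: coord_le_norm.
apply: ler_wpM2r; first exact: sqr_ge0.
by rewrite -natrX ler_nat -mulnn (leq_trans (leqnSn m)) // leq_pmulr.
Qed.

Lemma nbhs_enormP m (x : 'rV[R]_m) (P : set 'rV[R]_m) :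
  nbhs x P <-> exists2 d, 0 < d & forall y, enorm (y - x) < d -> P y.
Proof.
rewrite -nbhs_ballE; split=> [[d /= d0 h]|[d d0 h]].
  exists d => // y yx; apply: h; rewrite -ball_normE /= distrC.
  exact: le_lt_trans (norm_le_enorm _) yx.
exists (d / m.+1%:R); first by rewrite /= divr_gt0.
move=> y; rewrite -ball_normE /= => yx; apply: h; rewrite enormB.
apply: (le_lt_trans (enorm_le_norm _)).
by rewrite -ltr_pdivlMl // mulrC.
Qed.

Lemma cvg_enormP T (F : set_system T) {FF : Filter F} m (u : T -> 'rV[R]_m) (x : 'rV[R]_m) :
  u @ F --> x <-> forall e, 0 < e -> \forall k \near F, enorm (u k - x) < e.
Proof.
split=> [ux e e0|h P /nbhs_enormP[d d0 dP]].
  have /ux// : nbhs x [set y | enorm (y - x) < e].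
  by apply/nbhs_enormP; exists e.
by have := h _ d0; apply: filterS => k; exact: dP.
Qed.

Lemma cvg_dot T (F : set_system T) {FF : Filter F} m (u v : T -> 'rV[R]_m) (x y : 'rV[R]_m) :
  u @ F --> x -> v @ F --> y -> (fun k => dot (u k) (v k)) @ F --> dot x y.
Proof.
move=> ux vy.
have coord (w : T -> 'rV[R]_m) (z : 'rV[R]_m) i : w @ F --> z -> (fun k => w k 0 i) @ F --> z 0 i.
  move=> wz; apply: (@cvg_comp _ _ _ w (fun X : 'rV[R]_m => X 0 i) F _ _ wz).
  exact: coord_continuous.
rewrite /dot; elim: (index_enum _) => [|i r IH].
  under eq_fun do rewrite big_nil.
  by rewrite big_nil; exact: cvg_cst.
under eq_fun do rewrite big_cons.
rewrite big_cons; apply: cvgD IH; apply: cvgM; exact: coord.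
Qed.

Lemma bounded_compact m (x : 'rV[R]_m) (r : R) (A : set 'rV[R]_m) :
  closed A -> (forall y, A y -> enorm (y - x) <= r) -> compact A.
Proof.
move=> Acl Ar; apply: bounded_closed_compact => //.
rewrite /bounded_set /bounded_near; near=> M => y /= /Ar yr.
rewrite -(subrK x y) (le_trans (ler_normD _ _)) //.
apply: (@le_trans _ _ (r + `|x|)); last by near: M; apply: nbhs_pinfty_ge; rewrite num_real.
by rewrite lerD2r (le_trans (norm_le_enorm _)).
Unshelve. all: by end_near. Qed.

Lemma closed_adherentP m (A : set 'rV[R]_m) :
  (forall x, (forall e, 0 < e -> exists2 y, A y & enorm (y - x) < e) -> A x) ->
  closed A.
Proof.
move=> h x clx; apply: h => e e0.
have [|y [Ay yx]] := clx [set y | enorm (y - x) < e].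
  by apply/nbhs_enormP; exists e.
by exists y.
Qed.

Lemma closed_enorm_ball m (c : 'rV[R]_m) (r : R) :
  closed [set y : 'rV[R]_m | enorm (y - c) <= r].
Proof.
apply: closed_adherentP => x hx /=.
apply/ler_addgt0Pr => e e0; have [y /= yr yx] := hx e e0.
rewrite -(subrK y x) -addrA (le_trans (enormD _ _)) // [leLHS]addrC.
by apply: lerD => //; rewrite enormB ltW.
Qed.

Lemma harmonic_small (e : R) : 0 < e -> \forall k \near \oo, k.+1%:R^-1 < e.
Proof.
move=> e0; have := @cvg_harmonic R => /cvgr_dist_lt /(_ e e0).
by apply: filterS => k; rewrite sub0r normrN gtr0_norm ?invr_gt0.
Qed.

(** A form of the tangent cone without sequences: vectors are shown to be tangent, and
    tangent vectors are used, one tolerance at a time. *)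
Lemma tangent_coneP m (Om : set 'rV[R]_m) z u :
  tangent_cone Om z u <-> Om z /\ forall e, 0 < e ->
    exists t u', [/\ 0 < t, t < e, enorm (u' - u) < e & Om (z + t *: u')].
Proof.
split=> [[Oz [u_ [t_ [uu t0 tt Ou]]]]|[Oz h]].
  split=> // e e0; have /cvg_enormP/(_ e e0) h1 := uu.
  have h2 : \forall k \near \oo, t_ k < e.
    move/cvgr_dist_lt : tt => /(_ e e0); apply: filterS => k.
    by rewrite sub0r normrN gtr0_norm.
  have [k [hk1 hk2]] := filter_ex (filterI h1 h2).
  by exists (t_ k), (u_ k).
split=> //.
have hk k : exists tu : R * 'rV[R]_m, [/\ 0 < tu.1, tu.1 < k.+1%:R^-1,
    enorm (tu.2 - u) < k.+1%:R^-1 & Om (z + tu.1 *: tu.2)].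
  by have [|t [u' h']] := h k.+1%:R^-1; [rewrite invr_gt0|exists (t, u')].
pose tu k := projT1 (cid (hk k)).
have tuP k := projT2 (cid (hk k)).
exists (fun k => (tu k).2), (fun k => (tu k).1); split.
- apply/cvg_enormP => e e0; apply: filterS (harmonic_small e0) => k ke.
  by have [_ _ h' _] := tuP k; exact: lt_trans h' ke.
- by move=> k; have [] := tuP k.
- apply/cvgrPdist_lt => e e0; apply: filterS (harmonic_small e0) => k ke.
  have [p h' _ _] := tuP k; rewrite sub0r normrN gtr0_norm //.
  exact: lt_trans h' ke.
- by move=> k; have [] := tuP k.
Qed.

Definition polyhedron m (l : seq ('rV[R]_m * R)) : set 'rV[R]_m :=
  [set z | forall p, p \in l -> dot p.1 z <= p.2].

Definition active m (l : seq ('rV[R]_m * R)) (z : 'rV[R]_m) : seq 'rV[R]_m :=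
  [seq p.1 | p <- l & dot p.1 z == p.2].

(** Near z only the active constraints matter, so the polyhedron coincides with z plus
    a polyhedral cone on a whole neighbourhood, uniformly in the direction. *)
Lemma polyhedron_local m (l : seq ('rV[R]_m * R)) z : polyhedron l z ->
  exists2 d, 0 < d & forall u, enorm u <= d ->
    polyhedron l (z + u) <-> halfspaces (active l z) u.
Proof.
elim: l => [|p l IH] lz; first by exists 1.
have [|d d0 h] := IH; first by move=> q ql; apply: lz; rewrite inE ql orbT.
have split_p u : polyhedron (p :: l) (z + u) <->
    dot p.1 (z + u) <= p.2 /\ polyhedron l (z + u).
  split=> [H|[H1 H2]].
    by split=> [|q ql]; apply: H; rewrite inE ?eqxx // ql orbT.
  by move=> q; rewrite inE => /orP[/eqP ->|/H2].
have [pz|pz] := eqVneq (dot p.1 z) p.2.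
  exists d => // u ud; rewrite split_p h // /active /= pz eqxx /= dotDr pz.
  rewrite gerDl; split=> [[H1 H2] a|H].
    by rewrite inE => /orP[/eqP ->|/H2].
  by split=> [|a al]; apply: H; rewrite inE ?eqxx // al orbT.
have pz' : 0 < p.2 - dot p.1 z.
  by rewrite subr_gt0 lt_def eq_sym pz /= lz // mem_head.
pose c := (p.2 - dot p.1 z) / (1 + enorm p.1).
have e1 : 0 < 1 + enorm p.1 by rewrite ltr_pwDl // enorm_ge0.
have c0 : 0 < c by rewrite divr_gt0.
exists (Num.min d c); first by rewrite lt_min d0.
move=> u; rewrite le_min => /andP[ud uc]; rewrite split_p h // /active /=.
rewrite (negbTE pz); split=> [[]//|H]; split=> //.
rewrite dotDr -lerBrDl; apply: (le_trans (cauchy_schwarz _ _)).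
apply: (@le_trans _ _ ((1 + enorm p.1) * c)).
  by apply: ler_pM => //; rewrite ?enorm_ge0 // lerDr.
by rewrite /c mulrCA divff ?mulr1 // lt0r_neq0.
Qed.

Lemma polyhedron_closed m (l : seq ('rV[R]_m * R)) : closed (polyhedron l).
Proof.
apply: closed_adherentP => x h p pl; rewrite leNgt; apply/negP => px.
have np : 0 < 1 + enorm p.1 by rewrite ltr_pwDl ?enorm_ge0.
have [|y ly] := h ((dot p.1 x - p.2) / (1 + enorm p.1)).
  by rewrite divr_gt0 // subr_gt0.
rewrite ltr_pdivlMr // enormB => xy.
have := cauchy_schwarz p.1 (x - y); rewrite dotBr.
have := ly p pl; have := enorm_ge0 (x - y); nra.
Qed.

Lemma halfspacesZ m (A : seq 'rV[R]_m) (t : R) u :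
  0 <= t -> halfspaces A u -> halfspaces A (t *: u).
Proof. by move=> t0 Au a aA; rewrite dotZr mulr_ge0_le0 // Au. Qed.

Lemma halfspacesD m (A : seq 'rV[R]_m) u v :
  halfspaces A u -> halfspaces A v -> halfspaces A (u + v).
Proof. by move=> Au Av a aA; rewrite dotDr; have := Au a aA; have := Av a aA; lra. Qed.

Lemma tangent_polyhedron m (l : seq ('rV[R]_m * R)) z : polyhedron l z ->
  tangent_cone (polyhedron l) z = halfspaces (active l z).
Proof.
move=> lz; apply/seteqP; split=> u.
  move=> /tangent_coneP[_ h] a aA; rewrite leNgt; apply/negP => au.
  have na : 0 < 1 + enorm a by rewrite ltr_pwDl ?enorm_ge0.
  have [|t [u' [t0 _ uu lu]]] := h (dot a u / (1 + enorm a)); first exact: divr_gt0.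
  move: aA => /mapP[p]; rewrite mem_filter => /andP[/eqP pz pl] ap.
  have := lu p pl; rewrite -ap -pz -ap dotDr gerDl dotZr pmulr_rle0 // leNgt.
  move/negP; apply; move: uu; rewrite ltr_pdivlMr // enormB => uu.
  have := cauchy_schwarz a (u - u'); rewrite dotBr.
  have := enorm_ge0 (u - u'); lra.
move=> uA; apply/tangent_coneP; split=> // e e0.
have [d d0 h] := polyhedron_local lz.
have nu : 0 < 1 + enorm u by rewrite ltr_pwDl ?enorm_ge0.
pose t := Num.min (e / 2) (d / (1 + enorm u)).
have t0 : 0 < t by rewrite lt_min !divr_gt0.
exists t, u; split => //.
- by rewrite /t gt_min ltr_pdivrMr ?ltr_pMr // ltr1n.
- by rewrite subrr enorm0.
apply/h; last by apply: halfspacesZ => //; exact: ltW.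
rewrite enormZ gtr0_norm //; apply: (@le_trans _ _ (t * (1 + enorm u))).
  by rewrite ler_pM2l // lerDr.
by rewrite -ler_pdivlMr // /t ge_min lexx orbT.
Qed.

Lemma normal_polyhedron m (l : seq ('rV[R]_m * R)) z : polyhedron l z ->
  normal_cone (polyhedron l) z = fgcone (active l z).
Proof.
move=> lz; apply/seteqP; split=> w.
  by move=> [_]; rewrite /polar /= tangent_polyhedron //; exact: farkas.
move=> wA; split=> // v; rewrite tangent_polyhedron //.
exact: fgcone_halfspaces.
Qed.

Lemma halfspaces_polyhedron m (A : seq 'rV[R]_m) :
  halfspaces A = polyhedron [seq (a, 0) | a <- A].
Proof.
apply/seteqP; split=> u h.
  by move=> p /mapP[a aA ->] /=; exact: h.
by move=> a aA; have := h _ (map_f (fun a => (a, 0)) aA).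
Qed.

Lemma convex_polyhedralP m (D : set 'rV[R]_m) :
  convex_polyhedral D -> exists l, D = polyhedron l.
Proof.
move=> [k [a [c ->]]]; exists [seq (a i, c i) | i <- enum 'I_k].
apply/seteqP; split=> z h.
  by move=> p /mapP[i _ ->]; exact: h.
by move=> i; apply: (h (a i, c i)); apply: map_f; rewrite mem_enum.
Qed.

End Topology.

(** * First-order calculus *)

Section Calculus.
Context {R : realType}.

Lemma dot_mxvec m k (A B : 'M[R]_(m, k)) :
  dot (mxvec A) (mxvec B) = \sum_i \sum_j A i j * B i j.
Proof.
rewrite /dot (reindex _ (curry_mxvec_bij m k)) /= pair_bigA.
by apply: eq_bigr => -[i j] _; rewrite !mxvecE.
Qed.

(** [enorm (mxvec M)] is the Frobenius norm of M, which bounds its operator norm. *)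
Lemma enorm_mulmx m k (u : 'rV[R]_m) (M : 'M[R]_(m, k)) :
  enorm (u *m M) <= enorm u * enorm (mxvec M).
Proof.
rewrite -ler_sqr ?nnegrE ?mulr_ge0 ?enorm_ge0 // exprMn !enorm_sqr.
rewrite dot_mxvec exchange_big mulr_sumr /=; apply: ler_sum => j _.
have -> : (u *m M) 0 j = dot u (\row_i M i j).
  by rewrite mxE; apply: eq_bigr => i _; rewrite mxE.
have -> : \sum_i M i j * M i j = dot (\row_i M i j) (\row_i M i j).
  by apply: eq_bigr => i _; rewrite !mxE.
rewrite -!enorm_sqr -exprMn -expr2 -[X in X <= _]real_normK ?num_real //.
by rewrite ler_sqr ?nnegrE ?mulr_ge0 ?enorm_ge0 // cauchy_schwarz_norm.
Qed.

Lemma enorm_mulmx_vec m k (u : 'rV[R]_m) (X : 'rV[R]_(m * k)) :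
  enorm (u *m vec_mx X) <= enorm u * enorm X.
Proof. by have := enorm_mulmx u (vec_mx X); rewrite vec_mxK. Qed.

(** Differentiability with derivative M, as an explicit remainder estimate in the
    Euclidean norm. The derivatives of the various compositions of f and g with affine
    maps are computed in this form. *)
Definition has_jacobian m k (F : 'rV[R]_m -> 'rV[R]_k) (x : 'rV[R]_m)
    (M : 'M[R]_(m, k)) : Prop :=
  forall e, 0 < e -> exists2 d, 0 < d & forall h, enorm h <= d ->
    enorm (F (x + h) - F x - h *m M) <= e * enorm h.

Lemma differentiable_has_jacobian m k (F : 'rV[R]_m -> 'rV[R]_k) x :
  differentiable F x -> has_jacobian F x ('J F x).
Proof.
move=> /diff_locally /eqaddoP dF e e0.
have k0 : 0 < k.+1%:R :> R by [].
have e'0 : 0 < e / k.+1%:R by rewrite divr_gt0.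
have /nbhs_enormP[d d0 h] := dF _ e'0.
exists (d / 2); first by rewrite divr_gt0.
move=> u ud; have := h u; rewrite subr0 => /(_ _)/=.
rewrite -![(_ + _ : _ -> _) _]/(_ + _) -![(- _ : _ -> _) _]/(- _) /=.
rewrite (addrC u x) => hu; rewrite /jacobian mul_rV_lin1.
apply: (le_trans (enorm_le_norm _)); rewrite -ler_pdivlMl // mulrA.
rewrite [_^-1 * e]mulrC -addrA -opprD; apply: (le_trans (hu _)).
  by rewrite (le_lt_trans ud) // ltr_pdivrMr // ltr_pMr // ltr1n.
by rewrite ler_pM2l // norm_le_enorm.
Qed.

Lemma continuous_mulmxr m k (M : 'M[R]_(m, k)) :
  continuous (mulmxr M : 'rV[R]_m -> 'rV[R]_k).
Proof.
move=> x; apply/(@cvg_enormP _ _ _ (nbhs_filter x)) => e e0.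
have p : 0 < 1 + enorm (mxvec M) by rewrite ltr_pwDl ?enorm_ge0.
apply/nbhs_enormP; exists (e / (1 + enorm (mxvec M))); first exact: divr_gt0.
move=> y; rewrite /= -mulmxBl ltr_pdivlMr // => h.
apply: le_lt_trans h; apply: (le_trans (enorm_mulmx _ _)).
by rewrite ler_wpM2l ?enorm_ge0 // lerDr.
Qed.

Lemma diff_bound (V W : normedModType R) (F : V -> W) (x : V)
    (L : {linear V -> W}) :
  continuous L ->
  (forall e : R, 0 < e ->
    \forall h \near (0 : V), `|F (h + x) - F x - L h| <= e * `|h|) ->
  differentiable F x /\ 'd F x = L :> (V -> W).
Proof.
move=> cL hF.
have loc : F \o shift x = cst (F x) + L +o_ 0 id.
  apply/eqaddoP => e e0; apply: filterS (hF e e0) => h.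
  rewrite -![(_ + _ : _ -> _) _]/(_ + _) -![(- _ : _ -> _) _]/(- _) /=.
  by rewrite opprD addrA.
have dE := diff_unique cL loc.
by split; first by apply/diff_locallyP; rewrite dE.
Qed.

Lemma has_jacobian_differentiable m k (F : 'rV[R]_m -> 'rV[R]_k) x M :
  has_jacobian F x M -> differentiable F x /\ 'J F x = M.
Proof.
move=> hF.
have [|dF dE] := @diff_bound 'rV[R]_m 'rV[R]_k F x (mulmxr M)
  (@continuous_mulmxr _ _ M).
  move=> e e0; have m0 : 0 < m.+1%:R :> R by [].
  have [|d d0 h] := hF (e / m.+1%:R); first exact: divr_gt0.
  apply/nbhs_enormP; exists d => // u; rewrite subr0 (addrC u) => ud.
  apply: (le_trans (norm_le_enorm _)); apply: (le_trans (h _ (ltW ud))).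
  rewrite -mulrA ler_pM2l // ler_pdivrMl //; exact: enorm_le_norm.
split=> //.
by apply/row_matrixP => i; rewrite !rowE /jacobian mul_rV_lin1 dE.
Qed.

Lemma has_jacobianD m k (F G : 'rV[R]_m -> 'rV[R]_k) x M N :
  has_jacobian F x M -> has_jacobian G x N ->
  has_jacobian (fun y => F y + G y) x (M + N).
Proof.
move=> hF hG e e0; have e2 : 0 < e / 2 by rewrite divr_gt0.
have [d d0 hd] := hF _ e2; have [d' d'0 hd'] := hG _ e2.
exists (Num.min d d'); first by rewrite lt_min d0.
move=> h; rewrite le_min => /andP[/hd h1 /hd' h2].
rewrite mulmxDr [X in enorm X](_ : _ =
  (F (x + h) - F x - h *m M) + (G (x + h) - G x - h *m N)); last first.
  by rewrite !opprD !addrA; apply/rowP => i; rewrite !mxE; ring.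
apply: (le_trans (enormD _ _)); have := lerD h1 h2; lra.
Qed.

Lemma has_jacobian_affine m p k q (F : 'rV[R]_p -> 'rV[R]_k)
    (a : 'rV[R]_m -> 'rV[R]_p) (x : 'rV[R]_m) (P : 'M[R]_(m, p)) N
    (Q : 'M[R]_(k, q)) :
  (forall h, a (x + h) = a x + h *m P) -> has_jacobian F (a x) N ->
  has_jacobian (fun y => F (a y) *m Q) x (P *m N *m Q).
Proof.
move=> aP hF e e0.
have p0 : 0 < 1 + enorm (mxvec P) by rewrite ltr_pwDl ?enorm_ge0.
have q0 : 0 < 1 + enorm (mxvec Q) by rewrite ltr_pwDl ?enorm_ge0.
have pe := enorm_ge0 (mxvec P); have qe := enorm_ge0 (mxvec Q).
have [|d d0 hd] := hF (e / (1 + enorm (mxvec P)) / (1 + enorm (mxvec Q))).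
  by rewrite !divr_gt0.
exists (d / (1 + enorm (mxvec P))); first exact: divr_gt0.
move=> h; rewrite ler_pdivlMr // => hh; have h0 := enorm_ge0 h.
have hP := enorm_mulmx h P.
have := hd (h *m P); rewrite aP => /(_ _) h2.
rewrite -!mulmxBl !mulmxA -!mulmxBl; apply: (le_trans (enorm_mulmx _ _)).
have {}h2 := h2 (le_trans hP _).
apply: (@le_trans _ _ (e / (1 + enorm (mxvec P)) / (1 + enorm (mxvec Q)) *
   (enorm h * (1 + enorm (mxvec P))) * (1 + enorm (mxvec Q)))).
  apply: ler_pM => //; rewrite ?enorm_ge0 ?lerDr //.
  apply: (le_trans (h2 _)); first by apply: le_trans hh; rewrite ler_wpM2l // lerDr.
  apply: ler_wpM2l; first by rewrite !divr_ge0 // ltW.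
  by apply: (le_trans hP); rewrite ler_wpM2l // lerDr.
rewrite le_eqVlt; apply/orP; left; apply/eqP.
by field; rewrite !lt0r_neq0.
Qed.

(** Difference quotients along directions v that converge, with an arbitrary filter:
    the proof uses it along an ultrafilter on the integers and along [0^'+]. *)
Lemma jacobian_lim T (Fi : set_system T) {FF : Filter Fi} m k
    (F : 'rV[R]_m -> 'rV[R]_k) x M (t : T -> R) (v : T -> 'rV[R]_m)
    (v0 : 'rV[R]_m) :
  has_jacobian F x M -> t @ Fi --> 0 -> (\forall a \near Fi, t a != 0) ->
  v @ Fi --> v0 ->
  (fun a => (t a)^-1 *: (F (x + t a *: v a) - F x)) @ Fi --> v0 *m M.
Proof.
move=> hF t0 tn vv; apply/cvg_enormP => e e0.
have e2 : 0 < e / 2 by rewrite divr_gt0.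
have vM : (fun a => v a *m M) @ Fi --> v0 *m M.
  exact: (cvg_comp _ _ vv (@continuous_mulmxr _ _ M v0)).
pose c := 1 + enorm v0.
have c0 : 0 < c by rewrite ltr_pwDl ?enorm_ge0.
have [|d d0 hd] := hF (e / 2 / c); first exact: divr_gt0.
have vb : \forall a \near Fi, enorm (v a) <= c.
  move/cvg_enormP : vv => /(_ 1 ltr01); apply: filterS => a h.
  rewrite -(subrK v0 (v a)) (le_trans (enormD _ _)) // lerD2r.
  exact: ltW.
have tb : \forall a \near Fi, `|t a| < d / c.
  have dc : 0 < d / c by rewrite divr_gt0.
  by move/cvgr_dist_lt : t0 => /(_ _ dc); apply: filterS => a; rewrite sub0r normrN.
move/cvg_enormP : vM => /(_ _ e2) vM.
near=> a.
have ta : t a != 0 by near: a.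
have va : enorm (v a) <= c by near: a.
have tda : `|t a| < d / c by near: a.
have vMa : enorm (v a *m M - v0 *m M) < e / 2 by near: a.
have ta0 : 0 < `|t a| by rewrite normr_gt0.
have := hd (t a *: v a); rewrite enormZ => /(_ _) h.
have {}h : enorm (F (x + t a *: v a) - F x - (t a *: v a) *m M) <=
    e / 2 / c * (`|t a| * enorm (v a)).
  apply: h; move: tda; rewrite ltr_pdivlMr // => /ltW; apply: le_trans.
  by rewrite ler_pM2l.
rewrite [X in enorm X](_ : _ =
  (t a)^-1 *: (F (x + t a *: v a) - F x - (t a *: v a) *m M) +
  (v a *m M - v0 *m M)); last first.
  rewrite [in RHS]scalerBr -scalemxAl scalerA mulVf // scale1r.
  by rewrite addrA subrK.
apply: (le_lt_trans (enormD _ _)); rewrite [e]splitr ler_ltD //.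
rewrite enormZ normfV ler_pdivrMl //; apply: (le_trans h).
apply: (@le_trans _ _ (e / 2 / c * (`|t a| * c))).
  by rewrite ler_pM2l ?divr_gt0 // ler_pM2l.
by rewrite mulrCA mulfVK ?lt0r_neq0.
Unshelve. all: by end_near. Qed.

End Calculus.

(** * Second-order expansions *)

Section SecondOrder.
Context {R : realType}.

(** Covers both the derivative along a segment, for the mean value theorem, and the
    directional derivatives in the definition of the Hessian. *)
Lemma is_derive_dot_along (V : normedModType R) m k (F : 'rV[R]_m -> 'rV[R]_k)
    (a : V -> 'rV[R]_m) (z w : V) (h : 'rV[R]_m) M (zeta : 'rV[R]_k) :
  (forall t : R, a (t *: w + z) = a z + t *: h) -> has_jacobian F (a z) M ->
  is_derive z w (fun z' => dot zeta (F (a z')) : R^o) (dot zeta (h *m M)).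
Proof.
move=> aE hF.
have lim : (fun t : R => t^-1 *: ((dot zeta (F (a (t *: w + z))) : R^o) -
    dot zeta (F (a z)))) @ 0^' --> (dot zeta (h *m M) : R^o).
  have -> : (fun t : R => t^-1 *: ((dot zeta (F (a (t *: w + z))) : R^o) -
      dot zeta (F (a z)))) =
      (fun t => dot zeta (t^-1 *: (F (a z + t *: h) - F (a z)))).
    by apply/funext => t; rewrite aE dotZr dotBr.
  apply: cvg_dot; first exact: cvg_cst.
  apply: (@jacobian_lim _ _ _ _ _ _ F (a z) M id (fun=> h) h hF).
  - exact: nbhs_dnbhs.
  - exact: nbhs_dnbhs_neq.
  - exact: cvg_cst.
apply: DeriveDef; first by apply/cvg_ex; exists (dot zeta (h *m M)).
exact: cvg_lim lim.
Qed.

(** The bilinear map [D^2 g(y)(h, h')]: the derivative in direction h of the Jacobian,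
    flattened by [mxvec], applied to h'. *)
Definition second_derivative m k (g : 'rV[R]_m -> 'rV[R]_k) (y h h' : 'rV[R]_m) :=
  h' *m vec_mx (h *m 'J (fun x => mxvec ('J g x)) y).

Lemma second_derivativeDl m k (g : 'rV[R]_m -> 'rV[R]_k) y h1 h2 h' :
  second_derivative g y (h1 + h2) h' =
  second_derivative g y h1 h' + second_derivative g y h2 h'.
Proof. by rewrite /second_derivative mulmxDl linearD mulmxDr. Qed.

Lemma second_derivativeZl m k (g : 'rV[R]_m -> 'rV[R]_k) y (t : R) h h' :
  second_derivative g y (t *: h) h' = t *: second_derivative g y h h'.
Proof. by rewrite /second_derivative -scalemxAl linearZ /= -scalemxAr. Qed.

Lemma second_derivativeDr m k (g : 'rV[R]_m -> 'rV[R]_k) y h h1 h2 :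
  second_derivative g y h (h1 + h2) =
  second_derivative g y h h1 + second_derivative g y h h2.
Proof. exact: mulmxDl. Qed.

Lemma second_derivativeZr m k (g : 'rV[R]_m -> 'rV[R]_k) y (t : R) h h' :
  second_derivative g y h (t *: h') = t *: second_derivative g y h h'.
Proof. by rewrite /second_derivative -scalemxAl. Qed.

Lemma second_derivative_bound m k (g : 'rV[R]_m -> 'rV[R]_k) y :
  exists2 C, 0 <= C & forall h h',
    enorm (second_derivative g y h h') <= C * enorm h * enorm h'.
Proof.
exists (enorm (mxvec ('J (fun x => mxvec ('J g x)) y))); first exact: enorm_ge0.
move=> h h'; apply: (le_trans (enorm_mulmx_vec _ _)); rewrite mulrC.
by apply: ler_wpM2r; rewrite ?enorm_ge0 // mulrC enorm_mulmx.
Qed.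

Lemma C2_has_jacobian m k (g : 'rV[R]_m -> 'rV[R]_k) x :
  C2 g -> has_jacobian g x ('J g x).
Proof. by move=> [dg _]; exact: differentiable_has_jacobian. Qed.

Lemma C2_has_jacobian2 m k (g : 'rV[R]_m -> 'rV[R]_k) x :
  C2 g -> has_jacobian (fun x => mxvec ('J g x)) x ('J (fun x => mxvec ('J g x)) x).
Proof. by move=> [_ [dg _]]; exact: differentiable_has_jacobian. Qed.

Lemma subr_sub_add (V : zmodType) (a b c x y : V) :
  a - c - (x + y) - (b - c - x) = a - b - y.
Proof.
rewrite opprD addrA [LHS]addrAC; congr (_ - y).
by rewrite opprD addrACA subrr addr0 opprD addrACA subrr addr0.
Qed.

Lemma mulmx_vec_comb m k (h : 'rV[R]_m) (A B : 'M[R]_(m, k)) c X :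
  h *m A - h *m B - c *: (h *m vec_mx X) =
  h *m vec_mx (mxvec A - mxvec B - c *: X).
Proof.
have E : vec_mx (c *: X) = c *: vec_mx X :> 'M[R]_(m, k) by exact: linearZ.
rewrite !(linearB (@vec_mx R m k)) [X in _ = _ *m (_ - X)]E.
by rewrite [X in _ - X = _]scalemxAr !mulmxBr /= !mxvecK.
Qed.

(** Second-order expansion at a base point y0 that may differ from y, while the
    quadratic term is frozen at y. The mean value theorem is applied to the remainder
    paired with the fixed vector r that is to be estimated, and the derivative of J at
    y controls the difference of J at two points near y. A moving base point is needed
    when the points of a constraint set are compared with a point of a curve. *)
Lemma taylor2 m k (g : 'rV[R]_m -> 'rV[R]_k) y : C2 g ->
  forall e, 0 < e -> exists2 d, 0 < d & forall y0 h,
    enorm (y0 - y) <= d -> enorm (y0 + h - y) <= d ->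
    enorm (g (y0 + h) - g y0 - h *m 'J g y0 - 2^-1 *: second_derivative g y h h)
      <= e * enorm h * (enorm (y0 - y) + enorm h).
Proof.
move=> gC2 e e0; have e2 : 0 < e / 2 by rewrite divr_gt0.
set H := 'J (fun x => mxvec ('J g x)) y.
have [d d0 hd] := C2_has_jacobian2 y gC2 e2.
pose E x := mxvec ('J g x) - mxvec ('J g y) - (x - y) *m H.
have hE x : enorm (x - y) <= d -> enorm (E x) <= e / 2 * enorm (x - y).
  by move=> /hd; rewrite [y + _]addrC subrK.
exists d => // y0 h y0d yhd.
(* the remainder itself serves as the test vector *)
set r := (X in enorm X).
have h0 := enorm_ge0 h; have y00 := enorm_ge0 (y0 - y).
have [r0|r0] := eqVneq r 0.
  by rewrite r0 enorm0 !mulr_ge0 ?addr_ge0 // ltW.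
have rp := enorm_gt0 r0.
pose a := dot r (h *m 'J g y0); pose b := dot r (second_derivative g y h h).
pose phi (s : R) : R := dot r (g (y0 + s *: h)) - s * a - s ^+ 2 * (b / 2).
pose dphi (s : R) : R := dot r (h *m 'J g (y0 + s *: h)) - a - s * b.
have der (s : R) : is_derive s (1 : R) phi (dphi s).
  have d1 : is_derive s (1 : R) (fun s => dot r (g (y0 + s *: h)) : R^o)
      (dot r (h *m 'J g (y0 + s *: h))).
    apply: (@is_derive_dot_along _ _ _ g (fun s : R => y0 + s *: h) s 1 h).
      by move=> t; rewrite /= [t *: 1]mulr1 scalerDl [t *: h + _]addrC addrA.
    exact: C2_has_jacobian.
  have d2 : is_derive s (1 : R) (fun s : R => s * a) a.
    by apply: is_derive_eq; rewrite scaler0 add0r [_%:A]mulr1.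
  have d3 : is_derive s (1 : R) (fun s : R => s ^+ 2 * (b / 2)) (s * b).
    apply: is_derive_eq.
    by rewrite scaler0 add0r /GRing.scale /=; field.
  have d12 := is_deriveB d1 d2; have d123 := is_deriveB d12 d3; exact: d123.
have [|c /andP[/ltW c0 /ltW c1]] := @MVT R phi dphi 0 1 ltr01 (fun s _ => der s).
  by apply: derivable_within_continuous => s _; have ds := der s; exact: ex_derive.
rewrite subr0 mulr1 => mvt.
have ph : phi 1 - phi 0 = dot r r.
  transitivity (dot r (g (y0 + h) - g y0 - h *m 'J g y0 -
      2^-1 *: second_derivative g y h h)); last by [].
  by rewrite /phi scale1r scale0r addr0 /a /b !dotBr dotZr; field.
have Ec := hE (y0 + c *: h).
have Ey := hE y0 y0d.
have cn : y0 + c *: h - y = (y0 - y) + c *: h by rewrite addrAC.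
have {}Ec : enorm (E (y0 + c *: h)) <= e / 2 * (enorm (y0 - y) + enorm h).
  apply: (le_trans (Ec _)).
    rewrite (_ : _ - y = (1 - c) *: (y0 - y) + c *: (y0 + h - y)); last first.
      by apply/rowP => i; rewrite !mxE; ring.
    apply: (le_trans (enormD _ _)); rewrite !enormZ !ger0_norm ?subr_ge0 //.
    have : 0 <= 1 - c by rewrite subr_ge0.
    by nra.
  rewrite ler_pM2l // cn; apply: (le_trans (enormD _ _)); rewrite lerD2l.
  by rewrite enormZ ger0_norm // ler_piMl.
have dE : dphi c = dot r (h *m vec_mx (E (y0 + c *: h) - E y0)).
  rewrite /dphi /a /b /second_derivative -/H -!dotBr -dotZr -dotBr.
  congr (dot _ _).
  have -> : E (y0 + c *: h) - E y0 = mxvec ('J g (y0 + c *: h)) - mxvec ('J g y0) - c *: (h *m H).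
    by rewrite /E cn mulmxDl -scalemxAl subr_sub_add.
  exact: mulmx_vec_comb.
have h3 : enorm r * enorm r <= enorm r * (e * enorm h * (enorm (y0 - y) + enorm h)).
  rewrite -expr2 enorm_sqr -ph mvt dE.
  apply: (le_trans (cauchy_schwarz _ _)); rewrite ler_pM2l //.
  apply: (le_trans (enorm_mulmx_vec _ _)).
  have := enormD (E (y0 + c *: h)) (- E y0); rewrite enormN => h4.
  have : enorm (E (y0 + c *: h) - E y0) <= e * (enorm (y0 - y) + enorm h) by nra.
  by move/(ler_wpM2l h0); rewrite mulrCA mulrA.
by rewrite ler_pM2l in h3.
Qed.

Lemma scale_remainder k (A X Y : 'rV[R]_k) (t : R) : t != 0 ->
  (t ^+ 2)^-1 *: A - 2^-1 *: Y =
  (t ^+ 2)^-1 *: (A - 2^-1 *: (t *: (t *: X))) + 2^-1 *: (X - Y).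
Proof. by move=> t0; apply/rowP => i; rewrite !mxE; field. Qed.

Lemma taylor2_lim T (Fi : set_system T) {FF : Filter Fi} m k
    (g : 'rV[R]_m -> 'rV[R]_k) y (t : T -> R) (v : T -> 'rV[R]_m)
    (v0 : 'rV[R]_m) :
  C2 g -> t @ Fi --> 0 -> (\forall a \near Fi, t a != 0) -> v @ Fi --> v0 ->
  (fun a => (t a ^+ 2)^-1 *: (g (y + t a *: v a) - g y - (t a *: v a) *m 'J g y))
    @ Fi --> 2^-1 *: second_derivative g y v0 v0.
Proof.
move=> gC2 t0 tn vv; apply/cvg_enormP => e e0.
have [C C0 hC] := second_derivative_bound g y.
pose c := 1 + enorm v0.
have c0 : 0 < c by rewrite ltr_pwDl ?enorm_ge0.
have e1 : 0 < e / 2 / c ^+ 2 by rewrite !divr_gt0 // exprn_gt0.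
have [d d0 hd] := taylor2 y gC2 e1.
have e2 : 0 < e / 2 / (1 + C * (2 * c)).
  by rewrite divr_gt0 ?divr_gt0 // ltr_pwDl // !mulr_ge0 // ltW.
have vb : \forall a \near Fi, enorm (v a) <= c.
  move/cvg_enormP : vv => /(_ 1 ltr01); apply: filterS => a h.
  rewrite -(subrK v0 (v a)) (le_trans (enormD _ _)) // lerD2r.
  exact: ltW.
have tb : \forall a \near Fi, `|t a| < d / c.
  have dc : 0 < d / c by rewrite divr_gt0.
  by move/cvgr_dist_lt : t0 => /(_ _ dc); apply: filterS => a; rewrite sub0r normrN.
move/cvg_enormP : vv => /(_ _ e2) vv.
near=> a.
have ta : t a != 0 by near: a.
have va : enorm (v a) <= c by near: a.
have tda : `|t a| < d / c by near: a.
have vva : enorm (v a - v0) < e / 2 / (1 + C * (2 * c)) by near: a.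
have ta0 : 0 < `|t a| by rewrite normr_gt0.
have v00 := enorm_ge0 v0.
have tva : enorm (t a *: v a) <= d.
  rewrite enormZ; move: tda; rewrite ltr_pdivlMr // => /ltW; apply: le_trans.
  by rewrite ler_pM2l.
have := hd y (t a *: v a); rewrite subrr enorm0 add0r (addrC y) addrK => /(_ (ltW d0) tva).
rewrite (addrC _ y) second_derivativeZl second_derivativeZr enormZ.
set r := (X in enorm X <= _) => hr.
have DE : second_derivative g y (v a - v0) (v a) +
    second_derivative g y v0 (v a - v0) =
    second_derivative g y (v a) (v a) - second_derivative g y v0 v0.
  rewrite -!(scaleN1r v0) second_derivativeDl second_derivativeZl.
  by rewrite second_derivativeDr second_derivativeZr !scaleN1r addrA subrK.
rewrite (scale_remainder _ (second_derivative g y (v a) (v a)) _ ta) -DE -/r.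
apply: (le_lt_trans (enormD _ _)); rewrite [e]splitr ler_ltD //.
  rewrite enormZ normfV normrX ler_pdivrMl ?exprn_gt0 //.
  apply: (le_trans hr).
  apply: (@le_trans _ _ (e / 2 / c ^+ 2 * (`|t a| * c) * (`|t a| * c))).
    have tc : `|t a| * enorm (v a) <= `|t a| * c by rewrite ler_pM2l.
    have tv0 : 0 <= `|t a| * enorm (v a) by rewrite mulr_ge0 ?enorm_ge0.
    by apply: ler_pM => //; [rewrite mulr_ge0 // ltW | rewrite ler_pM2l].
  by rewrite le_eqVlt; apply/orP; left; apply/eqP; field; rewrite lt0r_neq0.
rewrite enormZ ger0_norm ?invr_ge0 // ltr_pdivrMl //.
apply: (le_lt_trans (enormD _ _)).
have h1 := hC (v a - v0) (v a); have h2 := hC v0 (v a - v0).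
move: vva; rewrite ltr_pdivlMr; last by rewrite ltr_pwDl // !mulr_ge0 // ltW.
have x0 := enorm_ge0 (v a - v0); set x := enorm (v a - v0) in h1 h2 x0 *.
move=> vva.
have h1' : C * x * enorm (v a) <= C * x * c by rewrite ler_wpM2l // mulr_ge0.
have h2' : C * enorm v0 * x <= C * c * x by rewrite ler_wpM2r // ler_wpM2l // lerDr.
nra.
Unshelve. all: by end_near. Qed.

Lemma linear_coords m (phi : 'rV[R]_m -> R) v :
  (forall a b, phi (a + b) = phi a + phi b) ->
  (forall t a, phi (t *: a) = t * phi a) ->
  phi v = \sum_i v 0 i * phi 'e_i.
Proof.
move=> pD pZ; have p0 : phi 0 = 0 by rewrite -(scale0r 0) pZ mul0r.
rewrite {1}(row_sum_delta v) (big_morph phi pD p0).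
by apply: eq_bigr => i _; rewrite pZ.
Qed.

(** The derivative of [lam . g] along e_j is at every point a fixed linear form in the
    flattened Jacobian, so that differentiating it along e_i gives
    [lam . D^2 g(y)(e_i, e_j)]. *)
Lemma curvatureE m k (g : 'rV[R]_m -> 'rV[R]_k) y v lam : C2 g ->
  curvature g y v lam = dot lam (second_derivative g y v v).
Proof.
move=> gC2.
have d1 j y' : 'D_('e_j) (fun y' => dot lam (g y') : R^o) y' =
    dot (mxvec (('e_j)^T *m lam)) (mxvec ('J g y')).
  have hh := @is_derive_dot_along _ _ _ g id y' 'e_j 'e_j _ lam
    (fun t => addrC _ _) (C2_has_jacobian y' gC2).
  rewrite derive_val dot_mxvec.
  rewrite (bigD1 j) //= [X in _ + X]big1 ?addr0 => [|i ij]; last first.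
    by apply: big1 => b _; rewrite !mxE big_ord1 !mxE eq_sym (negbTE ij) andbF !mul0r.
  rewrite -rowE /dot; apply: eq_bigr => b _.
  by rewrite !mxE big_ord1 !mxE !eqxx mul1r.
have hE i j : hessian (fun y' => dot lam (g y')) y i j =
    dot lam (second_derivative g y 'e_i 'e_j).
  rewrite mxE; under [X in derive X]eq_fun do rewrite d1.
  have hh := @is_derive_dot_along _ _ _ (fun x => mxvec ('J g x)) id y 'e_i 'e_i _
    (mxvec (('e_j)^T *m lam)) (fun t => addrC _ _) (C2_has_jacobian2 y gC2).
  rewrite derive_val /second_derivative.
  set X := 'e_i *m _; rewrite -{1}(vec_mxK X) dot_mxvec.
  rewrite (bigD1 j) //= [X in _ + X]big1 ?addr0 => [|a aj]; last first.
    by apply: big1 => b _; rewrite !mxE big_ord1 !mxE eq_sym (negbTE aj) andbF !mul0r.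
  rewrite -rowE /dot; apply: eq_bigr => b _.
  by rewrite !mxE big_ord1 !mxE !eqxx mul1r.
rewrite /curvature [LHS]/dot.
rewrite [RHS](@linear_coords _ (fun h' => dot lam (second_derivative g y v h'))); last 2 first.
- by move=> a b; rewrite second_derivativeDr dotDr.
- by move=> t a; rewrite second_derivativeZr dotZr.
apply: eq_bigr => j _; rewrite mulrC; congr (_ * _).
rewrite [RHS](@linear_coords _ (fun h => dot lam (second_derivative g y h 'e_j))); last 2 first.
- by move=> a b; rewrite second_derivativeDl dotDr.
- by move=> t a; rewrite second_derivativeZl dotZr.
by rewrite mxE; apply: eq_bigr => i _; rewrite hE.
Qed.

End SecondOrder.

(** * Regular normals and multipliers *)

Section NormalCones.
Context {R : realType}.

(** Converts the subregularity hypotheses into the existence of points: the distance to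
    the empty set is infinite, so A is nonempty, and e > 0 replaces attainment. *)
Lemma dist_leP m k (x : 'rV[R]_m) (A : set 'rV[R]_m) (y b : 'rV[R]_k)
    (B : set 'rV[R]_k) (kappa e : R) :
  0 <= kappa -> (dist x A <= kappa%:E * dist y B)%E -> B b -> 0 < e ->
  exists2 a, A a & enorm (x - a) <= kappa * enorm (y - b) + e.
Proof.
move=> k0 h Bb e0.
have : (dist x A < (kappa * enorm (y - b) + e)%:E)%E.
  apply: (le_lt_trans h); apply: (@le_lt_trans _ _ (kappa * enorm (y - b))%:E).
    by rewrite EFinM; apply: lee_wpmul2l; [rewrite lee_fin | apply: ereal_inf_lbound; exists b].
  by rewrite lte_fin ltrDl.
move=> /ereal_inf_lt[_ [a Aa <-]]; rewrite lte_fin => /ltW ha.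
by exists a.
Qed.

(** Ultrafilters replace repeated extraction of subsequences. *)
Lemma ultra_bounded_cvg T (U : set_system T) m (u : T -> 'rV[R]_m) (r : R) :
  UltraFilter U -> (forall k, enorm (u k) <= r) ->
  exists u0 : 'rV[R]_m, u @ U --> u0.
Proof.
move=> UU ur.
have cpt : compact [set y : 'rV[R]_m | enorm (y - 0) <= r].
  by apply: (@bounded_compact _ _ 0 r) => //; exact: closed_enorm_ball.
have [|u0 [_ clu]] := cpt (u @ U) _.
  by apply: (@filterE _ U) => k /=; rewrite subr0.
exists u0 => B Bu0; have [//|nB] := in_ultra_setVsetC (u @^-1` B) UU.
have [y [/= By nBy]] := clu (~` B) B nB Bu0.
by [].
Qed.

Lemma limit_ge0 T (F : set_system T) {FF : ProperFilter F} (f : T -> R) (a : R) :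
  f @ F --> a -> (\forall k \near F, 0 <= f k) -> 0 <= a.
Proof.
move=> fa f0; rewrite leNgt; apply/negP => a0.
have fn : \forall k \near F, f k < 0 by exact: cvgr_lt fa _ a0.
by have [k [/= h1 h2]] := filter_ex (filterI f0 fn); move: h2; rewrite ltNge h1.
Qed.

Lemma limit_le0 T (F : set_system T) {FF : ProperFilter F} (f : T -> R) (a : R) :
  f @ F --> a -> (\forall k \near F, f k <= 0) -> a <= 0.
Proof.
move=> fa f0; rewrite leNgt; apply/negP => a0.
have fn : \forall k \near F, 0 < f k by exact: cvgr_gt fa _ a0.
by have [k [/= h1 h2]] := filter_ex (filterI f0 fn); move: h2; rewrite ltNge h1.
Qed.

(** Regular normals satisfy the variational inequality up to [o(|z' - z|)]. Otherwise
    the normalized differences have a limit along an ultrafilter, which is a tangent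
    direction on which w is positive. *)
Lemma normal_cone_small m (Om : set 'rV[R]_m) z w : normal_cone Om z w ->
  forall e, 0 < e -> exists2 d, 0 < d & forall z', Om z' -> enorm (z' - z) <= d ->
    dot w (z' - z) <= e * enorm (z' - z).
Proof.
move=> [Oz wN] e e0; apply: contrapT => hn.
have hk k : exists z', [/\ Om z', enorm (z' - z) <= k.+1%:R^-1 &
    e * enorm (z' - z) < dot w (z' - z)].
  apply: contrapT => hk; apply: hn; exists k.+1%:R^-1; first by rewrite invr_gt0.
  move=> z' Oz' zz; rewrite leNgt; apply/negP => lt; apply: hk; by exists z'.
pose zs k := projT1 (cid (hk k)); have zP k := projT2 (cid (hk k)).
pose t k := enorm (zs k - z).
have t0 k : 0 < t k.
  have [_ _ h] := zP k; apply: enorm_gt0; apply: contraTneq h => h0.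
  by rewrite -/(zs k) h0 enorm0 dot0r mulr0 ltxx.
pose u k := (t k)^-1 *: (zs k - z).
have u1 k : enorm (u k) <= 1.
  by rewrite enormZ normfV gtr0_norm // mulVf // lt0r_neq0.
have [U [UU Uoo]] := @ultraFilterLemma _ (nbhs \oo) _.
have [u0 uu] := ultra_bounded_cvg UU u1.
have : dot w u0 <= 0.
  apply: wN; apply/tangent_coneP; split=> // d d0.
  move/cvg_enormP : (uu) => /(_ d d0) h1; have h2 := Uoo _ (harmonic_small d0).
  have [k [/= k1 k2]] := filter_ex (filterI h1 h2).
  exists (t k), (u k); split=> //.
    by have [_ h _] := zP k; exact: le_lt_trans h k2.
  by rewrite scalerA divff ?lt0r_neq0 // scale1r addrC subrK; have [] := zP k.
suff : 0 <= dot w u0 - e by lra.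
apply: (@limit_ge0 _ U _ (fun k => dot w (u k) - e)).
  by apply: cvgB; [apply: cvg_dot => //; exact: cvg_cst | exact: cvg_cst].
apply: filterE => k; rewrite subr_ge0 /u dotZr ler_pdivlMl //.
by have [_ _ /ltW] := zP k; rewrite mulrC.
Qed.

Lemma nearest_point m (A : set 'rV[R]_m) (c : 'rV[R]_m) : closed A -> A !=set0 ->
  exists2 x, A x & forall y, A y -> enorm (x - c) <= enorm (y - c).
Proof.
move=> Acl [a Aa].
pose B := A `&` [set y | enorm (y - c) <= enorm (a - c)].
have Bcpt : compact B.
  apply: (@bounded_compact _ _ c (enorm (a - c))) => [|y []//].
  by apply: closedI => //; exact: closed_enorm_ball.
pose f (y : 'rV[R]_m) : R := enorm (y - c).
have fc : continuous f.
  move=> x; apply/(@cvgrPdist_lt _ _ _ _ (nbhs_filter x)) => e e0.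
  apply/nbhs_enormP; exists e => // y yx.
  have h1 := enormD (y - x) (x - c); have h2 := enormD (x - y) (y - c).
  rewrite !addrA !subrK in h1 h2; rewrite (enormB x y) in h2.
  by rewrite /f ltr_norml; apply/andP; split; lra.
have [|x /set_mem[Ax xa] xmin] := compact_EVT_min _ Bcpt (continuous_subspaceT fc).
  by exists a; split => /=.
exists x => // y Ay; have [ya|/ltW ya] := leP (enorm (y - c)) (enorm (a - c)).
  by apply: xmin; rewrite inE; split.
exact: le_trans xa ya.
Qed.

(** Along a tangent direction u the squared distance to c changes by
    [- 2 t (c - x) . u] to first order, and it cannot decrease at a local projection. *)
Lemma proximal_normal m (Om : set 'rV[R]_m) (x c : 'rV[R]_m) (r : R) :
  Om x -> 0 < r ->
  (forall y, Om y -> enorm (y - x) < r -> enorm (x - c) <= enorm (y - c)) ->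
  normal_cone Om x (c - x).
Proof.
move=> Ox r0 hmin; split=> // u /tangent_coneP[_ hu].
rewrite leNgt; apply/negP => cu.
have u0 : u != 0 by apply: contraTneq cu => ->; rewrite dot0r ltxx.
have np := enorm_gt0 u0; have ncx := enorm_ge0 (c - x).
have dp : 0 < 1 + enorm (c - x) by rewrite ltr_pwDl.
pose K := (1 + enorm u) ^+ 2.
have K0 : 0 < K by rewrite exprn_gt0 // ltr_pwDl // ltW.
pose e := Num.min 1 (Num.min (r / (1 + enorm u))
  (Num.min (dot (c - x) u / 2 / (1 + enorm (c - x))) (dot (c - x) u / K))).
have p1 : 0 < 1 + enorm u by rewrite ltr_pwDl // ltW.
have e0 : 0 < e by rewrite !lt_min ltr01 !divr_gt0.
have [t [u' [t0 te uu Ou]]] := hu e e0.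
move: te uu; rewrite !lt_min => /and4P[_ te1 _ te2] /and4P[uu1 _ uu2 _].
have hu' : enorm u' <= 1 + enorm u.
  by rewrite -(subrK u u') (le_trans (enormD _ _)) // lerD2r ltW.
have := hmin _ Ou; rewrite addrAC subrr add0r enormZ gtr0_norm // => /(_ _).
have tr : t * enorm u' < r.
  move: te1; rewrite ltr_pdivlMr //.
  by apply: le_lt_trans; rewrite ler_pM2l.
move=> /(_ tr); rewrite -ler_sqr ?nnegrE ?enorm_ge0 // !enorm_sqr.
have -> : x + t *: u' - c = t *: u' - (c - x) by rewrite opprB addrA addrAC [RHS]addrC addrA.
have -> : x - c = - (c - x) by rewrite opprB.
rewrite !dot_lin (dotC u' c) (dotC u' x) => h.
have cs := cauchy_schwarz (c - x) (u - u').
move: uu2; rewrite ltr_pdivlMr // (enormB u') => uu2.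
have h1 : dot (c - x) u' > dot (c - x) u / 2.
  by move: cs uu2; rewrite !(dotBr, dotBl); have := enorm_ge0 (u - u'); nra.
have h2 : dot u' u' <= K.
  by rewrite -enorm_sqr /K ler_sqr ?nnegrE ?enorm_ge0 // addr_ge0 // ltW.
move: te2; rewrite ltr_pdivlMr // => te2.
have h3 : t * (t * dot u' u') <= t * (t * K).
  by rewrite !ler_pM2l.
have h4 : t * (t * K) < t * (2 * dot (c - x) u').
  by rewrite ltr_pM2l //; lra.
move: h3 h4 h; rewrite !dotBl; lra.
Qed.

Lemma fgcone_closed m (A : seq 'rV[R]_m) : closed (fgcone A).
Proof.
by have [B ->] := weyl A; rewrite halfspaces_polyhedron; exact: polyhedron_closed.
Qed.

(** A shortest multiplier lam maximizes [- lam . lam'] among the multipliers lam' of the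
    same vector, so linear programming duality yields w such that w M^T decomposes into
    lam and a vector of the polar cone orthogonal to lam. *)
Lemma min_norm_multiplier m k (A : seq 'rV[R]_k) (M : 'M[R]_(k, m)) x :
  fgcone A x -> exists lam w, [/\ fgcone A lam, lam *m M = x *m M,
    halfspaces A (w *m M^T - lam) & dot (x *m M) w = enorm lam ^+ 2].
Proof.
move=> xA.
pose S := fgcone A `&` [set lam | lam *m M = x *m M].
have Scl : closed S.
  apply: closedI; first exact: fgcone_closed.
  apply: closed_adherentP => lam hlam /=; apply/eqP; rewrite -subr_eq0; apply/eqP.
  apply: enorm_eq0; apply/eqP; rewrite eq_le enorm_ge0 andbT.
  apply/ler_addgt0Pr => e e0.
  have p : 0 < 1 + enorm (mxvec M) by rewrite ltr_pwDl ?enorm_ge0.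
  have [|y /= yM ylam] := hlam (e / (1 + enorm (mxvec M))); first exact: divr_gt0.
  rewrite -yM -mulmxBl add0r (le_trans (enorm_mulmx _ _)) //.
  move: ylam; rewrite enormB ltr_pdivlMr // => /ltW; apply: le_trans.
  by rewrite ler_wpM2l ?enorm_ge0 // lerDr.
have [|lam [lamA lamM] lammin] := @nearest_point _ S 0 Scl; first by exists x; split.
have [lam' lam'A lam'M|w] := @dual_multiplier _ _ _ A M lam (- lam) lamA.
  (* otherwise moving from lam towards lam' would shorten lam *)
  rewrite !dotNr lerN2 leNgt; apply/negP => lt.
  have dl : 0 < dot lam lam - dot lam' lam by rewrite subr_gt0.
  have d0 := dot_ge0 (lam' - lam).
  pose D := 1 + dot (lam' - lam) (lam' - lam).
  pose t := Num.min 1 ((dot lam lam - dot lam' lam) / D).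
  have D0 : 0 < D by rewrite ltr_pwDl.
  have t0 : 0 < t by rewrite lt_min ltr01 divr_gt0.
  have t1 : t <= 1 by rewrite ge_min lexx.
  have tD : t * D <= dot lam lam - dot lam' lam.
    by rewrite -ler_pdivlMr // ge_min lexx orbT.
  have : S (lam + t *: (lam' - lam)).
    split; last by rewrite /= mulmxDl -scalemxAl mulmxBl lam'M subrr scaler0 addr0.
    rewrite (_ : _ + _ = (1 - t) *: lam + t *: lam').
      by apply: fgconeD; apply: fgconeZ => //; rewrite ?subr_ge0 // ltW.
    by rewrite scalerBr scalerBl scale1r addrA addrAC.
  move=> /lammin; rewrite !subr0 -ler_sqr ?nnegrE ?enorm_ge0 // !enorm_sqr.
  rewrite leNgt => /negP; apply.
  have -> : dot (lam + t *: (lam' - lam)) (lam + t *: (lam' - lam)) =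
    dot lam lam - t * (2 * (dot lam lam - dot lam' lam) -
      t * dot (lam' - lam) (lam' - lam)).
    by rewrite !dot_lin (dotC lam lam'); ring.
  rewrite gtrBl mulr_gt0 // subr_gt0.
  by move: tD; rewrite /D mulrDr mulr1; lra.
move=> [hw hlam]; exists lam, w; split=> //.
  by rewrite addrC.
rewrite -lamM dot_mulmx enorm_sqr; move: hlam; rewrite dotDr dotNr; lra.
Qed.

End NormalCones.

Section Multipliers.
Context {R : realType}.

(** Metric subregularity bounds multipliers uniformly. It gives the estimate
    [xs . w <= kappa |xs| |w M - theta|] for all w and all tangent directions theta:
    move from z0 by t w, correct the point to a feasible one, and use that xs is a
    regular normal. For theta = w M, Farkas' lemma yields a multiplier. For the vector
    w attached to a shortest multiplier lam, one can take w M - theta = lam and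
    [xs . w = |lam|^2], so [|lam| <= kappa |xs|]. *)
Lemma multiplier_bound n s (h : 'rV[R]_n -> 'rV[R]_s) l z0 M (kappa rho : R) xs :
  has_jacobian h z0 M -> 0 < kappa -> 0 < rho ->
  (forall z, enorm (z - z0) < rho -> forall d, polyhedron l d -> forall e, 0 < e ->
     exists2 z', polyhedron l (h z') & enorm (z - z') <= kappa * enorm (h z - d) + e) ->
  normal_cone [set z | polyhedron l (h z)] z0 xs ->
  exists lam, [/\ fgcone (active l (h z0)) lam, lam *m M^T = xs &
    enorm lam <= kappa * enorm xs].
Proof.
move=> hM k0 r0 subreg xsN.
have hz0 : polyhedron l (h z0) by case: xsN.
set A := active l (h z0).
have key w theta : halfspaces A theta ->
    dot xs w <= kappa * enorm xs * enorm (w *m M - theta).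
  move=> thA; apply/ler_addgt0Pr => eta eta0.
  pose a := enorm (w *m M - theta); pose W := enorm w; pose X := enorm xs.
  have a0 : 0 <= a by exact: enorm_ge0.
  have W0 : 0 <= W by exact: enorm_ge0.
  have X0 : 0 <= X by exact: enorm_ge0.
  have th0 := enorm_ge0 theta.
  have ka0 : 0 <= kappa * a by rewrite mulr_ge0 // ltW.
  have kW0 : 0 <= kappa * W by rewrite mulr_ge0 // ltW.
  pose B := W + kappa * a + kappa * W + 1.
  have B0 : 0 < B by rewrite ltr_wpDl // !addr_ge0.
  pose K := X * (kappa * W + 1) + B.
  have K0 : 0 < K by rewrite ltr_wpDl // mulr_ge0 // addr_ge0.
  pose e := Num.min 1 (eta / K).
  have e0 : 0 < e by rewrite lt_min ltr01 divr_gt0.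
  have e1 : e <= 1 by rewrite ge_min lexx.
  have eK : e * K <= eta by rewrite -ler_pdivlMr // ge_min lexx orbT.
  have [dh dh0 hdh] := hM e e0.
  have [dD dD0 hdD] := polyhedron_local hz0.
  have [dN dN0 hdN] := normal_cone_small xsN e0.
  have pW : 0 < 1 + W by rewrite ltr_pwDl.
  have pth : 0 < 1 + enorm theta by rewrite ltr_pwDl.
  pose t := Num.min (Num.min (rho / 2 / (1 + W)) (dh / (1 + W)))
    (Num.min (dD / (1 + enorm theta)) (dN / B)).
  have t0 : 0 < t by rewrite !lt_min !divr_gt0.
  have t1 : t * W < rho.
    apply: (@le_lt_trans _ _ (t * (1 + W))); first by rewrite ler_pM2l // lerDr.
    apply: (@le_lt_trans _ _ (rho / 2)); last by rewrite ltr_pdivrMr // ltr_pMr // ltr1n.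
    by rewrite -ler_pdivlMr // !ge_min lexx.
  have t2 : t * W <= dh.
    apply: (@le_trans _ _ (t * (1 + W))); first by rewrite ler_pM2l // lerDr.
    by rewrite -ler_pdivlMr // !ge_min lexx orbT.
  have t3 : t * enorm theta <= dD.
    apply: (@le_trans _ _ (t * (1 + enorm theta))); first by rewrite ler_pM2l // lerDr.
    by rewrite -ler_pdivlMr // !ge_min lexx !orbT.
  have t4 : t * B <= dN by rewrite -ler_pdivlMr // !ge_min lexx !orbT.
  have nw : enorm (t *: w) = t * W by rewrite enormZ gtr0_norm.
  have [|||z' Oz' zz'] := subreg (z0 + t *: w) _ (h z0 + t *: theta) _ (e * t).
  - by rewrite addrAC subrr add0r nw.
  - apply/hdD; first by rewrite enormZ gtr0_norm.
    by apply: halfspacesZ => //; exact: ltW.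
  - exact: mulr_gt0.
  have hz : enorm (h (z0 + t *: w) - (h z0 + t *: theta)) <= t * a + e * (t * W).
    rewrite [X in enorm X](_ : _ = (h (z0 + t *: w) - h z0 - (t *: w) *m M) +
      t *: (w *m M - theta)).
      rewrite (le_trans (enormD _ _)) // addrC enormZ gtr0_norm // lerD2l -nw.
      by apply: hdh; rewrite nw.
    by rewrite scalerBr -scalemxAl opprD !addrA subrK.
  set r := enorm (z0 + t *: w - z') in zz'.
  have r0' : 0 <= r by exact: enorm_ge0.
  have rle : r <= t * (kappa * a + e * (kappa * W + 1)).
    by apply: (le_trans zz'); have := ler_wpM2l (ltW k0) hz; lra.
  have zz0 : enorm (z' - z0) <= t * B.
    rewrite (_ : z' - z0 = t *: w - (z0 + t *: w - z')); last first.
      by rewrite opprB addrCA [z0 + _]addrC opprD addNKr.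
    rewrite (le_trans (enormD _ _)) // enormN nw -/r.
    have : e * (kappa * W + 1) <= kappa * W + 1 by rewrite ler_piMl // addr_ge0.
    by move/(ler_wpM2l (ltW t0)); rewrite /B; lra.
  have := hdN z' Oz' (le_trans zz0 t4).
  have cs := cauchy_schwarz xs (z0 + t *: w - z'); rewrite -/r -/X in cs.
  have -> : dot xs (z' - z0) = t * dot xs w - dot xs (z0 + t *: w - z').
    by rewrite !dot_lin; ring.
  move=> h1; have h2 := ler_wpM2l X0 rle; have h3 := ler_wpM2l (ltW e0) zz0.
  have : t * dot xs w <= t * (kappa * X * a + e * K) by rewrite /K; lra.
  by rewrite ler_pM2l //; rewrite -/a -/X; lra.
have /fgcone_map[x xA xM] : fgcone [seq a *m M^T | a <- A] xs.
  apply: farkas => w hw; have := key w (w *m M).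
  rewrite subrr enorm0 mulr0; apply => a aA.
  by rewrite dotC dot_mulmx dotC; apply: hw; exact: map_f.
have [lam [w [lamA lamM hw lamw]]] := min_norm_multiplier M^T xA.
exists lam; split=> //; first by rewrite lamM.
have := key w _ hw; rewrite trmxK opprB addrCA subrr addr0 -xM lamw xM => h1.
have [->|l0] := eqVneq lam 0; first by rewrite enorm0 mulr_ge0 ?enorm_ge0 // ltW.
by move: h1; rewrite expr2 ler_pM2r // enorm_gt0.
Qed.

End Multipliers.

(** * Partial derivatives of the data *)

Section Blocks.
Context {R : realType}.

Lemma tripD l n (p p' : 'rV[R]_l) (x x' z z' : 'rV[R]_n) :
  trip (p + p') (x + x') (z + z') = trip p x z + trip p' x' z'.
Proof. by rewrite /trip !add_row_mx. Qed.

Lemma tripZ l n (t : R) (p : 'rV[R]_l) (x z : 'rV[R]_n) :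
  trip (t *: p) (t *: x) (t *: z) = t *: trip p x z.
Proof. by rewrite /trip !scale_row_mx. Qed.

Lemma pr1_trip l n (p : 'rV[R]_l) (x z : 'rV[R]_n) : pr1 (trip p x z) = p.
Proof. exact: row_mxKl. Qed.

Lemma pr2_trip l n (p : 'rV[R]_l) (x z : 'rV[R]_n) : pr2 (trip p x z) = x.
Proof. by rewrite /pr2 row_mxKr row_mxKl. Qed.

Lemma pr3_trip l n (p : 'rV[R]_l) (x z : 'rV[R]_n) : pr3 (trip p x z) = z.
Proof. by rewrite /pr3 row_mxKr row_mxKr. Qed.

Lemma trip_pr l n (y : 'rV[R]_(l + (n + n))) : trip (pr1 y) (pr2 y) (pr3 y) = y.
Proof. by rewrite /trip !hsubmxK. Qed.

Definition pr_tripE := (pr1_trip, pr2_trip, pr3_trip).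

Lemma enorm_trip l n (p : 'rV[R]_l) (x z : 'rV[R]_n) :
  enorm (trip p x z) <= enorm p + (enorm x + enorm z).
Proof.
apply: (le_trans (enorm_row_mx_le _ _)); rewrite lerD2l.
exact: enorm_row_mx_le.
Qed.

(** The matrices of the maps sending z to (0, 0, z), x to (0, x, x) and (p, x) to
    (p, x, x). *)
Definition inj3 l n : 'M[R]_(n, l + (n + n)) := row_mx 0 (row_mx 0 1%:M).
Definition inj23 l n : 'M[R]_(n, l + (n + n)) := row_mx 0 (row_mx 1%:M 1%:M).
Definition inj123 l n : 'M[R]_(l + n, l + (n + n)) :=
  col_mx (row_mx 1%:M 0) (inj23 l n).

Lemma mul_inj3 l n (v : 'rV[R]_n) : v *m inj3 l n = trip 0 0 v.
Proof. by rewrite /inj3 !mul_mx_row !mulmx0 mulmx1. Qed.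

Lemma mul_inj23 l n (v : 'rV[R]_n) : v *m inj23 l n = trip 0 v v.
Proof. by rewrite /inj23 !mul_mx_row !mulmx0 mulmx1. Qed.

Lemma mul_inj123 l n (q : 'rV[R]_l) (v : 'rV[R]_n) :
  row_mx q v *m inj123 l n = trip q v v.
Proof.
rewrite /inj123 mul_row_col mul_inj23 mul_mx_row mulmx0 mulmx1 /trip.
by rewrite add_row_mx addr0 add0r.
Qed.

Lemma bTE l n s (g : 'rV[R]_(l + (n + n)) -> 'rV[R]_s) p x :
  differentiable g (trip p x x) -> bT g p x = inj3 l n *m 'J g (trip p x x).
Proof.
move=> dg; rewrite /bT.
have aE h : trip p x (x + h) = trip p x x + h *m inj3 l n.
  by rewrite mul_inj3 -tripD !addr0.
have := @has_jacobian_affine _ _ _ _ _ g (trip p x) x _ _ 1%:M aE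
  (differentiable_has_jacobian dg).
move=> /has_jacobian_differentiable[_]; rewrite mulmx1 => <-.
by congr (jacobian _ x); apply/funext => z; rewrite mulmx1.
Qed.

Lemma mul_bT l n s (g : 'rV[R]_(l + (n + n)) -> 'rV[R]_s) p x v :
  differentiable g (trip p x x) ->
  v *m bT g p x = trip 0 0 v *m 'J g (trip p x x).
Proof. by move=> dg; rewrite bTE // mulmxA mul_inj3. Qed.

Lemma mul_jacobian_gtilde l n s (g : 'rV[R]_(l + (n + n)) -> 'rV[R]_s) p x q u :
  differentiable g (trip p x x) ->
  row_mx q u *m 'J (gtilde g) (row_mx p x) = trip q u u *m 'J g (trip p x x).
Proof.
move=> dg.
pose a (y : 'rV[R]_(l + n)) := trip (lsubmx y) (rsubmx y) (rsubmx y).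
have aE h : a (row_mx p x + h) = a (row_mx p x) + h *m inj123 l n.
  rewrite -{2}(hsubmxK h) mul_inj123 /a row_mxKl row_mxKr -tripD.
  by rewrite -{1 2 3}(hsubmxK h) add_row_mx row_mxKl row_mxKr.
have ax : a (row_mx p x) = trip p x x by rewrite /a row_mxKl row_mxKr.
have dga : has_jacobian g (a (row_mx p x)) ('J g (trip p x x)).
  by rewrite ax; exact: differentiable_has_jacobian.
have := @has_jacobian_affine _ _ _ _ _ g a _ _ _ 1%:M aE dga.
move=> /has_jacobian_differentiable[_]; rewrite mulmx1.
have -> : (fun y => g (a y) *m 1%:M) = gtilde g.
  by apply/funext => y; rewrite mulmx1.
by move=> ->; rewrite mulmxA mul_inj123.
Qed.

Lemma mul_jacobian_gtilde2 l n s (g : 'rV[R]_(l + (n + n)) -> 'rV[R]_s) p x u :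
  differentiable g (trip p x x) ->
  u *m 'J (fun x' : 'rV[R]_n => gtilde g (row_mx p x')) x =
  trip 0 u u *m 'J g (trip p x x).
Proof.
move=> dg.
have aE h : trip p (x + h) (x + h) = trip p x x + h *m inj23 l n.
  by rewrite mul_inj23 -tripD !addr0.
have := @has_jacobian_affine _ _ _ _ _ g (fun x => trip p x x) x _ _ 1%:M aE
  (differentiable_has_jacobian dg).
move=> /has_jacobian_differentiable[_]; rewrite mulmx1.
have -> : (fun y => g (trip p y y) *m 1%:M) = (fun x' => gtilde g (row_mx p x')).
  by apply/funext => y; rewrite mulmx1 /gtilde row_mxKl row_mxKr.
by move=> ->; rewrite mulmxA mul_inj23.
Qed.

(** The matrix of N |-> lam N^T in the coordinates [mxvec N]; it turns the term
    [b^T lam] of the Lagrangian into a linear function of the flattened Jacobian. *)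
Definition lmul_tr m s (lam : 'rV[R]_s) : 'M[R]_(m * s, m) :=
  lin1_mx (mulmx lam \o trmx \o vec_mx).

Lemma mxvec_lmul_tr m s (lam : 'rV[R]_s) (N : 'M[R]_(m, s)) :
  mxvec N *m lmul_tr m lam = lam *m N^T.
Proof. by rewrite /lmul_tr mul_rV_lin1 /= mxvecK. Qed.

(** The second derivative of g enters through the direction (0, u, u), because b(p, x)
    depends on x through both of the last two arguments of g. *)
Lemma dot_jacobian_Lagr l n s (f : 'rV[R]_(l + n) -> 'rV[R]_n)
    (g : 'rV[R]_(l + (n + n)) -> 'rV[R]_s) lam p x u v :
  C1 f -> C2 g ->
  dot v (u *m 'J (Lagr f g lam p) x) =
  dot v (row_mx 0 u *m 'J f (row_mx p x)) +
  dot lam (second_derivative g (trip p x x) (trip 0 u u) (trip 0 0 v)).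
Proof.
move=> [df _] gC2; have [dg _] := gC2.
have fE h : row_mx p (x + h) = row_mx p x + h *m row_mx 0 1%:M.
  by rewrite mul_mx_row mulmx0 mulmx1 add_row_mx addr0.
have aE h : trip p (x + h) (x + h) = trip p x x + h *m inj23 l n.
  by rewrite mul_inj23 -tripD !addr0.
have h1 := @has_jacobian_affine _ _ _ _ _ f (row_mx p) x _ _ 1%:M fE
  (differentiable_has_jacobian (df _)).
have h2 := @has_jacobian_affine _ _ _ _ _ (fun y => mxvec ('J g y))
  (fun x => trip p x x) x _ _ (lmul_tr _ lam *m (inj3 l n)^T) aE
  (C2_has_jacobian2 _ gC2).
have := has_jacobianD h1 h2; move=> /has_jacobian_differentiable[_].
have -> : (fun y => f (row_mx p y) *m 1%:M +
    mxvec ('J g (trip p y y)) *m (lmul_tr _ lam *m (inj3 l n)^T)) = Lagr f g lam p.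
  apply/funext => y; rewrite mulmx1 mulmxA mxvec_lmul_tr /Lagr bTE //.
  by rewrite trmx_mul mulmxA.
move=> ->; rewrite mulmxDr dotDr mulmx1; congr (_ + _).
  by rewrite mulmxA mul_mx_row mulmx0 mulmx1.
rewrite !mulmxA mul_inj23 -{1}[_ *m 'J _ _](@vec_mxK R) mxvec_lmul_tr.
by rewrite dotC dot_mulmx trmxK mul_inj3 dot_mulmx trmxK.
Qed.

End Blocks.

(** * Sufficiency *)

Section Sufficiency.
Context {R : realType}.

(** The critical cone is itself polyhedral, with the constraints [mu . v <= 0] and
    [- mu . v <= 0] in addition to the active ones. *)
Lemma tangent_critical m (L : seq ('rV[R]_m * R)) z mu w :
  polyhedron L z -> critical_cone (polyhedron L) z mu w ->
  tangent_cone (critical_cone (polyhedron L) z mu) w =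
  halfspaces [seq a <- active L z ++ [:: mu; - mu] | dot a w == 0].
Proof.
move=> Lz [wT wmu].
have KE : critical_cone (polyhedron L) z mu =
    polyhedron [seq (a, 0) | a <- active L z ++ [:: mu; - mu]].
  rewrite -halfspaces_polyhedron /critical_cone tangent_polyhedron //.
  apply/seteqP; split=> v.
    move=> [vA vmu] a; rewrite mem_cat !inE => /or3P[/vA//|/eqP ->|/eqP ->].
      by rewrite vmu.
    by rewrite dotNl vmu oppr0.
  move=> hv; split; first by move=> a aA; apply: hv; rewrite mem_cat aA.
  apply/eqP; rewrite eq_le hv ?mem_cat ?inE ?eqxx ?orbT //=.
  by rewrite -oppr_le0 -dotNl hv // mem_cat !inE eqxx !orbT.
have wK : critical_cone (polyhedron L) z mu w by [].
move: wK; rewrite KE => wK; rewrite tangent_polyhedron //; congr halfspaces.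
by rewrite /active filter_map -map_comp map_id.
Qed.

Lemma normal_ineq m (L : seq ('rV[R]_m * R)) z lam d :
  fgcone (active L z) lam -> polyhedron L d -> dot lam (d - z) <= 0.
Proof.
move=> lamA Ld; apply: fgcone_halfspaces lamA _ => a /mapP[p].
rewrite mem_filter => /andP[/eqP pz pL] ->.
by rewrite dotBr subr_le0 pz; exact: Ld.
Qed.

Lemma subregularity_points l n s (g : 'rV[R]_(l + (n + n)) -> 'rV[R]_s)
    (D : set 'rV[R]_s) (y0 : 'rV[R]_(l + (n + n))) (kappa : R) :
  0 < kappa ->
  (\forall y \near y0, (dist (pr3 y) (Gamma g D (pr1 y) (pr2 y))
     <= kappa%:E * dist (g y) D)%E) ->
  exists2 rho, 0 < rho & forall y, enorm (y - y0) < rho ->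
    forall d, D d -> forall e, 0 < e ->
    exists2 z', D (g (trip (pr1 y) (pr2 y) z')) &
      enorm (pr3 y - z') <= kappa * enorm (g y - d) + e.
Proof.
move=> k0 /nbhs_enormP[rho rho0 h]; exists rho => // y yr d Dd e e0.
by have [z' Gz' zz'] := dist_leP (ltW k0) (h y yr) Dd e0; exists z'.
Qed.

Lemma solution_multiplier l n s (f : 'rV[R]_(l + n) -> 'rV[R]_n)
    (g : 'rV[R]_(l + (n + n)) -> 'rV[R]_s) L (y0 : 'rV[R]_(l + (n + n)))
    (kappa rho : R) p x :
  (forall y, differentiable g y) -> 0 < kappa -> 0 < rho ->
  (forall y, enorm (y - y0) < rho ->
    forall d, polyhedron L d -> forall e, 0 < e ->
    exists2 z', polyhedron L (g (trip (pr1 y) (pr2 y) z')) &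
      enorm (pr3 y - z') <= kappa * enorm (g y - d) + e) ->
  enorm (trip p x x - y0) < rho / 2 ->
  Smap f g (polyhedron L) p x ->
  [/\ polyhedron L (g (trip p x x)) &
   exists lam, [/\ fgcone (active L (g (trip p x x))) lam,
     enorm lam <= kappa * enorm (f (row_mx p x)) &
     forall v, dot v (f (row_mx p x)) +
       dot lam (trip 0 0 v *m 'J g (trip p x x)) = 0]].
Proof.
move=> dg k0 rho0 subreg close [w wG fw].
have wE : w = - f (row_mx p x) by apply/eqP; rewrite -addr_eq0 addrC fw.
move: wG; rewrite /Gmap row_mxKl row_mxKr wE => wN.
have Lx : polyhedron L (g (trip p x x)) by case: wN.
split=> //.
have aE h : trip p x (x + h) = trip p x x + h *m inj3 l n.
  by rewrite mul_inj3 -tripD !addr0.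
have := @has_jacobian_affine _ _ _ _ _ g (trip p x) x _ _ 1%:M aE
  (differentiable_has_jacobian (dg _)).
rewrite mulmx1 (_ : (fun y => g (trip p x y) *m 1%:M) = (fun z => g (trip p x z))); last first.
  by apply/funext => z; rewrite mulmx1.
rewrite -bTE // => hjac.
have rho2 : 0 < rho / 2 by rewrite divr_gt0.
have [|lam [lamA lamM lamn]] := multiplier_bound hjac k0 rho2 _ wN.
- move=> z zx d Ld e e0.
  have [|z' Lz' zz'] := subreg (trip p x z) _ d Ld e e0.
    rewrite (_ : trip p x z - y0 = trip 0 0 (z - x) + (trip p x x - y0)).
      rewrite (le_lt_trans (enormD _ _)) // [rho]splitr ltrD //.
      rewrite (le_lt_trans (enorm_trip _ _ _)) // !enorm0 !add0r //.
    by rewrite addrA -tripD !add0r subrK.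
  by exists z'; move: Lz' zz'; rewrite !pr_tripE.
exists lam; split=> //; first by rewrite enormN in lamn.
move=> v; rewrite -mul_bT // dotC -(opprK (f _)) -lamM dotNl dot_mulmx trmxK.
by rewrite addNr.
Qed.

(** There are finitely many active sets, so one of them occurs eventually along an
    ultrafilter. The constants c are recorded to pass to the limit in the active
    constraints. *)
Lemma ultra_active T (U : set_system T) m (L : seq ('rV[R]_m * R))
    (z : T -> 'rV[R]_m) : UltraFilter U ->
  exists A, U [set k | active L (z k) = A] /\
    forall a, a \in A -> exists2 c, (a, c) \in L & U [set k | dot a (z k) = c].
Proof.
move=> UU; elim: L => [|p L [A [UA hA]]].
  by exists [::]; split => //; apply: filterE.
have [Up|Up] := in_ultra_setVsetC [set k | dot p.1 (z k) = p.2] UU.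
  exists (p.1 :: A); split.
    apply: filterS (filterI UA Up) => k [/= kA kp].
    by rewrite /active /= kp eqxx /= -kA.
  move=> a; rewrite inE => /orP[/eqP ->|/hA[c cL Uc]].
    by exists p.2; rewrite // -surjective_pairing mem_head.
  by exists c; rewrite // inE cL orbT.
exists A; split.
  apply: filterS (filterI UA Up) => k [/= kA /eqP/negbTE kp].
  by rewrite /active /= kp -kA.
by move=> a /hA[c cL Uc]; exists c; rewrite // inE cL orbT.
Qed.

Lemma scaled_ball m (x y : 'rV[R]_m) (r : R) : 0 <= r ->
  enorm (y - x) <= r ->
  [set x + r *: e | e in [set e : 'rV[R]_m | enorm e <= 1]] y.
Proof.
move=> r0 yr; have [rE|rn] := eqVneq r 0.
  exists 0; first by rewrite /= enorm0.
  rewrite scaler0 addr0; apply/eqP; rewrite eq_sym -subr_eq0; apply/eqP.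
  by apply: enorm_eq0; apply/eqP; rewrite eq_le enorm_ge0 andbT -rE.
have rp : 0 < r by rewrite lt_def rn.
exists (r^-1 *: (y - x)); last by rewrite scalerA divff // scale1r addrC subrK.
by rewrite /= enormZ ger0_norm ?invr_ge0 // ler_pdivrMl // mulr1.
Qed.

Lemma dot_eq_all m (a : 'rV[R]_m) : (forall v, dot v a = 0) -> a = 0.
Proof. by move=> h; exact/dot_eq0/h. Qed.

(** If isolated calmness fails, there are solutions (p_k, x_k) with
    [|p_k - pbar| = o(|x_k - xbar|)]. Their directions converge to (0, u), their bounded
    multipliers lam_k to some mu, and the active sets are eventually a fixed list A0.
    The values [g(y_k)] lie in the face of D orthogonal to the cone of A0, which contains
    mu and lam_k; expanding them to first and second order shows that mu belongs to
    [Lambda_tilde] for the direction u. For every admissible c,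
    [(lam_k - mu) . b c <= 0], and the difference of the stationarity equations at
    (p_k, x_k) and (pbar, xbar), divided by t_k and tested with c, gives in the limit
    that c is not a descent direction of the Lagrangian. *)
Theorem SOCIC_sufficient l n s (f : 'rV[R]_(l + n) -> 'rV[R]_n)
    (g : 'rV[R]_(l + (n + n)) -> 'rV[R]_s) (L : seq ('rV[R]_s * R))
    (pbar : 'rV[R]_l) (xbar : 'rV[R]_n) :
  C1 f -> C2 g -> Smap f g (polyhedron L) pbar xbar ->
  (exists2 kappa : R, 0 < kappa &
      \forall y \near trip pbar xbar xbar,
        (dist (pr3 y) (Gamma g (polyhedron L) (pr1 y) (pr2 y))
           <= kappa%:E * dist (g y) (polyhedron L))%E) ->
  SOCIC f g (polyhedron L) pbar xbar ->
  isolated_calm (Smap f g (polyhedron L)) pbar xbar.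
Proof.
move=> fC1 gC2 xbarS [kappa k0 hsub] socic; split=> //.
apply: contrapT => hn.
have [dg _] := gC2; have [df _] := fC1.
set ybar := trip pbar xbar xbar in hsub *.
set fbar := row_mx pbar xbar in xbarS *.
have [rho rho0 subreg] := subregularity_points k0 hsub.
(* bounds the values of f at the solutions, hence the multipliers *)
have [rf rf0 hrf] : exists2 r, 0 < r & forall y, enorm (y - fbar) < r ->
    enorm (f y - f fbar) < 1.
  have /cvg_enormP := differentiable_continuous (df fbar).
  by move=> /(_ 1 ltr01) /nbhs_enormP.
pose r0 := Num.min (rho / 2 / 3) (rf / 2).
have r00 : 0 < r0 by rewrite lt_min !divr_gt0.
have hk k : exists px : 'rV[R]_l * 'rV[R]_n,
    [/\ Smap f g (polyhedron L) px.1 px.2, enorm (px.1 - pbar) < r0,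
      enorm (px.2 - xbar) < r0, enorm (px.2 - xbar) < k.+1%:R^-1 &
      k.+1%:R * enorm (px.1 - pbar) < enorm (px.2 - xbar)].
  apply: contrapT => hk; apply: hn.
  exists [set x | enorm (x - xbar) < Num.min r0 k.+1%:R^-1],
    [set p | enorm (p - pbar) < r0], k.+1%:R; split=> //.
  - apply/nbhs_enormP; exists (Num.min r0 k.+1%:R^-1) => //.
    by rewrite lt_min r00 /= invr_gt0 ltr0Sn.
  - by apply/nbhs_enormP; exists r0.
  move=> p pV x [xS]; rewrite /= lt_min => /andP[xU1 xU2].
  apply: scaled_ball; first by rewrite mulr_ge0 ?enorm_ge0.
  rewrite leNgt; apply/negP => lt; apply: hk.
  by exists (p, x); split.
pose p_ k := (projT1 (cid (hk k))).1; pose x_ k := (projT1 (cid (hk k))).2.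
have pxP k : [/\ Smap f g (polyhedron L) (p_ k) (x_ k), enorm (p_ k - pbar) < r0,
      enorm (x_ k - xbar) < r0, enorm (x_ k - xbar) < k.+1%:R^-1 &
      k.+1%:R * enorm (p_ k - pbar) < enorm (x_ k - xbar)].
  exact: projT2 (cid (hk k)).
pose y_ k := trip (p_ k) (x_ k) (x_ k).
have yy k : enorm (y_ k - ybar) < rho / 2.
  have [_ h1 h2 _ _] := pxP k.
  rewrite -(scaleN1r ybar) -tripZ -tripD !scaleN1r.
  apply: (le_lt_trans (enorm_trip _ _ _)).
  have : r0 <= rho / 2 / 3 by rewrite ge_min lexx.
  lra.
have fy k : enorm (f (row_mx (p_ k) (x_ k))) <= enorm (f fbar) + 1.
  have [_ h1 h2 _ _] := pxP k.
  have : enorm (f (row_mx (p_ k) (x_ k)) - f fbar) < 1.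
    apply: hrf; rewrite opp_row_mx add_row_mx.
    apply: (le_lt_trans (enorm_row_mx_le _ _)).
    have : r0 <= rf / 2 by rewrite ge_min lexx orbT.
    lra.
  move=> h; rewrite -{1}(subrK (f fbar) (f _)) (le_trans (enormD _ _)) //.
  by rewrite addrC lerD2l ltW.
have hmul k := solution_multiplier dg k0 rho0 subreg (yy k)
  (let: And5 h _ _ _ _ := pxP k in h).
have Ly k : polyhedron L (g (y_ k)) by case: (hmul k).
have hlam k : exists lam, [/\ fgcone (active L (g (y_ k))) lam,
     enorm lam <= kappa * enorm (f (row_mx (p_ k) (x_ k))) &
     forall v, dot v (f (row_mx (p_ k) (x_ k))) +
       dot lam (trip 0 0 v *m 'J g (y_ k)) = 0] by case: (hmul k).
pose lam_ k := projT1 (cid (hlam k)).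
have lamP k : [/\ fgcone (active L (g (y_ k))) (lam_ k),
     enorm (lam_ k) <= kappa * enorm (f (row_mx (p_ k) (x_ k))) &
     forall v, dot v (f (row_mx (p_ k) (x_ k))) +
       dot (lam_ k) (trip 0 0 v *m 'J g (y_ k)) = 0].
  exact: projT2 (cid (hlam k)).
have lamb k : enorm (lam_ k) <= kappa * (enorm (f fbar) + 1).
  have [_ h _] := lamP k; apply: (le_trans h).
  by rewrite ler_wpM2l // ltW.
pose t_ k := enorm (x_ k - xbar).
have t0 k : 0 < t_ k.
  have [_ _ _ _ h] := pxP k; apply: le_lt_trans h.
  by rewrite mulr_ge0 ?enorm_ge0.
pose u_ k := (t_ k)^-1 *: (x_ k - xbar).
pose q_ k := (t_ k)^-1 *: (p_ k - pbar).
have u1 k : enorm (u_ k) = 1.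
  by rewrite enormZ normfV gtr0_norm // mulVf // lt0r_neq0.
have q1 k : enorm (q_ k) < k.+1%:R^-1.
  have [_ _ _ _ h] := pxP k.
  rewrite enormZ normfV gtr0_norm // ltr_pdivrMl // mulrC.
  by rewrite -ltr_pdivrMl ?invr_gt0 // invrK.
have [U [UU Uoo]] := @ultraFilterLemma _ (nbhs \oo) _.
have u1' k : enorm (u_ k) <= 1 by rewrite u1.
have [u uu] := ultra_bounded_cvg UU u1'.
have [mu muu] := ultra_bounded_cvg UU lamb.
have small (e : R) : 0 < e -> U [set k | k.+1%:R^-1 < e].
  by move=> e0; exact: (Uoo _ (harmonic_small e0)).
have qq : q_ @ U --> (0 : 'rV[R]_l).
  apply/cvg_enormP => e e0; apply: filterS (small e e0) => k /= h.
  by rewrite subr0; exact: lt_trans (q1 k) h.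
have tt : t_ @ U --> (0 : R).
  apply/cvgrPdist_lt => e e0; apply: filterS (small e e0) => k /= h.
  rewrite sub0r normrN gtr0_norm //; have [_ _ _ h' _] := pxP k.
  exact: lt_trans h' h.
have tn : \forall k \near U, t_ k != 0.
  by apply: filterE => k; rewrite lt0r_neq0.
have un0 : u != 0.
  have : 0 <= dot u u - 1.
    apply: (@limit_ge0 _ _ U _ (fun k => dot (u_ k) (u_ k) - 1)).
      by apply: cvgB; [exact: cvg_dot | exact: cvg_cst].
    by apply: filterE => k; rewrite -enorm_sqr u1 expr1n subrr.
  by apply: contraTneq => ->; rewrite dot0l sub0r oppr_ge0 ler10.
have vv : (fun k => trip (q_ k) (u_ k) (u_ k)) @ U --> trip (0 : 'rV[R]_l) u u.
  apply/cvg_enormP => e e0; have e2 : 0 < e / 3 by rewrite divr_gt0.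
  move/cvg_enormP : (uu) => /(_ _ e2) Uu; move/cvg_enormP : qq => /(_ _ e2) Uq.
  apply: filterS (filterI Uu Uq) => k [h1 h2].
  rewrite -(scaleN1r (trip _ _ _)) -tripZ -tripD !scaleN1r.
  apply: (le_lt_trans (enorm_trip _ _ _)); lra.
have wv : (fun k => row_mx (q_ k) (u_ k)) @ U --> row_mx (0 : 'rV[R]_l) u.
  apply/cvg_enormP => e e0; have e2 : 0 < e / 2 by rewrite divr_gt0.
  move/cvg_enormP : (uu) => /(_ _ e2) Uu; move/cvg_enormP : qq => /(_ _ e2) Uq.
  apply: filterS (filterI Uu Uq) => k [h1 h2].
  rewrite opp_row_mx add_row_mx; apply: (le_lt_trans (enorm_row_mx_le _ _)); lra.
pose v_ k := trip (q_ k) (u_ k) (u_ k); rewrite -/v_ in vv.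
pose v := trip (0 : 'rV[R]_l) u u; rewrite -/v in vv.
have yE k : y_ k = ybar + t_ k *: v_ k.
  rewrite -tripZ -tripD /y_ !scalerA !divff ?lt0r_neq0 // !scale1r.
  by rewrite ![_ + (_ - _)]addrC !subrK.
have pxE k : row_mx (p_ k) (x_ k) = fbar + t_ k *: row_mx (q_ k) (u_ k).
  rewrite scale_row_mx add_row_mx !scalerA !divff ?lt0r_neq0 // !scale1r.
  by rewrite ![_ + (_ - _)]addrC !subrK.
pose J := 'J g ybar; pose H := second_derivative g ybar.
have lim1 : (fun k => (t_ k)^-1 *: (g (y_ k) - g ybar)) @ U --> v *m J.
  have -> : (fun k => (t_ k)^-1 *: (g (y_ k) - g ybar)) =
      (fun k => (t_ k)^-1 *: (g (ybar + t_ k *: v_ k) - g ybar)).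
    by apply/funext => k; rewrite yE.
  exact: jacobian_lim (C2_has_jacobian _ gC2) tt tn vv.
have limf : (fun k => (t_ k)^-1 *: (f (row_mx (p_ k) (x_ k)) - f fbar)) @ U -->
    row_mx 0 u *m 'J f fbar.
  have -> : (fun k => (t_ k)^-1 *: (f (row_mx (p_ k) (x_ k)) - f fbar)) =
      (fun k => (t_ k)^-1 *: (f (fbar + t_ k *: row_mx (q_ k) (u_ k)) - f fbar)).
    by apply/funext => k; rewrite pxE.
  exact: jacobian_lim (differentiable_has_jacobian (df _)) tt tn wv.
have limJ : (fun k => (t_ k)^-1 *: (mxvec ('J g (y_ k)) - mxvec J)) @ U -->
    v *m 'J (fun x => mxvec ('J g x)) ybar.
  have -> : (fun k => (t_ k)^-1 *: (mxvec ('J g (y_ k)) - mxvec J)) =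
      (fun k => (t_ k)^-1 *: (mxvec ('J g (ybar + t_ k *: v_ k)) - mxvec J)).
    by apply/funext => k; rewrite yE.
  exact: jacobian_lim (C2_has_jacobian2 _ gC2) tt tn vv.
have lim2 : (fun k => (t_ k ^+ 2)^-1 *:
    (g (y_ k) - g ybar - (t_ k *: v_ k) *m J)) @ U --> 2^-1 *: H v v.
  have -> : (fun k => (t_ k ^+ 2)^-1 *:
      (g (y_ k) - g ybar - (t_ k *: v_ k) *m J)) = (fun k => (t_ k ^+ 2)^-1 *:
      (g (ybar + t_ k *: v_ k) - g ybar - (t_ k *: v_ k) *m J)).
    by apply/funext => k; rewrite yE.
  exact: taylor2_lim gC2 tt tn vv.
have yU : y_ @ U --> ybar.
  apply/cvg_enormP => e e0; have e3 : 0 < e / 3 by rewrite divr_gt0.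
  apply: filterS (small _ e3) => k /= h; have [_ _ _ h' _] := pxP k.
  rewrite yE addrC addrA addNr add0r enormZ gtr0_norm //.
  have : enorm (v_ k) <= 3.
    apply: (le_trans (enorm_trip _ _ _)); rewrite u1.
    have k1 : k.+1%:R^-1 <= 1 :> R by rewrite invf_le1 // ler1n.
    by have := le_trans (ltW (q1 k)) k1; lra.
  have tk : t_ k < e / 3 by exact: lt_trans h' h.
  have := t0 k; have := enorm_ge0 (v_ k); nra.
have gU : (fun k => g (y_ k)) @ U --> g ybar.
  exact: (cvg_comp _ _ yU (differentiable_continuous (dg ybar))).
have [A0 [UA hA0]] := ultra_active L (fun k => g (y_ k)) UU.
have lim1_dot a : (fun k => dot a ((t_ k)^-1 *: (g (y_ k) - g ybar))) @ U -->
    dot a (v *m J) by apply: cvg_dot => //; exact: cvg_cst.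
have gbarL : polyhedron L (g ybar).
  move=> p pL; rewrite -subr_le0.
  apply: (@limit_le0 _ _ U _ (fun k => dot p.1 (g (y_ k)) - p.2)).
    by apply: cvgB; [apply: cvg_dot => //; exact: cvg_cst | exact: cvg_cst].
  by apply: filterE => k; rewrite subr_le0; exact: Ly.
have A0c a : a \in A0 -> exists2 c, (a, c) \in L &
    dot a (g ybar) = c /\ U [set k | dot a (g (y_ k)) = c].
  move=> /hA0[c cL Uc]; exists c => //; split=> //.
  have lim : (fun k => dot a (g (y_ k)) - c) @ U --> dot a (g ybar) - c.
    by apply: cvgB; [apply: cvg_dot => //; exact: cvg_cst | exact: cvg_cst].
  have Uc0 : U [set k | dot a (g (y_ k)) - c = 0].
    by apply: filterS Uc => k /= ->; rewrite subrr.
  apply/eqP; rewrite -subr_eq0 eq_le; apply/andP; split.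
    by apply: limit_le0 lim _; apply: filterS Uc0 => k /= ->.
  by apply: limit_ge0 lim _; apply: filterS Uc0 => k /= ->.
have A0sub : {subset A0 <= active L (g ybar)}.
  move=> a /A0c[c cL [ac _]]; apply/mapP; exists (a, c) => //.
  by rewrite mem_filter /= ac eqxx.
have A0orth lam : fgcone A0 lam ->
    U [set k | dot lam (g (y_ k) - g ybar) = 0].
  move: lam; apply: fgcone_min.
    by apply: filterE => k /=; rewrite dot0l.
  move=> lam a c Ulam /A0c[d _ [ad Ud]] c0.
  apply: filterS (filterI Ulam Ud) => k [/= h1 h2].
  by rewrite dotDl dotZl h1 dotBr h2 ad subrr mulr0 addr0.
have A0W lam : fgcone A0 lam -> dot lam (v *m J) = 0.
  move=> /A0orth Ulam.
  have Ul : U [set k | dot lam ((t_ k)^-1 *: (g (y_ k) - g ybar)) = 0].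
    by apply: filterS Ulam => k /= h; rewrite dotZr h mulr0.
  apply/eqP; rewrite eq_le; apply/andP; split.
    by apply: limit_le0 (lim1_dot lam) _; apply: filterS Ul => k /= ->.
  by apply: limit_ge0 (lim1_dot lam) _; apply: filterS Ul => k /= ->.
have muA0 : fgcone A0 mu.
  have [B EB] := weyl A0; rewrite EB => b bB.
  apply: (@limit_le0 _ _ U _ (fun k => dot b (lam_ k))).
    by apply: cvg_dot => //; exact: cvg_cst.
  apply: filterS UA => k /= kA; have [h _ _] := lamP k.
  by move: h; rewrite kA EB; exact.
have muA : fgcone (active L (g ybar)) mu by exact: fgcone_sub muA0.
have WA : halfspaces (active L (g ybar)) (v *m J).
  move=> a aA; apply: limit_le0 (lim1_dot a) _; apply: filterE => k.
  rewrite dotZr mulr_ge0_le0 ?invr_ge0 ?(ltW (t0 k)) //.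
  by apply: normal_ineq (Ly k); exact: fgcone_mem.
have gE : gtilde g fbar = g ybar by rewrite /gtilde row_mxKl row_mxKr.
have JU : (fun k => mxvec ('J g (y_ k))) @ U --> mxvec J.
  have [_ [d2g _]] := gC2.
  exact: (cvg_comp _ _ yU (differentiable_continuous (d2g ybar))).
(* the product with c is a continuous function of mxvec N *)
have mulvec (c : 'rV[R]_(l + (n + n))) (N : 'M[R]_(l + (n + n), s)) :
    mxvec N *m lin1_mx (mulmx c \o vec_mx) = c *m N.
  by rewrite mul_rV_lin1 /= mxvecK.
have fU : (fun k => f (row_mx (p_ k) (x_ k))) @ U --> f fbar.
  have pxU : (fun k => row_mx (p_ k) (x_ k)) @ U --> fbar.
    apply/cvg_enormP => e e0; move/cvg_enormP : yU => /(_ _ e0).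
    apply: filterS => k; apply: le_lt_trans.
    rewrite -(scaleN1r ybar) -tripZ -tripD !scaleN1r opp_row_mx add_row_mx.
    by apply: ler_wsqrtr; rewrite !dot_row_mx lerD2l lerDl dot_ge0.
  exact: (cvg_comp _ _ pxU (differentiable_continuous (df fbar))).
have stat c : dot c (f fbar) + dot mu (trip 0 0 c *m J) = 0.
  have lim : (fun k => dot c (f (row_mx (p_ k) (x_ k))) +
      dot (lam_ k) (trip 0 0 c *m 'J g (y_ k))) @ U -->
      dot c (f fbar) + dot mu (trip 0 0 c *m J).
    apply: cvgD; first by apply: cvg_dot => //; exact: cvg_cst.
    apply: cvg_dot => //.
    under eq_fun do rewrite -mulvec.
    rewrite -mulvec.
    exact: (cvg_comp _ _ JU (@continuous_mulmxr _ _ _ _ _)).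
  have z k : dot c (f (row_mx (p_ k) (x_ k))) +
      dot (lam_ k) (trip 0 0 c *m 'J g (y_ k)) = 0.
    by have [_ _ h] := lamP k; exact: h.
  apply/eqP; rewrite eq_le; apply/andP; split.
    by apply: limit_le0 lim _; apply: filterE => k; rewrite z.
  by apply: limit_ge0 lim _; apply: filterE => k; rewrite z.
have muLt : Lambda_tilde g (polyhedron L) pbar xbar (- f fbar) 0 u mu.
  exists mu.
    split.
    - by rewrite -/fbar gE normal_polyhedron.
    - apply/eqP; rewrite -addr_eq0; apply/eqP; apply: dot_eq_all => c.
      rewrite dotDr addrC [X in _ + X]dotC dot_mulmx trmxK (mul_bT _ (dg _)).
      exact: stat.
    - rewrite -/fbar gE (mul_jacobian_gtilde _ _ (dg _)) -/ybar -/J -/v.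
      split; first by rewrite tangent_polyhedron.
      by rewrite /perp /=; exact: A0W.
  split; first by split=> //; rewrite normal_polyhedron.
  move=> lam' [lam'N lam'J]; rewrite !curvatureE //.
  rewrite normal_polyhedron // in lam'N.
  rewrite -/ybar -/v -subr_le0 -dotBl -(pmulr_rle0 _ (_ : 0 < 2^-1)) // -dotZr.
  apply: (@limit_le0 _ _ U _ (fun k => dot (lam' - mu) ((t_ k ^+ 2)^-1 *:
    (g (y_ k) - g ybar - (t_ k *: v_ k) *m J)))).
    by apply: cvg_dot; [exact: cvg_cst | exact: lim2].
  apply: filterS (A0orth _ muA0) => k /= muk.
  rewrite dotZr mulr_ge0_le0 ?invr_ge0 ?exprn_ge0 ?(ltW (t0 k)) //.
  have Jz : dot (lam' - mu) ((t_ k *: v_ k) *m J) = 0.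
    by rewrite dotC dot_mulmx mulmxBl lam'J subrr dot0r.
  rewrite dotBr Jz subr0 dotBl muk subr0.
  exact: normal_ineq lam'N (Ly k).
have wcrit : critical_cone (polyhedron L) (g ybar) mu (v *m J).
  by split; [rewrite tangent_polyhedron | exact: A0W].
have := socic u un0 mu muLt.
rewrite -/fbar gE (mul_jacobian_gtilde2 _ (dg _)) -/ybar -/v -/J.
move=> /(_ wcrit)[c [cT cneg]].
rewrite tangent_critical // (mul_bT _ (dg _)) -/ybar -/J in cT.
have muc : dot mu (trip 0 0 c *m J) = 0.
  have muW := A0W _ muA0.
  apply/eqP; rewrite eq_le -oppr_le0 -dotNl !cT //.
    by rewrite mem_filter dotNl muW oppr0 eqxx mem_cat !inE eqxx !orbT.
  by rewrite mem_filter muW eqxx mem_cat !inE eqxx !orbT.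
have lamc : U [set k | dot (lam_ k) (trip 0 0 c *m J) <= 0].
  apply: filterS UA => k /= kA; have [h _ _] := lamP k.
  rewrite kA in h; apply: fgcone_halfspaces h _ => a aA0; apply: cT.
  by rewrite mem_filter (A0W _ (fgcone_mem aA0)) eqxx mem_cat A0sub.
move: cneg; rewrite dot_jacobian_Lagr // -/fbar -/ybar -/v -/H ltNge => /negP; apply.
apply: (@limit_ge0 _ _ U _ (fun k =>
  dot c ((t_ k)^-1 *: (f (row_mx (p_ k) (x_ k)) - f fbar)) +
  dot (lam_ k) (trip 0 0 c *m vec_mx ((t_ k)^-1 *: (mxvec ('J g (y_ k)) - mxvec J))))).
  apply: cvgD; first by apply: cvg_dot => //; exact: cvg_cst.
  apply: cvg_dot => //.
  have mulvec' X : trip 0 0 c *m vec_mx X =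
      X *m lin1_mx (mulmx (trip 0 0 c) \o vec_mx) by rewrite mul_rV_lin1.
  under eq_fun do rewrite mulvec'.
  rewrite /H /second_derivative mulvec'.
  exact: (cvg_comp _ _ limJ (@continuous_mulmxr _ _ _ _ _)).
apply: filterS lamc => k /= lamck.
have [_ _ /(_ c) z] := lamP k; have sc := stat c; rewrite muc addr0 in sc.
have -> : vec_mx ((t_ k)^-1 *: (mxvec ('J g (y_ k)) - mxvec J)) =
    (t_ k)^-1 *: ('J g (y_ k) - J).
  by rewrite -linearB -linearZ mxvecK.
rewrite -scalemxAr !dotZr -mulrDr mulr_ge0 ?invr_ge0 ?(ltW (t0 k)) //.
rewrite mulmxBr !dotBr sc subr0 addrA z add0r oppr_ge0 //.
Qed.

End Sufficiency.

(** * Ingredients of the necessity part *)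

Section Necessity.
Context {R : realType}.

(** The vector xs is perturbed to a regular normal of Om at a point near z0, by minimizing
    [C |z - z0|^2 - xs . (z - z0)] over the points of Om in a ball. The hypothesis on
    the sphere keeps the minimizer in the interior of the ball. *)
Lemma nearby_normal m (Om : set 'rV[R]_m) (z0 xs zhat : 'rV[R]_m) (C r : R) :
  closed Om -> 0 < C -> 0 < r -> Om zhat -> enorm (zhat - z0) <= r ->
  (forall z, Om z -> enorm (z - z0) = r ->
     C * enorm (zhat - z0) ^+ 2 - dot xs (zhat - z0) < C * r ^+ 2 - dot xs (z - z0)) ->
  exists2 z, enorm (z - z0) < r & normal_cone Om z (xs - (2 * C) *: (z - z0)).
Proof.
move=> Omcl C0 r0 Oz zr sphere.
(* minimizing C |z - z0|^2 - xs . (z - z0) means projecting c *)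
pose c := z0 + (2 * C)^-1 *: xs.
have C2 : 0 < 2 * C by rewrite mulr_gt0.
have cE z : C * enorm (z - c) ^+ 2 = C * enorm (z - z0) ^+ 2 - dot xs (z - z0) +
    (4 * C)^-1 * dot xs xs.
  rewrite (_ : z - c = (z - z0) - (2 * C)^-1 *: xs); last by rewrite opprD addrA.
  rewrite !enorm_sqr; move: (z - z0) => h.
  by rewrite !dot_lin (dotC h xs); field; rewrite lt0r_neq0.
have bcl := @closed_enorm_ball _ _ z0 r.
have [|z [Omz zr'] zmin] := nearest_point c (closedI Omcl bcl).
  by exists zhat; split.
have zmin' y : Om y -> enorm (y - z0) <= r ->
    C * enorm (z - z0) ^+ 2 - dot xs (z - z0) <= C * enorm (y - z0) ^+ 2 - dot xs (y - z0).
  move=> Oy yr; have := zmin y (conj Oy yr).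
  rewrite -ler_sqr ?nnegrE ?enorm_ge0 // -(ler_pM2l C0) !cE; lra.
have zlt : enorm (z - z0) < r.
  rewrite lt_def zr' andbT; apply/negP => /eqP zE.
  have := sphere z Omz (esym zE); have := zmin' _ Oz zr; rewrite -zE; lra.
exists z => //.
rewrite (_ : _ - _ = (2 * C) *: (c - z)); last first.
  by rewrite /c; apply/rowP => i; rewrite !mxE; field; rewrite lt0r_neq0.
have [_ N] : normal_cone Om z (c - z).
  apply: (@proximal_normal _ _ _ _ _ (r - enorm (z - z0))) => //.
    by rewrite subr_gt0.
  move=> y Oy; rewrite ltrBrDr => yz; apply: zmin; split=> //=.
  have := enormD (y - z) (z - z0); rewrite addrA subrK => /le_trans; apply.
  exact: ltW.
by split=> // v /N h; rewrite dotZl pmulr_rle0.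
Qed.

Lemma cone_shift m (A : seq 'rV[R]_m) lam eta :
  fgcone A lam -> fgcone (A ++ [:: lam; - lam]) eta ->
  exists2 t1, 0 < t1 & forall t, 0 <= t -> t <= t1 -> fgcone A (lam + t *: eta).
Proof.
move=> lamA etaA.
have [c c0 cA] : exists2 c, 0 <= c & fgcone A (eta + c *: lam).
  move: eta etaA; apply: fgcone_min.
    by exists 0; rewrite // scale0r addr0; exact: fgcone0.
  move=> x a d [c c0 cA] aA d0.
  have [aA'|->|->] : [\/ a \in A, a = lam | a = - lam].
    move: aA; rewrite mem_cat !inE => /or3P[|/eqP|/eqP].
    - by constructor 1.
    - by constructor 2.
    - by constructor 3.
  - exists c => //; rewrite addrAC; apply: fgconeD => //.
    by apply: fgconeZ => //; exact: fgcone_mem.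
  - by exists c => //; rewrite addrAC; apply: fgconeD => //; exact: fgconeZ.
  - exists (c + d); first exact: addr_ge0.
    by rewrite scalerN scalerDl addrACA addNr addr0.
exists (1 + c)^-1; first by rewrite invr_gt0 ltr_pwDl.
move=> t t0; rewrite -[(1 + c)^-1]mul1r ler_pdivlMr ?ltr_pwDl // => tc.
rewrite (_ : _ + _ = (1 - t * c) *: lam + t *: (eta + c *: lam)).
  apply: fgconeD; apply: fgconeZ => //; rewrite subr_ge0.
  by apply: le_trans tc; rewrite mulrDr mulr1 lerDr.
by apply/rowP => i; rewrite !mxE; ring.
Qed.

(** Two uses of duality. Optimality of lam gives a feasible second-order correction
    zeta0 orthogonal to lam. It bounds the program that maximizes q over the cone with
    the line of lam added and with the image of eta prescribed; a maximizer eta' has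
    the same image as eta, and the multiplier zeta attached to it gives a correction
    orthogonal to both lam and eta'. *)
Lemma second_order_corrector m s (A : seq 'rV[R]_s) (J : 'M[R]_(m, s))
    (lam eta q : 'rV[R]_s) :
  fgcone A lam ->
  (forall lam', fgcone A lam' -> lam' *m J^T = lam *m J^T -> dot lam' q <= dot lam q) ->
  fgcone (A ++ [:: lam; - lam]) eta ->
  exists eta' zeta, [/\ fgcone (A ++ [:: lam; - lam]) eta',
    eta' *m J^T = eta *m J^T, halfspaces A (q + zeta *m J),
    dot lam (q + zeta *m J) = 0 & dot eta' (q + zeta *m J) = 0].
Proof.
move=> lamA lammax etaK.
have [zeta0 [z0A z0lam]] := dual_multiplier lamA lammax; rewrite trmxK in z0A z0lam.
have z0K : halfspaces (A ++ [:: lam; - lam]) (q + zeta0 *m J^T^T).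
  rewrite trmxK => a; rewrite mem_cat !inE => /or3P[/z0A//|/eqP ->|/eqP ->].
    by rewrite z0lam.
  by rewrite dotNl z0lam oppr0.
have [eta' [eta'K eta'J] etamax] := maximizer_attained etaK z0K.
have [|zeta [zK zeta']] := @dual_multiplier _ _ _ _ J^T eta' q eta'K.
  by move=> eta'' h; rewrite eta'J; exact: etamax.
rewrite trmxK in zK zeta'.
exists eta', zeta; split=> //; first by move=> a aA; apply: zK; rewrite mem_cat aA.
apply/eqP; rewrite eq_le zK ?mem_cat ?inE ?eqxx ?orbT //=.
by rewrite -oppr_le0 -dotNl zK // mem_cat !inE eqxx !orbT.
Qed.

(** A vector in the graphical derivative provides points at distance of order t from
    (p, x), in directions close to (0, u), where the inclusion holds up to o(t).
    Directional subregularity moves them by o(t) to solutions whose parameters are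
    at distance o(t) from p; isolated calmness puts these solutions at distance o(t)
    from x, although they are at distance about t |u|. *)
Lemma calm_subregular_contradiction l n
    (f : 'rV[R]_(l + n) -> 'rV[R]_n) (G : 'rV[R]_(l + n) -> set 'rV[R]_n)
    (p : 'rV[R]_l) (x u xi xs : 'rV[R]_n) :
  differentiable f (row_mx p x) -> u != 0 ->
  xs = - f (row_mx p x) -> xi = - (row_mx 0 u *m 'J f (row_mx p x)) ->
  graphical_derivative G (row_mx p x) xs (row_mx 0 u) xi ->
  metric_subregular_dir (fun y => [set f y + w | w in G y]) (row_mx 0 u)
    (row_mx p x) 0 ->
  isolated_calm (fun p' => [set x' | [set f (row_mx p' x') + w | w in G (row_mx p' x')] 0])
    p x -> False.
Proof.
move=> df u0 -> -> /tangent_coneP[_ tan] [_ [U [kappa [[rho [delta [rho0 delta0 hU]]] k0 sub]]]].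
move=> [_ [X [V [L0 [/nbhs_enormP[rX rX0 hX] /nbhs_enormP[rV rV0 hV] L00 calm]]]]].
pose m := row_mx (0 : 'rV[R]_l) u; pose P0 := row_mx p x.
pose Jf := 'J f P0; pose nJ := enorm (mxvec Jf).
have nJ0 : 0 <= nJ by exact: enorm_ge0.
have nu := enorm_gt0 u0.
have nm : enorm m = enorm u by rewrite /enorm dot_row_mx dot0l add0r.
pose K := kappa * (nJ + 1 + (enorm u + 1)) + 1.
have K0 : 1 <= K by rewrite lerDr mulr_ge0 // !addr_ge0 // ltW.
have [e [e0 e1 eu ed eK]] : exists e, [/\ 0 < e, e <= 1, e <= enorm u / 2,
    4 * e <= delta * enorm u & e * ((1 + K) * (1 + L0)) <= enorm u / 2].
  have d1 : 0 < (1 + K) * (1 + L0) by rewrite mulr_gt0 // ltr_pwDl // (le_trans ler01).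
  exists (Num.min (Num.min 1 (enorm u / 2))
    (Num.min (delta * enorm u / 4) (enorm u / 2 / ((1 + K) * (1 + L0))))).
  split.
  - by rewrite !lt_min ltr01 !divr_gt0 // mulr_gt0.
  - by rewrite !ge_min lexx.
  - by rewrite !ge_min lexx !orbT.
  - by rewrite mulrC -ler_pdivlMr // !ge_min lexx !orbT.
  - by rewrite -ler_pdivlMr // !ge_min lexx !orbT.
have [df0 df00 hdf] := differentiable_has_jacobian df e0.
pose B := enorm u + 1 + K.
have B0 : 0 < B by rewrite /B; lra.
pose e' := Num.min (Num.min e (rho / B)) (Num.min (df0 / B) (Num.min (rX / B) (rV / B))).
have e'0 : 0 < e' by rewrite !lt_min e0 !divr_gt0.
have [t [w [t0 te wu Gw]]] := tan e' e'0.
have te'' : t < e' by [].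
have te1 : t < e by rewrite (lt_le_trans te'') // !ge_min lexx.
have small a : 0 < a -> e' <= a / B -> t * B < a.
  by move=> a0 ea; rewrite -ltr_pdivlMr //; exact: lt_le_trans ea.
have tB1 : t * B < rho by apply: small => //; rewrite !ge_min lexx !orbT.
have tB2 : t * B < df0 by apply: small => //; rewrite !ge_min lexx !orbT.
have tB3 : t * B < rX by apply: small => //; rewrite !ge_min lexx !orbT.
have tB4 : t * B < rV by apply: small => //; rewrite !ge_min lexx !orbT.
pose xi0 := - (m *m Jf); pose m' := lsubmx w; pose xi' := rsubmx w.
have [me xie] : enorm (m' - m) < e /\ enorm (xi' - xi0) < e.
  have we : enorm (w - row_mx m xi0) < e by rewrite (lt_le_trans wu) // !ge_min lexx.
  have wE : w - row_mx m xi0 = row_mx (m' - m) (xi' - xi0).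
    by rewrite -{1}(hsubmxK w) opp_row_mx add_row_mx.
  by split; apply: le_lt_trans we; rewrite wE;
    [exact: enorm_row_mxl | exact: enorm_row_mxr].
have m'1 : enorm m' <= enorm u + e.
  by rewrite -(subrK m m') (le_trans (enormD _ _)) // nm addrC lerD2l ltW.
have m'2 : enorm u - e <= enorm m'.
  have := enormD (m - m') m'; rewrite subrK nm enormB; lra.
pose P := P0 + t *: m'.
have tm' : enorm (t *: m') <= t * (enorm u + 1).
  by rewrite enormZ gtr0_norm // ler_pM2l //; lra.
have tmB : enorm (t *: m') <= t * B.
  by apply: (le_trans tm'); rewrite ler_pM2l // /B lerDl (le_trans ler01).
have GP : G P (- f P0 + t *: xi').
  have := Gw; rewrite /gph /= -{1 2}(hsubmxK w) scale_row_mx add_row_mx.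
  by rewrite row_mxKl row_mxKr.
pose r := f P + (- f P0 + t *: xi').
have rle : enorm r <= t * (e * (nJ + 1 + (enorm u + 1))).
  rewrite (_ : r = (f P - f P0 - (t *: m') *m Jf) +
      t *: ((m' - m) *m Jf + (xi' - xi0))); last first.
    rewrite /r /xi0 mulmxBl -scalemxAl.
    move: (f P) (f P0) (m' *m Jf) (m *m Jf) => a1 a2 a3 a4.
    by apply/rowP => i; rewrite !mxE; ring.
  rewrite (le_trans (enormD _ _)) //.
  have h1 := hdf (t *: m') (ltW (le_lt_trans tmB tB2)); rewrite -/P -/P0 -/Jf in h1.
  have h2 := enormD ((m' - m) *m Jf) (xi' - xi0).
  have h3 := enorm_mulmx (m' - m) Jf; rewrite -/nJ in h3.
  have h4 : enorm (m' - m) * nJ <= e * nJ by rewrite ler_wpM2r // ltW.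
  have h5 := ler_wpM2l (ltW e0) tm'.
  have h6 : t * enorm ((m' - m) *m Jf + (xi' - xi0)) <= t * (e * nJ + e).
    by rewrite ler_pM2l //; lra.
  rewrite enormZ gtr0_norm //; lra.
have dirP : U (t *: m').
  apply: hU; split; first by apply: (le_trans tmB); exact: ltW.
  rewrite nm -/m.
  have -> : enorm u *: (t *: m') - enorm (t *: m') *: m =
      t *: (enorm u *: (m' - m) + (enorm m - enorm m') *: m).
    rewrite enormZ gtr0_norm // nm; move: (enorm u) (enorm m') => a b.
    by apply/rowP => i; rewrite !mxE; ring.
  rewrite !enormZ gtr0_norm // mulrCA ler_pM2l //.
  apply: (le_trans (enormD _ _)); rewrite !enormZ gtr0_norm // nm.
  have h1 : `|enorm u - enorm m'| <= e by rewrite ler_norml; apply/andP; split; lra.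
  have h2 := ler_wpM2l (ltW nu) (ltW me).
  have h3 := ler_wpM2r (ltW nu) h1.
  have h4 : delta * enorm u * (enorm u / 2) <= delta * enorm u * enorm m'.
    by rewrite ler_pM2l ?mulr_gt0 //; lra.
  have h5 := ler_wpM2r (ltW nu) ed; lra.
have [P'' M0 PP] := dist_leP k0 (sub _ dirP) (ex_intro2 _ _ _ GP erefl) (mulr_gt0 e0 t0).
rewrite sub0r enormN -/P0 -/P -/r in PP.
have PPK : enorm (P - P'') <= t * (e * K).
  apply: (le_trans PP); have := ler_wpM2l k0 rle; rewrite /K; lra.
have P''0 : enorm (P'' - P0) <= t * B.
  rewrite (_ : P'' - P0 = t *: m' - (P - P'')); last first.
    by rewrite /P opprB addrCA [P0 + _]addrC opprD addNKr.
  rewrite (le_trans (enormD _ _)) // enormN.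
  have : e * K <= K by rewrite ler_piMl // (le_trans ler01).
  by move/(ler_wpM2l (ltW t0)); rewrite /B; lra.
pose p'' := lsubmx P''; pose x'' := rsubmx P''.
have sE : row_mx (p'' - p) (x'' - x) = P'' - P0.
  by rewrite -[X in _ = X - _](hsubmxK P'') opp_row_mx add_row_mx.
have pV : V p''.
  apply: hV; apply: le_lt_trans (le_lt_trans P''0 tB4).
  by rewrite -sE; exact: enorm_row_mxl.
have xX : X x''.
  apply: hX; apply: le_lt_trans (le_lt_trans P''0 tB3).
  by rewrite -sE; exact: enorm_row_mxr.
have xle : enorm (x'' - x) <= L0 * enorm (p'' - p).
  have [|ee ee1 <-] := calm p'' pV x''.
    by split=> //=; rewrite hsubmxK.
  rewrite addrAC subrr add0r enormZ ger0_norm ?mulr_ge0 ?enorm_ge0 //.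
  by rewrite ler_piMr ?mulr_ge0 ?enorm_ge0.
have diffE : row_mx (p'' - p) (x'' - x) - t *: m = t *: (m' - m) - (P - P'').
  have alg (a b c d : 'rV[R]_(l + n)) : a - b - d = c - d - (b + c - a).
    by apply/rowP => i; rewrite !mxE; ring.
  by rewrite sE /P scalerBr; exact: alg.
clear sE.
have dle : enorm (row_mx (p'' - p) (x'' - x - t *: u)) <= t * (e * (1 + K)).
  have <- : row_mx (p'' - p) (x'' - x) - t *: m = row_mx (p'' - p) (x'' - x - t *: u).
    by rewrite /m scale_row_mx scaler0 opp_row_mx add_row_mx subr0.
  rewrite diffE {diffE} (le_trans (enormD _ _)) // enormN enormZ gtr0_norm //.
  have := ler_wpM2l (ltW t0) (ltW me); lra.
clear diffE.
have h1 := le_trans (enorm_row_mxl _ _) dle.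
have h2 := le_trans (enorm_row_mxr _ _) dle.
have h3 : t * enorm u <= enorm (x'' - x) + t * (e * (1 + K)).
  have := enormD (x'' - x) (- (x'' - x - t *: u)).
  by rewrite enormN opprB addrCA subrr addr0 enormZ gtr0_norm //; lra.
have h4 := ler_wpM2l L00 h1.
have : t * enorm u <= t * (enorm u / 2).
  have := ler_wpM2l (ltW t0) eK; lra.
rewrite ler_pM2l //; lra.
Qed.

End Necessity.

(** * Approximate normals along a second-order curve *)

Section Tangents.
Context {R : realType}.

Lemma enorm_near m (a b : 'rV[R]_m) c : enorm (a - b) <= c -> enorm a <= enorm b + c.
Proof.
by move=> h; rewrite -(subrK b a) (le_trans (enormD _ _)) // addrC lerD2l.
Qed.

Lemma enorm_trip3 l n (h : 'rV[R]_n) : enorm (trip (0 : 'rV[R]_l) 0 h) = enorm h.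
Proof. by rewrite /enorm !dot_row_mx !dot0l !add0r. Qed.

(** The matrix of N |-> lam N^T restricted to the third block: for N the Jacobian of g it
    gives [b^T lam] as a linear function of [mxvec N]. *)
Definition covec3 l n s (lam : 'rV[R]_s) : 'M[R]_((l + (n + n)) * s, n) :=
  lmul_tr _ lam *m (inj3 l n)^T.

Lemma dot_covec3 l n s (lam : 'rV[R]_s) (N : 'M[R]_(l + (n + n), s)) k :
  dot k (mxvec N *m covec3 l n lam) = dot lam (trip 0 0 k *m N).
Proof.
by rewrite mulmxA mxvec_lmul_tr dotC dot_mulmx trmxK mul_inj3 dot_mulmx trmxK.
Qed.

Lemma cvg_id_at_right0 : (fun t : R => t) @ 0^'+ --> (0 : R).
Proof. exact: cvg_at_right_filter. Qed.

Lemma near_at_right0_neq0 : \forall t \near (0 : R)^'+, t != 0.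
Proof.
by near=> t; rewrite lt0r_neq0 //; near: t; exact: nbhs_right_gt.
Unshelve. all: by end_near. Qed.

Lemma corrected_direction_cvg m (v zeta : 'rV[R]_m) :
  (fun t : R => v + (t / 2) *: zeta) @ 0^'+ --> v.
Proof.
have h : (fun t : R => v + (t / 2) *: zeta) @ 0^'+ --> v + (0 / 2 : R) *: zeta.
  apply: cvgD; first exact: cvg_cst.
  by apply: cvgZr_tmp; apply: cvgM; [exact: cvg_id_at_right0 | exact: cvg_cst].
by move: h; rewrite mul0r scale0r addr0.
Qed.

Lemma corrected_curve_cvg m (y0 v zeta : 'rV[R]_m) :
  (fun t : R => y0 + t *: (v + (t / 2) *: zeta)) @ 0^'+ --> y0.
Proof.
have h : (fun t : R => t *: (v + (t / 2) *: zeta)) @ 0^'+ --> (0 : R) *: v.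
  by apply: cvgZ; [exact: cvg_id_at_right0 | exact: corrected_direction_cvg].
by have := cvgD (cvg_cst y0) h; rewrite scale0r addr0; exact.
Qed.

(** Along the curve y(t), whose image under g stays within o(t^2) of D, the vector
    [xs t = b(y t)^T (lam + t eta)] is within O(e t) of a regular normal of the feasible
    set at a point within e t of y(t). The multiplier lam + t eta is normal to D at
    g y0 and orthogonal to d - g y0, where d is the second-order approximation of
    [g (y t)], so on the sphere of radius e t the linear form xs t is at most a fixed
    multiple of (e t)^2 plus o(t^2) on feasible points, and [nearby_normal] applies with a constant C that does not depend on e. *)
Lemma eventually_nearby_normal l n s (g : 'rV[R]_(l + (n + n)) -> 'rV[R]_s)
    (L : seq ('rV[R]_s * R)) (y0 v zeta : 'rV[R]_(l + (n + n))) (kappa rho : R)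
    (lam eta : 'rV[R]_s) :
  let J := 'J g y0 in let w := v *m J in
  let om := second_derivative g y0 v v + zeta *m J in
  let y t := y0 + t *: (v + (t / 2) *: zeta) in
  let xs t := mxvec ('J g (y t)) *m covec3 l n lam +
    t *: (mxvec ('J g (y t)) *m covec3 l n eta) in
  C2 g -> 0 < kappa -> 0 < rho ->
  (forall y, enorm (y - y0) < rho ->
    forall d, polyhedron L d -> forall e, 0 < e ->
    exists2 z', polyhedron L (g (trip (pr1 y) (pr2 y) z')) &
      enorm (pr3 y - z') <= kappa * enorm (g y - d) + e) ->
  polyhedron L (g y0) ->
  halfspaces (active L (g y0)) w -> halfspaces (active L (g y0)) om ->
  fgcone (active L (g y0)) lam ->
  fgcone (active L (g y0) ++ [:: lam; - lam]) eta ->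
  dot lam w = 0 -> dot lam om = 0 -> dot eta w = 0 -> dot eta om = 0 ->
  exists2 C, 0 < C & forall e, 0 < e -> \forall t \near 0^'+,
    exists2 z, enorm (z - pr3 (y t)) < e * t &
      Psi g (polyhedron L) (trip (pr1 (y t)) (pr2 (y t)) z)
        (xs t - (2 * C) *: (z - pr3 (y t))).
Proof.
move=> J w om y xs gC2 k0 rho0 subreg Ly0 wA omA lamA etaK lamw lamom etaw etaom.
have [dg _] := gC2.
have [C2' C20 hC2] := second_derivative_bound g y0.
pose Lb := enorm lam + enorm eta.
have Lb0 : 0 <= Lb by rewrite addr_ge0 ?enorm_ge0.
(* the curvature of [lam . g] on the sphere is at most C - 1 *)
pose C := Lb * C2' / 2 + 1.
have C0 : 0 < C by rewrite ltr_wpDl // divr_ge0 // mulr_ge0.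
exists C => // e e0.
pose V := enorm v + enorm zeta.
have V0 : 0 <= V by rewrite addr_ge0 ?enorm_ge0.
pose X := (enorm (mxvec J) + 1) *
  (enorm (mxvec (covec3 l n lam)) + enorm (mxvec (covec3 l n eta))).
have X0 : 0 <= X by rewrite mulr_ge0 ?addr_ge0 ?enorm_ge0.
have [e1 e10 e1e] : exists2 e1, 0 < e1 & Lb * e1 * (V + e) <= e / 4.
  have pL : 0 < 1 + Lb by rewrite ltr_pwDl.
  have pV : 0 < V + e by rewrite ltr_wpDl.
  have p : 0 < (1 + Lb) * (V + e) by exact: mulr_gt0.
  exists (e / 4 / ((1 + Lb) * (V + e))); first by rewrite !divr_gt0.
  have -> : Lb * (e / 4 / ((1 + Lb) * (V + e))) * (V + e) = e / 4 * (Lb / (1 + Lb)).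
    by field; rewrite !lt0r_neq0.
  rewrite ler_piMr ?divr_ge0 ?(ltW e0) // ler_pdivrMr // mul1r.
  by rewrite lerDr.
pose S := C * (kappa + 1) ^+ 2 + X * (kappa + 1) + Lb.
have k10 : 0 < kappa + 1 by rewrite ltr_pwDl.
have S0 : 0 <= S.
  have C0' := ltW C0; have k10' := ltW k10.
  by rewrite addr_ge0 // addr_ge0 // mulr_ge0 // exprn_ge0.
have [e2 [e20 e21 e2k e2S]] : exists e2, [/\ 0 < e2, e2 <= 1, (kappa + 1) * e2 <= e
    & S * e2 <= e ^+ 2 / 4].
  have p : 0 < 1 + S by rewrite ltr_pwDl.
  exists (Num.min 1 (Num.min (e / (kappa + 1)) (e ^+ 2 / 4 / (1 + S)))); split.
  - by rewrite !lt_min ltr01 !divr_gt0 // exprn_gt0.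
  - by rewrite ge_min lexx.
  - by rewrite mulrC -ler_pdivlMr // !ge_min lexx !orbT.
  - apply: (@le_trans _ _ ((1 + S) * (e ^+ 2 / 4 / (1 + S)))).
      apply: ler_pM => //; first by rewrite !le_min ler01 !divr_ge0 ?exprn_ge0 ?ltW.
        by rewrite lerDr.
      by rewrite !ge_min lexx !orbT.
    by rewrite mulrCA divff ?mulr1 // lt0r_neq0.
have [d1 d10 hd1] := taylor2 y0 gC2 e10.
have [dD dD0 hdD] := polyhedron_local Ly0.
have [t1 t10 ht1] := cone_shift lamA etaK.
have tid := cvg_id_at_right0; have tn0 := near_at_right0_neq0.
have vt := @corrected_direction_cvg _ v zeta.
have lim2 : (fun t : R => (t ^+ 2)^-1 *: (g (y t) - g y0 -
    (t *: (v + (t / 2) *: zeta)) *m J)) @ 0^'+ --> 2^-1 *: second_derivative g y0 v v.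
  exact: taylor2_lim gC2 tid tn0 vt.
move/cvg_enormP : lim2 => /(_ e2 e20) E2.
have ylim : y @ 0^'+ --> y0 by exact: corrected_curve_cvg.
have JU : (fun t => mxvec ('J g (y t))) @ 0^'+ --> mxvec J.
  have [_ [d2g _]] := gC2.
  exact: (cvg_comp _ _ ylim (differentiable_continuous (d2g y0))).
move/cvg_enormP : JU => /(_ 1 ltr01) EJ.
have tle a : 0 < a -> \forall t \near (0 : R)^'+, t <= a.
  by move=> a0; exact: nbhs_right_le.
have pVe : 0 < V + e by rewrite ltr_wpDl.
have pw : 0 < 1 + (enorm w + enorm om) by rewrite ltr_pwDl // addr_ge0 ?enorm_ge0.
near=> t.
have t0 : 0 < t by near: t; exact: nbhs_right_gt.
have t_1 : t <= 1 by near: t; exact: tle.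
have t_t1 : t <= t1 by near: t; exact: tle.
have t_d1 : t * (V + e) <= d1.
  by rewrite -ler_pdivlMr //; near: t; apply: tle; rewrite divr_gt0.
have t_rho : t * (V + e) <= rho / 2.
  by rewrite -ler_pdivlMr //; near: t; apply: tle; rewrite !divr_gt0.
have t_dD : t * (1 + (enorm w + enorm om)) <= dD.
  by rewrite -ler_pdivlMr //; near: t; apply: tle; rewrite divr_gt0.
have E2t : enorm ((t ^+ 2)^-1 *: (g (y t) - g y0 -
    (t *: (v + (t / 2) *: zeta)) *m J) - 2^-1 *: second_derivative g y0 v v) < e2.
  by near: t.
have EJt : enorm (mxvec ('J g (y t)) - mxvec J) < 1 by near: t.
have t20 : 0 < t ^+ 2 by rewrite exprn_gt0.
have th2 : 0 <= t / 2 by rewrite divr_ge0 // ltW.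
have th2' : t / 2 <= 1 by rewrite ler_pdivrMr // mul1r (le_trans t_1) // ler1n.
(* d is the point of D that g (y t) approximates to second order *)
pose d := g y0 + t *: (w + (t / 2) *: om).
have gd : enorm (g (y t) - d) <= e2 * t ^+ 2.
  have alg (G G0 A B Q : 'rV[R]_s) : G - (G0 + t *: (A + (t / 2) *: (Q + B))) =
     (t ^+ 2) *: ((t ^+ 2)^-1 *: (G - G0 - t *: (A + (t / 2) *: B)) - 2^-1 *: Q).
    by apply/rowP => i; rewrite !mxE; field; rewrite lt0r_neq0.
  rewrite /d /om (alg _ _ _ (zeta *m J)) enormZ gtr0_norm // mulrC ler_pM2r //.
  apply/ltW; apply: le_lt_trans E2t.
  have <- : (t *: (v + (t / 2) *: zeta)) *m J = t *: (w + (t / 2) *: (zeta *m J)).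
    by rewrite -scalemxAl mulmxDl -scalemxAl.
  exact: lexx.
have dL : polyhedron L d.
  apply/hdD; last first.
    apply: halfspacesZ; first exact: ltW.
    by apply: halfspacesD => //; exact: halfspacesZ.
  apply: le_trans t_dD; rewrite enormZ gtr0_norm // ler_pM2l //.
  apply: (le_trans (enormD _ _)); rewrite enormZ ger0_norm //.
  have := enorm_ge0 om; have := enorm_ge0 w; nra.
pose lamt := lam + t *: eta.
have lamtA : fgcone (active L (g y0)) lamt by apply: ht1 => //; exact: ltW.
have lamtd : dot lamt (d - g y0) = 0.
  rewrite /d addrAC subrr add0r /lamt dotDl !dotZl !dotZr !dotDr !dotZr.
  by rewrite lamw lamom etaw etaom !(mulr0, addr0).
have lamtb : enorm lamt <= Lb.
  rewrite (le_trans (enormD _ _)) // lerD2l enormZ gtr0_norm //.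
  by rewrite ler_piMl ?enorm_ge0.
have yb : enorm (y t - y0) <= t * V.
  rewrite /y addrAC subrr add0r enormZ gtr0_norm // ler_pM2l //.
  rewrite (le_trans (enormD _ _)) // lerD2l enormZ ger0_norm //.
  by rewrite ler_piMl ?enorm_ge0.
have xsE k : dot k (xs t) = dot lamt (trip 0 0 k *m 'J g (y t)).
  by rewrite /xs dotDr dotZr !dot_covec3 /lamt dotDl dotZl.
have xsX : enorm (xs t) <= X.
  have h1 := enorm_mulmx (mxvec ('J g (y t))) (covec3 l n lam).
  have h2 := enorm_mulmx (mxvec ('J g (y t))) (covec3 l n eta).
  have h3 : enorm (mxvec ('J g (y t))) <= enorm (mxvec J) + 1.
    exact: enorm_near (ltW EJt).
  have h4 : t * enorm (mxvec ('J g (y t)) *m covec3 l n eta) <=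
      enorm (mxvec ('J g (y t)) *m covec3 l n eta) by rewrite ler_piMl ?enorm_ge0.
  rewrite /xs (le_trans (enormD _ _)) // enormZ gtr0_norm // /X mulrDr.
  apply: lerD.
    by apply: (le_trans h1); rewrite ler_wpM2r ?enorm_ge0.
  apply: (le_trans h4); apply: (le_trans h2).
  by rewrite ler_wpM2r ?enorm_ge0.
pose z0 := pr3 (y t).
have yE h : trip (pr1 (y t)) (pr2 (y t)) (z0 + h) = y t + trip 0 0 h.
  by rewrite -{3}(trip_pr (y t)) -tripD !addr0.
pose Om := [set z | polyhedron L (g (trip (pr1 (y t)) (pr2 (y t)) z))].
have Omcl : closed Om.
  apply: (@preimage_closed _ _ (fun z => g (trip (pr1 (y t)) (pr2 (y t)) z))
    (polyhedron L)); last exact: polyhedron_closed.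
  move=> z _; apply: differentiable_continuous.
  have aE h : trip (pr1 (y t)) (pr2 (y t)) (z + h) =
      trip (pr1 (y t)) (pr2 (y t)) z + h *m inj3 l n.
    by rewrite mul_inj3 -tripD !addr0.
  have := @has_jacobian_affine _ _ _ _ _ g (trip (pr1 (y t)) (pr2 (y t))) z _ _ 1%:M aE
    (differentiable_has_jacobian (dg _)).
  move=> /has_jacobian_differentiable[+ _].
  by under eq_fun do rewrite mulmx1.
have tV : t * V <= t * (V + e) by rewrite ler_pM2l // lerDl ltW.
have yrho : enorm (y t - y0) < rho.
  apply: (le_lt_trans yb); apply: (le_lt_trans tV); apply: (le_lt_trans t_rho).
  by rewrite ltr_pdivrMr // ltr_pMr // ltr1n.
have [zh Lzh zhd] := subreg (y t) yrho d dL (e2 * t ^+ 2) (mulr_gt0 e20 t20).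
pose a := (kappa + 1) * e2 * t ^+ 2.
have zha : enorm (zh - z0) <= a.
  rewrite enormB (le_trans zhd) //; have := ler_wpM2l (ltW k0) gd; rewrite /a; lra.
have a0 : 0 <= a by exact: le_trans (enorm_ge0 _) zha.
pose r := e * t.
have r0 : 0 < r by rewrite mulr_gt0.
have ar : a <= r.
  apply: (le_trans (ler_wpM2r (ltW t20) e2k)).
  by rewrite expr2 mulrA ler_piMr // ltW.
have [||z zr zN] := @nearby_normal _ _ Om z0 (xs t) zh C r Omcl C0 r0 Lzh.
- exact: le_trans zha ar.
- move=> z Lz zr; pose h := z - z0.
  have hr : enorm h = r by [].
  pose H := trip (0 : 'rV[R]_l) 0 h.
  have Hr : enorm H = r by rewrite enorm_trip3.
  have zE : trip (pr1 (y t)) (pr2 (y t)) z = y t + H.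
    by rewrite -yE /h addrC subrK.
  have yH : enorm (y t + H - y0) <= d1.
    rewrite addrAC (le_trans (enormD _ _)) // Hr (le_trans _ t_d1) //.
    by rewrite mulrDr /r (mulrC e) lerD2r.
  have := hd1 (y t) H (le_trans yb (le_trans tV t_d1)) yH.
  set T := (X in enorm X <= _); rewrite Hr => Tb.
  have TE : H *m 'J g (y t) = g (y t + H) - g y0 - (d - g y0) - (g (y t) - d) - T -
      2^-1 *: second_derivative g y0 H H.
    rewrite /T; move: (g (y t + H)) (g y0) (d) (g (y t)) (H *m _) (2^-1 *: _).
    by move=> b1 b2 b3 b4 b5 b6; apply/rowP => i; rewrite !mxE; ring.
  have dxs : dot (xs t) h <= Lb * (e2 * t ^+ 2) +
      Lb * (e1 * r * (t * V + r)) + Lb * (C2' * r * r / 2).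
    have sp (A B G T0 S1 : 'rV[R]_s) : dot lamt (A - B - G - T0 - S1) =
        dot lamt A - dot lamt B - dot lamt G - dot lamt T0 - dot lamt S1.
      by rewrite !dotBr.
    rewrite dotC xsE -/H TE sp lamtd subr0.
    have i1 : dot lamt (g (y t + H) - g y0) <= 0.
      by apply: normal_ineq lamtA _; rewrite -zE.
    have cs u b : enorm u <= b -> - dot lamt u <= Lb * b.
      move=> ub; have := cauchy_schwarz lamt (- u); rewrite dotNr enormN => /le_trans.
      by apply; apply: ler_pM; rewrite ?enorm_ge0.
    have i2 := cs _ _ gd.
    have i3 : - dot lamt T <= Lb * (e1 * r * (t * V + r)).
      apply: cs; apply: (le_trans Tb); apply: ler_wpM2l; last by rewrite lerD2r.
      by rewrite mulr_ge0 // ltW.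
    have i4 : - dot lamt (2^-1 *: second_derivative g y0 H H) <= Lb * (C2' * r * r / 2).
      apply: cs; rewrite enormZ ger0_norm ?invr_ge0 // mulrC ler_wpM2r ?invr_ge0 //.
      by have := hC2 H H; rewrite Hr.
    rewrite -[leRHS]add0r !addrA; apply: lerD i4; apply: lerD i3.
    exact: lerD i1 i2.
  (* every error term is a small multiple of t ^+ 2, while C leaves e ^+ 2 * t ^+ 2 *)
  have j1 : C * enorm (zh - z0) ^+ 2 <= C * (kappa + 1) ^+ 2 * e2 * t ^+ 2.
    have -> : C * (kappa + 1) ^+ 2 * e2 * t ^+ 2 =
        C * ((kappa + 1) ^+ 2 * (e2 * t ^+ 2)) by ring.
    rewrite ler_pM2l //; apply: (@le_trans _ _ (a ^+ 2)).
      by rewrite ler_sqr ?nnegrE ?enorm_ge0.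
    have et0 : 0 <= e2 * t ^+ 2 by rewrite mulr_ge0 // ltW.
    have et1 : e2 * t ^+ 2 <= 1.
      by rewrite mulr_ile1 ?(ltW e20) ?(ltW t20) // expr_le1 // ltW.
    have -> : a ^+ 2 = (kappa + 1) ^+ 2 * ((e2 * t ^+ 2) * (e2 * t ^+ 2)).
      by rewrite /a; ring.
    by rewrite ler_wpM2l ?exprn_ge0 ?(ltW k10) // ler_piMr.
  have j2 : - dot (xs t) (zh - z0) <= X * (kappa + 1) * e2 * t ^+ 2.
    have := cauchy_schwarz (- xs t) (zh - z0); rewrite dotNl enormN => /le_trans; apply.
    have -> : X * (kappa + 1) * e2 * t ^+ 2 = X * a by rewrite /a; ring.
    by apply: ler_pM; rewrite ?enorm_ge0.
  have j3 : S * e2 * t ^+ 2 <= e ^+ 2 / 4 * t ^+ 2 by rewrite ler_pM2r.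
  have j4 : Lb * (e1 * r * (t * V + r)) <= e ^+ 2 / 4 * t ^+ 2.
    have -> : Lb * (e1 * r * (t * V + r)) = Lb * e1 * (V + e) * (e * t ^+ 2).
      by rewrite /r; ring.
    have -> : e ^+ 2 / 4 * t ^+ 2 = e / 4 * (e * t ^+ 2) by ring.
    by rewrite ler_wpM2r // mulr_ge0 // ltW.
  have j5 : C * r ^+ 2 = Lb * (C2' * r * r / 2) + e ^+ 2 * t ^+ 2.
    by rewrite /C /r; field.
  have j6 : 0 < e ^+ 2 * t ^+ 2 by rewrite mulr_gt0 // exprn_gt0.
  move: j1 j2 j3 j4 dxs j6; rewrite j5 /S.
  move: (C * enorm (zh - z0) ^+ 2) (dot (xs t) (zh - z0)) (dot (xs t) h)
    (Lb * (e1 * r * (t * V + r))) (Lb * (C2' * r * r / 2)) => b1 b2 b3 b4 b5.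
  clear; move: (e ^+ 2) (t ^+ 2) => ee tt; move: (C * _) (X * _) => b6 b7; lra.
by exists z => //; split; move: zN; rewrite /Psi /Gamma !pr_tripE => -[].
Unshelve. all: by end_near. Qed.

End Tangents.

(** * Necessity and the theorem *)

Section Main.
Context {R : realType}.

(** One inclusion of the formula for the graphical derivative of Psi: the points
    of [eventually_nearby_normal], as e tends to 0, realize the tangent vector. *)
Lemma graphical_derivative_Psi l n s (g : 'rV[R]_(l + (n + n)) -> 'rV[R]_s)
    (L : seq ('rV[R]_s * R)) (y0 v zeta : 'rV[R]_(l + (n + n))) (kappa rho : R)
    (lam eta : 'rV[R]_s) :
  let J := 'J g y0 in let w := v *m J in
  let om := second_derivative g y0 v v + zeta *m J in
  let xs := mxvec J *m covec3 l n lam in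
  let xi := (v *m 'J (fun y => mxvec ('J g y)) y0) *m covec3 l n lam +
    mxvec J *m covec3 l n eta in
  C2 g -> 0 < kappa -> 0 < rho ->
  (forall y, enorm (y - y0) < rho ->
    forall d, polyhedron L d -> forall e, 0 < e ->
    exists2 z', polyhedron L (g (trip (pr1 y) (pr2 y) z')) &
      enorm (pr3 y - z') <= kappa * enorm (g y - d) + e) ->
  polyhedron L (g y0) ->
  halfspaces (active L (g y0)) w -> halfspaces (active L (g y0)) om ->
  fgcone (active L (g y0)) lam ->
  fgcone (active L (g y0) ++ [:: lam; - lam]) eta ->
  dot lam w = 0 -> dot lam om = 0 -> dot eta w = 0 -> dot eta om = 0 ->
  Psi g (polyhedron L) y0 xs ->
  graphical_derivative (Psi g (polyhedron L)) y0 xs v xi.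
Proof.
move=> J w om xs0 xi gC2 k0 rho0 subreg Ly0 wA omA lamA etaK lamw lamom etaw etaom psi0.
have [C C0 ev] := eventually_nearby_normal gC2 k0 rho0 subreg Ly0 wA omA lamA etaK
  lamw lamom etaw etaom.
apply/tangent_coneP; split; first by rewrite /gph /= row_mxKl row_mxKr.
move=> e e0.
pose e1 := e / (4 * (1 + 2 * C)).
have c0 : 0 < 1 + 2 * C by rewrite ltr_pwDl // mulr_ge0 // ltW.
have e10 : 0 < e1 by rewrite divr_gt0 // mulr_gt0.
have e4 : 0 < e / 4 by rewrite divr_gt0.
have {ev} E1 := ev e1 e10.
pose y (t : R) := y0 + t *: (v + (t / 2) *: zeta).
pose xs (t : R) := mxvec ('J g (y t)) *m covec3 l n lam +
    t *: (mxvec ('J g (y t)) *m covec3 l n eta).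
have tid := @cvg_id_at_right0 R; have tn0 := @near_at_right0_neq0 R.
have vt := @corrected_direction_cvg _ _ v zeta.
have ylim : y @ 0^'+ --> y0 by exact: corrected_curve_cvg.
have JU : (fun t => mxvec ('J g (y t))) @ 0^'+ --> mxvec J.
  have [_ [d2g _]] := gC2.
  exact: (cvg_comp _ _ ylim (differentiable_continuous (d2g y0))).
have limJ : (fun t : R => t^-1 *: (mxvec ('J g (y t)) - mxvec J)) @ 0^'+ -->
    v *m 'J (fun x => mxvec ('J g x)) y0.
  exact: jacobian_lim (C2_has_jacobian2 _ gC2) tid tn0 vt.
have limxs : (fun t : R => (t^-1 *: (mxvec ('J g (y t)) - mxvec J)) *m covec3 l n lam +
    mxvec ('J g (y t)) *m covec3 l n eta) @ 0^'+ --> xi.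
  apply: cvgD.
    exact: (cvg_comp _ _ limJ (@continuous_mulmxr _ _ _ _ _)).
  exact: (cvg_comp _ _ JU (@continuous_mulmxr _ _ _ _ _)).
move/cvg_enormP : limxs => /(_ _ e4) E2.
move/cvg_enormP : vt => /(_ _ e4) E3.
have E4 : \forall t \near (0 : R)^'+, 0 < t /\ t < e.
  by near=> t; split; near: t; [exact: nbhs_right_gt | exact: nbhs_right_lt].
have [t [[[[z zy zN] xst] vte] [t0 te]]] :=
  filter_ex (filterI (filterI (filterI E1 E2) E3) E4).
rewrite -/(y t) in zy zN; rewrite -/(xs t) in zN.
set h := z - pr3 (y t) in zy zN.
have yE : trip (pr1 (y t)) (pr2 (y t)) z = y t + trip 0 0 h.
  by rewrite -{3}(trip_pr (y t)) -tripD !addr0 /h addrC subrK.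
pose u1 := v + (t / 2) *: zeta + t^-1 *: trip 0 0 h.
pose u2 := (t^-1 *: (mxvec ('J g (y t)) - mxvec J)) *m covec3 l n lam +
    mxvec ('J g (y t)) *m covec3 l n eta - t^-1 *: ((2 * C) *: h).
have he : t^-1 * enorm h < e1 by rewrite ltr_pdivrMl // mulrC.
exists t, (row_mx u1 u2); split=> //.
  rewrite opp_row_mx add_row_mx; apply: (le_lt_trans (enorm_row_mx_le _ _)).
  have i1 : enorm (u1 - v) < e / 4 + e1.
    rewrite /u1 addrAC; apply: (le_lt_trans (enormD _ _)); apply: ltrD => //.
    by rewrite enormZ normfV gtr0_norm // enorm_trip3.
  have i2 : enorm (u2 - xi) < e / 4 + 2 * C * e1.
    rewrite /u2 addrAC; apply: (le_lt_trans (enormD _ _)); apply: ltrD => //.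
    rewrite enormN !enormZ normfV !gtr0_norm ?mulr_gt0 // mulrCA ltr_pM2l //.
    exact: mulr_gt0.
  have e1E : e1 * (1 + 2 * C) = e / 4 by rewrite /e1; field; rewrite lt0r_neq0.
  move: (enorm (u1 - v)) (enorm (u2 - xi)) i1 i2 e1E e0 => a b; clear; lra.
rewrite /gph /= scale_row_mx add_row_mx row_mxKl row_mxKr.
have -> : y0 + t *: u1 = trip (pr1 (y t)) (pr2 (y t)) z.
  by rewrite yE /u1 scalerDr scalerA divff ?lt0r_neq0 // scale1r addrA.
have -> : xs0 + t *: u2 = xs t - (2 * C) *: h.
  have alg (a b c h' : 'rV[R]_n) :
      a + t *: (t^-1 *: (b - a) + c - t^-1 *: h') = b + t *: c - h'.
    by apply/rowP => i; rewrite !mxE; field; rewrite lt0r_neq0.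
  by rewrite /xs0 /xs /u2 -scalemxAl mulmxBl; exact: alg.
exact: zN.
Unshelve. all: by end_near. Qed.

(** If the condition fails at u and lam, the normal eta of the critical cone at w is
    replaced by some eta' with the same image under J^T for which a second-order
    corrector exists; b^T eta' = b^T eta, so [- D_x f u] belongs to the graphical
    derivative of Psi, hence of G, in the direction (0, u). Subregularity of M then
    contradicts isolated calmness. *)
Theorem SOCIC_necessary l n s (f : 'rV[R]_(l + n) -> 'rV[R]_n)
    (g : 'rV[R]_(l + (n + n)) -> 'rV[R]_s) (L : seq ('rV[R]_s * R))
    (pbar : 'rV[R]_l) (xbar : 'rV[R]_n) :
  C1 f -> C2 g -> Smap f g (polyhedron L) pbar xbar ->
  (exists2 kappa : R, 0 < kappa &
      \forall y \near trip pbar xbar xbar,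
        (dist (pr3 y) (Gamma g (polyhedron L) (pr1 y) (pr2 y))
           <= kappa%:E * dist (g y) (polyhedron L))%E) ->
  (forall u : 'rV[R]_n, u != 0 ->
      graphical_derivative (Gmap g (polyhedron L)) (row_mx pbar xbar)
        (- f (row_mx pbar xbar)) (row_mx 0 u)
      = graphical_derivative (Psi g (polyhedron L)) (trip pbar xbar xbar)
          (- f (row_mx pbar xbar)) (trip 0 u u)
      /\ metric_subregular_dir (Mmap f g (polyhedron L)) (row_mx 0 u)
           (row_mx pbar xbar) 0) ->
  isolated_calm (Smap f g (polyhedron L)) pbar xbar ->
  SOCIC f g (polyhedron L) pbar xbar.
Proof.
move=> fC1 gC2 xbarS [kappa k0 hsub] hyp calm gx u un0 w0 lam [mu muXi [lamL lammax]].
have [dg _] := gC2; have [df _] := fC1.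
set ybar := trip pbar xbar xbar in hsub hyp lamL lammax *.
set fbar := row_mx pbar xbar in xbarS hyp muXi *.
have gE : gtilde g fbar = g ybar by rewrite /gtilde row_mxKl row_mxKr.
have [rho rho0 subreg] := subregularity_points k0 hsub.
pose J := 'J g ybar; pose v := trip (0 : 'rV[R]_l) u u.
have w0E : w0 = v *m J by rewrite /w0 (mul_jacobian_gtilde2 _ (dg _)).
rewrite /gx gE w0E => wcrit; apply: contrapT => hn.
pose A := active L (g ybar).
have [lamN lamJ] := lamL.
have Lg : polyhedron L (g ybar) by case: lamN.
rewrite normal_polyhedron // -/A in lamN.
have [muN mux _] := muXi.
have [wA wlam] := wcrit; rewrite tangent_polyhedron // -/A in wA.
pose LK := A ++ [:: lam; - lam].
pose LK' := [seq a <- LK | dot a (v *m J) == 0].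
pose bt := (bT g pbar xbar)^T.
pose ell := u *m 'J (Lagr f g lam pbar) xbar.
have btE (a : 'rV[R]_s) k : dot k (a *m bt) = dot a (trip 0 0 k *m J).
  by rewrite /bt dotC dot_mulmx trmxK (mul_bT _ (dg _)).
(* by Farkas' lemma, if no c is admissible then the derivative of the Lagrangian is
   balanced by a normal eta of the critical cone *)
have [eta etaK etal] : exists2 eta, fgcone LK' eta & eta *m bt = - ell.
  apply: fgcone_map; apply: farkas => c hc; rewrite dotNl oppr_le0 leNgt.
  apply/negP => cneg; apply: hn; exists c; split; last by rewrite dotC.
  rewrite tangent_critical // => a aK.
  have := hc _ (map_f (fun a : 'rV_s => a *m bt) aK).
  by rewrite dotC btE (mul_bT _ (dg _)).
have etaLK : fgcone LK eta.
  by apply: fgcone_sub etaK => a; rewrite mem_filter => /andP[].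
have etaw : dot eta (v *m J) = 0.
  move: eta etaK {etal etaLK}; apply: fgcone_min; first by rewrite /= dot0l.
  move=> x a c /= xw; rewrite mem_filter => /andP[/eqP aw _] _.
  by rewrite dotDl dotZl xw aw mulr0 addr0.
pose q := second_derivative g ybar v v.
have lamq lam' : fgcone A lam' -> lam' *m J^T = lam *m J^T -> dot lam' q <= dot lam q.
  move=> lam'A lam'J; have := lammax lam'; rewrite !curvatureE //; apply.
  by split; [rewrite normal_polyhedron | rewrite lam'J].
have [eta' [zeta [eta'K eta'J omA lamom etaom]]] :=
  second_order_corrector lamN lamq etaLK.
have eta'w : dot eta' (v *m J) = 0.
  by rewrite -etaw ![dot _ (v *m J)]dotC !dot_mulmx eta'J.
have xsE : mxvec J *m covec3 l n lam = - f fbar.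
  rewrite -mux; apply/eqP; rewrite -subr_eq0; apply/eqP; apply: dot_eq_all => k.
  rewrite dotBr dot_covec3 -/bt btE ![dot _ (trip 0 0 k *m J)]dotC !dot_mulmx.
  by rewrite lamJ subrr.
have xiE : (v *m 'J (fun y => mxvec ('J g y)) ybar) *m covec3 l n lam +
    mxvec J *m covec3 l n eta' = - (row_mx 0 u *m 'J f fbar).
  apply/eqP; rewrite -subr_eq0 opprK; apply/eqP; apply: dot_eq_all => k.
  rewrite !dotDr dot_covec3.
  have -> : dot eta' (trip 0 0 k *m J) = - dot k ell.
    rewrite -dotNr -etal btE ![dot _ (trip 0 0 k *m J)]dotC !dot_mulmx.
    by rewrite eta'J.
  rewrite /ell dot_jacobian_Lagr // -/fbar -/ybar -/v.
  have -> : dot k ((v *m 'J (fun y => mxvec ('J g y)) ybar) *m covec3 l n lam) =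
      dot lam (second_derivative g ybar v (trip 0 0 k)).
    by rewrite -[v *m _ in LHS](@vec_mxK R) dot_covec3.
  by rewrite -addrA [- (_ + _) + _]addrC opprD addNKr subrr.
have psi0 : Psi g (polyhedron L) ybar (mxvec J *m covec3 l n lam).
  rewrite xsE /Psi /ybar !pr_tripE.
  have [w wG fw] := xbarS; move: wG; rewrite /Gmap row_mxKl row_mxKr.
  by have -> : w = - f fbar by apply/eqP; rewrite -addr_eq0 addrC fw.
have := graphical_derivative_Psi gC2 k0 rho0 subreg Lg wA omA lamN eta'K wlam lamom
  eta'w etaom psi0.
rewrite xiE xsE; have [<- msub] := hyp u un0 => DG.
exact: (calm_subregular_contradiction (df fbar) un0 erefl erefl DG msub calm).
Qed.

End Main.

Theorem theorem5p2 (R : realType) (l n s : nat)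
    (f : 'rV[R]_(l + n) -> 'rV[R]_n)
    (g : 'rV[R]_(l + (n + n)) -> 'rV[R]_s)
    (D : set 'rV[R]_s) (pbar : 'rV[R]_l) (xbar : 'rV[R]_n)
    (f_C1 : C1 f) (g_C2 : C2 g) (D_poly : convex_polyhedral D)
    (xbar_sol : Smap f g D pbar xbar)
    (g_subreg : exists2 kappa : R, 0 < kappa &
      \forall y \near trip pbar xbar xbar,
        (dist (pr3 y) (Gamma g D (pr1 y) (pr2 y))
           <= kappa%:E * dist (g y) D)%E) :
  (SOCIC f g D pbar xbar -> isolated_calm (Smap f g D) pbar xbar) /\
  ((forall u : 'rV[R]_n, u != 0 ->
      graphical_derivative (Gmap g D) (row_mx pbar xbar)
        (- f (row_mx pbar xbar)) (row_mx 0 u)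
      = graphical_derivative (Psi g D) (trip pbar xbar xbar)
          (- f (row_mx pbar xbar)) (trip 0 u u)
      /\ metric_subregular_dir (Mmap f g D) (row_mx 0 u)
           (row_mx pbar xbar) 0) ->
   isolated_calm (Smap f g D) pbar xbar -> SOCIC f g D pbar xbar).
Proof.
have [L DE] := convex_polyhedralP D_poly; subst D.
by split; [exact: SOCIC_sufficient | exact: SOCIC_necessary].
Qed.
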